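(* Let $D\subset\mathbb R^d$, $d\in\{1,2,3\}$, be a bounded Lipschitz domain, $X:=H_0^1(D)$ with norm $\|v\|_X:=\|\nabla v\|_{L^2(D)}$, $X':=H^{-1}(D)$, and $f\in X'$. Let $a_0\in L^\infty_+(D)$, and let $\psi_j\in L^\infty(D)$, $j\ge1$, be such that $b_j:=\|\psi_j\|_{L^\infty(D)}$ satisfies $b_1\ge b_2\ge\cdots$ and $\boldsymbol b:=(b_j)_{j\ge1}\in\ell^p(\mathbb N)$ for some $p\in(0,1)$. Let $$a(\boldsymbol x,\boldsymbol y)=a_0(\boldsymbol x)\exp\bigg(\sum_{j=1}^\infty y_j\psi_j(\boldsymbol x)\bigg),\qquad \boldsymbol x\in D,\ \boldsymbol y\in U_{\boldsymbol b},$$ and, for $\boldsymbol y\in U_{\boldsymbol b}$, let $u(\cdot,\boldsymbol y)\in X$ be the unique solution of $$\int_D a(\boldsymbol x,\boldsymbol y)\nabla u(\boldsymbol x,\boldsymbol y)\cdot\nabla v(\boldsymbol x)\,{\rm d}\boldsymbol x=\langle f,v\rangle_{X',X}\quad\text{for all } v\in X,$$ and $u_s(\cdot,\boldsymbol y):=u(\cdot,(\boldsymbol y_{\le s},\mathbf 0))$. Let either $\beta\in(1,\infty)$, or $\beta=1$ and $b_j<1$ for all $j\ge1$. Then $$\bigg\|\int_{\mathbb R^{\mathbb N}}(u(\cdot,\boldsymbol y)-u_s(\cdot,\boldsymbol y))\,\boldsymbol\mu_\beta({\rm d}\boldsymbol y)\bigg\|_X=\mathcal O(s^{-\frac2p+1}),$$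 where the implied coefficient is independent of the dimension $s$. Moreover, if $D$ is a bounded polyhedron and $\{X_h\}_h$ is a family of conforming finite element subspaces $X_h\subset X$, indexed by the mesh size $h>0$, and $u_h(\cdot,\boldsymbol y),u_{s,h}(\cdot,\boldsymbol y)\in X_h$ denote the finite element solutions corresponding to $u(\cdot,\boldsymbol y)$ and $u_s(\cdot,\boldsymbol y)$, then also $$\bigg\|\int_{\mathbb R^{\mathbb N}}(u_h(\cdot,\boldsymbol y)-u_{s,h}(\cdot,\boldsymbol y))\,\boldsymbol\mu_\beta({\rm d}\boldsymbol y)\bigg\|_X=\mathcal O(s^{-\frac2p+1}),$$ where the implied coefficient is independent of the dimension $s$.
   Context: $L^\infty_+(D)$ denotes the set of functions in $L^\infty(D)$ whose essential infimum over $D$ is positive. $\langle\cdot,\cdot\rangle_{X',X}$ is the duality pairing. For a nonnegative sequence $\boldsymbol b\in\ell^1(\mathbb N)$, $U_{\boldsymbol b}:=\{\boldsymbol y\in\mathbb R^{\mathbb N}:\sum_{j\ge1}b_j|y_j|<\infty\}$. For $\boldsymbol y\in\mathbb R^{\mathbb N}$ and $s\in\mathbb N$, $(\boldsymbol y_{\le s},\mathbf 0):=(y_1,\dots,y_s,0,0,\dots)$. For $\beta\ge1$, $\boldsymbol\mu_\beta:=\bigotimes_{j\ge1}\mathcal N_\beta(0,1)$ is the product probability measure on $\mathbb R^{\mathbb N}$, where $\mathcal N_\beta(0,1)$ has density $\varphi_\beta(y):=\frac{1}{2\beta^{1/\beta}\Gamma(1+\frac1\beta)}{\rm e}^{-|y|^\beta/\beta}$,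 $y\in\mathbb R$ (the case $\beta=2$ is the standard Gaussian, i.e. the lognormal model). One has $\boldsymbol\mu_\beta(U_{\boldsymbol b})=1$, and integrals over $\mathbb R^{\mathbb N}$ of functions defined on $U_{\boldsymbol b}$ are understood as (Bochner) integrals over $U_{\boldsymbol b}$. A conforming finite element subspace $X_h$ is a finite-dimensional subspace of $X$. The finite element solution $u_h(\cdot,\boldsymbol y)\in X_h$ is the unique element of $X_h$ satisfying $\int_D a(\boldsymbol x,\boldsymbol y)\nabla u_h(\boldsymbol x,\boldsymbol y)\cdot\nabla v_h(\boldsymbol x)\,{\rm d}\boldsymbol x=\langle f,v_h\rangle_{X',X}$ for all $v_h\in X_h$, and $u_{s,h}(\cdot,\boldsymbol y):=u_h(\cdot,(\boldsymbol y_{\le s},\mathbf 0))$. The notation $=\mathcal O(s^{-\frac2p+1})$ means bounded by $C s^{-\frac2p+1}$ for all $s\in\mathbb N$, with $C>0$ independent of $s$. *)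

(* Defs.v *)
From HB Require Import structures.
From mathcomp Require Import all_boot all_order all_algebra.
From mathcomp Require Import all_classical all_reals all_analysis ess_sup_inf.
Set Implicit Arguments.
Unset Strict Implicit.
Unset Printing Implicit Defensive.
Import Order.TTheory GRing.Theory Num.Theory.
Import numFieldNormedType.Exports.

Local Open Scope classical_set_scope.
Local Open Scope ring_scope.

Section MeasurableRow.
Context {R : realType}.
Variable n : nat.

(* The product sigma-algebra, which is also the Borel sigma-algebra of R^n. *)
Let coord (i : 'I_n) (v : 'rV[R]_n) : measurableTypeR R := v ord0 i.

Let rV_set0 : g_sigma_preimage coord set0.
Proof. exact: sigma_algebra0. Qed.

Let rV_setC A : g_sigma_preimage coord A -> g_sigma_preimage coord (~` A).
Proof. exact: sigma_algebraC. Qed.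

Let rV_bigcup (F : _^nat) : (forall i, g_sigma_preimage coord (F i)) ->
  g_sigma_preimage coord (\bigcup_i (F i)).
Proof. exact: sigma_algebra_bigcup. Qed.

HB.instance Definition _ := @isMeasurable.Build default_measure_display
  'rV[R]_n (g_sigma_preimage coord) rV_set0 rV_setC rV_bigcup.

Lemma measurable_coord_rV (i : 'I_n) :
  measurable_fun [set: 'rV[R]_n] (fun v => v ord0 i : measurableTypeR R).
Proof.
move=> _ Y mY; rewrite setTI; apply: sub_sigma_algebra => /=.
rewrite -bigcup_seq/=; exists i => /=; first by rewrite mem_index_enum.
by exists Y => //; rewrite setTI.
Qed.

Lemma measurable_fun_rV d0 (T : measurableType d0) (f : T -> 'rV[R]_n) :
  (forall i, measurable_fun [set: T] (fun t => f t ord0 i : measurableTypeR R)) ->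
  measurable_fun [set: T] f.
Proof.
move=> mf _ A; rewrite setTI; move: A.
pose G : set (set 'rV[R]_n) := fun A => measurable (f @^-1` A).
suff : (g_sigma_preimage coord) `<=` G by [].
apply: smallest_sub.
  split; rewrite /G /=.
  - by rewrite preimage_set0; exact: measurable0.
  - by move=> A mA; rewrite setTD preimage_setC; exact: measurableC.
  - by move=> F mF; rewrite preimage_bigcup; exact: bigcup_measurable.
move=> A; rewrite -bigcup_seq/= => -[i _ [B mB <-]].
rewrite setTI /G -[X in measurable X]setTI; exact: mf.
Qed.

End MeasurableRow.

Section LebesgueRow.
Context {R : realType}.

Definition cons_rV n (p : measurableTypeR R * 'rV[R]_n) : 'rV[R]_n.+1 :=
  \row_i oapp (p.2 ord0) p.1 (unlift ord0 i).

Lemma measurable_cons_rV n : measurable_fun setT (@cons_rV n).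
Proof.
apply: measurable_fun_rV => i.
have [j ij|ij] := unliftP ord0 i.
  rewrite (_ : (fun t => _) =
    (fun v : 'rV[R]_n => v ord0 j : measurableTypeR R) \o snd).
    apply: measurableT_comp => //; exact: measurable_coord_rV.
  by apply/funext => t; rewrite /cons_rV mxE ij liftK.
rewrite (_ : (fun t => _) = fst)//.
by apply/funext => t; rewrite /cons_rV mxE ij unlift_none.
Qed.

Definition uncons_rV n (v : 'rV[R]_n.+1) : measurableTypeR R * 'rV[R]_n :=
  (v ord0 ord0, \row_j v ord0 (lift ord0 j)).

Lemma measurable_uncons_rV n : measurable_fun setT (@uncons_rV n).
Proof.
apply/measurable_fun_pairP; split; rewrite /comp/=.
  exact: (measurable_coord_rV ord0).
apply: measurable_fun_rV => i.
rewrite (_ : (fun t => _) =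
  (fun v : 'rV[R]_n.+1 => v ord0 (lift ord0 i) : measurableTypeR R)).
  exact: measurable_coord_rV.
by apply/funext => t; rewrite /= mxE.
Qed.

Lemma cons_rVK n : cancel (@cons_rV n) (@uncons_rV n).
Proof.
move=> [x v]; rewrite /cons_rV /uncons_rV mxE unlift_none /=; congr pair.
by apply/rowP => j; rewrite !mxE liftK.
Qed.

Section lebesgue_rV_succ.
Variables (n : nat) (m : {sigma_finite_measure set 'rV[R]_n -> \bar R}).

Definition lebesgue_rV_succ : set 'rV[R]_n.+1 -> \bar R :=
  pushforward (lebesgue_measure \x m)%E (@cons_rV n).

Let mu0 : lebesgue_rV_succ set0 = 0%E.
Proof. by rewrite /lebesgue_rV_succ /pushforward preimage_set0 measure0. Qed.

Let mu_ge0 A : (0 <= lebesgue_rV_succ A)%E.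
Proof. by rewrite /lebesgue_rV_succ /pushforward measure_ge0. Qed.

Let mu_sigma_additive : semi_sigma_additive lebesgue_rV_succ.
Proof.
move=> F mF tF mUF; rewrite /lebesgue_rV_succ /pushforward preimage_bigcup.
have mc A : measurable A -> measurable (@cons_rV n @^-1` A).
  by move=> mA; rewrite -[X in measurable X]setTI; exact: measurable_cons_rV.
apply: measure_semi_sigma_additive.
- by move=> k; exact: mc.
- apply/trivIsetP => /= i j _ _ ij; rewrite -preimage_setI.
  by move/trivIsetP : tF => /(_ _ _ _ _ ij) ->//; rewrite preimage_set0.
- by rewrite -preimage_bigcup; exact: mc.
Qed.

HB.instance Definition _ := isMeasure.Build _ _ _ lebesgue_rV_succ
  mu0 mu_ge0 mu_sigma_additive.

Let mu_sigma_finite : sigma_finite setT lebesgue_rV_succ.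
Proof.
have /sigma_finiteP[F [TF ndF Foo]] := sigma_finiteT (@lebesgue_measure R).
have /sigma_finiteP[G [TG ndG Goo]] := sigma_finiteT m.
exists (fun k => @uncons_rV n @^-1` (F k `*` G k)).
  apply/esym; rewrite -subTset => v _.
  have [i _ Fi] : (\bigcup_i F i) (uncons_rV v).1 by rewrite -TF.
  have [j _ Gj] : (\bigcup_i G i) (uncons_rV v).2 by rewrite -TG.
  exists (maxn i j) => //; split => /=.
    by move: Fi; exact/subsetPset/ndF/leq_maxl.
  by move: Gj; exact/subsetPset/ndG/leq_maxr.
move=> k; have [mF Ffin] := Foo k; have [mG Gfin] := Goo k; split.
  rewrite -[X in measurable X]setTI; apply: measurable_uncons_rV => //.
  exact: measurableX.
rewrite /lebesgue_rV_succ /pushforward -comp_preimage.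
rewrite (_ : _ \o _ = id) ?preimage_id; last first.
  by apply/funext => x; exact: cons_rVK.
by rewrite product_measure1E// lte_mul_pinfty// ge0_fin_numE.
Qed.

HB.instance Definition _ := @Measure_isSigmaFinite.Build _ _ _
  lebesgue_rV_succ mu_sigma_finite.

End lebesgue_rV_succ.

Fixpoint lebesgue_rV n : {sigma_finite_measure set 'rV[R]_n -> \bar R} :=
  if n is n'.+1 then lebesgue_rV_succ (lebesgue_rV n')
  else \d_(0 : 'rV[R]_0).

End LebesgueRow.

(* Elements of the Lebesgue and Sobolev spaces over D are represented by
   functions on the whole of R^d of which only the restriction to D matters;
   functions that agree almost everywhere on D represent the same element. *)

Section FunctionSpaces.
Context {R : realType} {d : nat}.
Local Notation leb := (@lebesgue_rV R d).
Implicit Types (D : set 'rV[R]_d) (u v g phi : 'rV[R]_d -> R) (i : 'I_d).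

Definition Lspace_on (q : \bar R) D v : Prop := (v \_ D) \in Lfun leb q.

Definition Linf_norm D v : R := fine (Lnorm leb +oo (EFin \o (v \_ D))).

(* Extending by +oo outside D makes this the essential infimum over D. *)
Definition ess_inf_on D v : \bar R :=
  ess_inf leb (patch (fun=> +oo%E) D (EFin \o v)).

Definition Linf_plus D v := Lspace_on +oo D v /\ (0 < ess_inf_on D v)%E.

Definition partial i v : 'rV[R]_d -> R := 'D_(delta_mx ord0 i) v.

(* All iterated partial derivatives are (Frechet) differentiable. *)
Definition smooth v :=
  forall (s : seq 'I_d) x, differentiable (foldr partial v s) x.

Definition test_function D phi :=
  [/\ smooth phi, compact (closure [set x | phi x != 0])
    & closure [set x | phi x != 0] `<=` D].

Definition is_weak_partial D i v g :=
  forall phi, test_function D phi ->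
  \int[leb]_(x in D) (v x * partial i phi x) =
  - \int[leb]_(x in D) (g x * phi x).

Definition H1 D v := Lspace_on 2%:E D v /\
  forall i, exists g, Lspace_on 2%:E D g /\ is_weak_partial D i v g.

(* A representative of the weak derivative; it is unique up to a.e. equality
   on D. *)
Definition weak_partial D i v : 'rV[R]_d -> R :=
  xget (fun=> 0) [set g | Lspace_on 2%:E D g /\ is_weak_partial D i v g].

Definition grad_dot D u v (x : 'rV[R]_d) : R :=
  \sum_(i < d) weak_partial D i u x * weak_partial D i v x.

Definition H1_norm D v : R :=
  Num.sqrt (\int[leb]_(x in D) (v x ^+ 2) + \int[leb]_(x in D) grad_dot D v v x).

(* H^1_0(D) is the closure of the test functions in H^1(D). *)
Definition H10 D : set ('rV[R]_d -> R) := [set v | H1 D v /\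
  forall eps : R, 0 < eps ->
    exists phi, test_function D phi /\ H1_norm D (v \- phi) < eps].

Definition H10_norm D v : R := Num.sqrt (\int[leb]_(x in D) grad_dot D v v x).

Definition H10_dual D (f : ('rV[R]_d -> R) -> R) :=
  (forall (c : R) u v, H10 D u -> H10 D v ->
     f (fun x => c * u x + v x) = c * f u + f v) /\
  exists K : R, forall v, H10 D v -> `|f v| <= K * H10_norm D v.

Definition finite_dim_subspace D (V : set ('rV[R]_d -> R)) :=
  exists (m : nat) (e : 'I_m -> 'rV[R]_d -> R), (forall k, H10 D (e k)) /\
    V = [set v | H10 D v /\ exists c : 'I_m -> R,
           {ae leb, forall x, D x -> v x = \sum_(k < m) c k * e k x}].

Definition variational_solution D (a : 'rV[R]_d -> R)
    (f : ('rV[R]_d -> R) -> R) (V : set ('rV[R]_d -> R)) u :=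
  V u /\ forall v, V v ->
    \int[leb]_(x in D) (a x * grad_dot D u v x) = f v.

End FunctionSpaces.

Definition lipschitz_domain {R : realType} {d : nat} (D : set 'rV[R]_d) :=
  [/\ open D, connected D, D !=set0, bounded_set D &
    forall x0, (closure D `\` D) x0 ->
    (* In rotated coordinates z, D is locally the set of points above the
       graph of a Lipschitz function of the coordinates other than z_j. *)
    exists (j : 'I_d) (Q : 'M[R]_d) (gamma : 'rV[R]_d.-1 -> R),
      [/\ Q *m Q^T = 1%:M, lipschitz gamma &
        \forall x \near x0,
          D x <-> gamma (col' j (x *m Q)) < (x *m Q) ord0 j]].

(* The closure is a finite union of polyhedra {x | x A <= c}; D is not
   required to be convex. *)
Definition polyhedral {R : realType} {d : nat} (D : set 'rV[R]_d) :=
  exists (K m : nat) (A : 'I_K -> 'M[R]_(d, m)) (c : 'I_K -> 'rV[R]_m),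
    closure D =
    [set x | exists k, forall i, (x *m A k) ord0 i <= c k ord0 i].

Section ParameterSpace.
Context {R : realType}.

Definition coord_cylinders : set (set (nat -> R)) :=
  [set A | exists (j : nat) (B : set (measurableTypeR R)),
     measurable B /\ A = [set y | B (y j)]].

(* R^N with the product sigma-algebra. The index j : nat stands for the
   (j+1)-st coordinate. *)
Definition RN := g_sigma_algebraType coord_cylinders.

Definition Gamma (z : R) : R :=
  \int[lebesgue_measure]_(t in `]0, +oo[) (t `^ (z - 1) * expR (- t)).

Definition gen_gaussian_pdf (beta y : R) : R :=
  (2 * beta `^ (beta^-1) * Gamma (1 + beta^-1))^-1 *
  expR (- (`|y| `^ beta / beta)).

Definition gen_gaussian (beta : R) (A : set (measurableTypeR R)) : \bar R :=
  (\int[lebesgue_measure]_(y in A) (gen_gaussian_pdf beta y)%:E)%E.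

(* The values on measurable rectangles determine the product measure. *)
Definition is_product_gen_gaussian (beta : R) (P : probability RN R) :=
  forall (n : nat) (A : nat -> set (measurableTypeR R)),
    (forall j, measurable (A j)) ->
    P [set y | forall j, (j < n)%N -> A j (y j)] =
    (\prod_(j < n) gen_gaussian beta (A j))%E.

Definition Uset (b : nat -> R) : set RN :=
  [set y | (\sum_(0 <= j <oo) (b j * `|y j|)%:E < +oo)%E].

Definition truncate (s : nat) (y : RN) : RN := fun j => if (j < s)%N then y j else 0.

End ParameterSpace.

Definition lognormal_coeff {R : realType} {d : nat} (a0 : 'rV[R]_d -> R)
    (psi : nat -> 'rV[R]_d -> R) (y : @RN R) (x : 'rV[R]_d) : R :=
  a0 x * expR (limn (series (fun j => y j * psi j x))).

(* The normed space is given as a set E of representatives in a vector space V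
   with a seminorm N, so that the integral is determined up to vectors of
   seminorm zero. *)
Section Bochner.
Context {R : realType} {d : measure_display} {T : measurableType d}
  {V : lmodType R}.

Record simple_map := SimpleMap {
  simple_size : nat;
  simple_set : 'I_simple_size -> set T;
  simple_val : 'I_simple_size -> V }.

Definition simple_in (E : set V) (s : simple_map) :=
  forall k, measurable (@simple_set s k) /\ E (@simple_val s k).

Definition simple_eval (s : simple_map) (t : T) : V :=
  \sum_k \1_(@simple_set s k) t *: @simple_val s k.

Definition simple_integral (mu : {measure set T -> \bar R}) (B : set T)
    (s : simple_map) : V :=
  \sum_k fine (mu (B `&` @simple_set s k)) *: @simple_val s k.

Definition is_bochner_integral (mu : {measure set T -> \bar R}) (B : set T)
    (E : set V) (N : V -> R) (F : T -> V) (I : V) :=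
  E I /\ exists s : nat -> simple_map,
    [/\ forall n, simple_in E (s n),
        {ae mu, forall t, B t ->
           (fun n => N (F t - simple_eval (s n) t)) @ \oo --> (0 : R)},
        (fun n => \int[mu]_(t in B) (N (F t - simple_eval (s n) t))%:E)%E
          @ \oo --> 0%E
      & (fun n => N (I - simple_integral mu B (s n))) @ \oo --> (0 : R)].

End Bochner.

(* Main.v *)
Require Import Defs.
From mathcomp Require Import all_boot all_order all_algebra.
From mathcomp Require Import all_classical all_reals all_analysis ess_sup_inf.
From mathcomp Require Import measurable_realfun.
From mathcomp Require Import zify ring lra.
Set Implicit Arguments.
Unset Strict Implicit.
Unset Printing Implicit Defensive.
Import Order.TTheory GRing.Theory Num.Theory.
Import numFieldNormedType.Exports.
Local Open Scope classical_set_scope.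
Local Open Scope ring_scope.

(** The truncation error is a sum of increments of the solution in one coordinate
    each. Let tau_j y keep the first j coordinates of y and replace the others by
    0; then u(y) - u(tau_s y) is the sum over j >= s of the increments
    u(tau_(j+1) y) - u(tau_j y). The coordinate y_j has an even law
    ([flip_invariant]), so the mean of an increment is half the mean of the second
    difference u(z + y_j e_j) + u(z - y_j e_j) - 2 u(z) at z = tau_j y
    ([symmetric_increment]). The exponent of the coefficient is affine in y_j with
    slope at most b_j. Hence the second difference of the coefficient is of order
    b_j^2 relative to the coefficient ([coeff_second_diff]), and the energy
    inequality transfers this order to the solution ([energy_second_diff],
    [solution_estimates]). The factors that depend on y are exponentials of
    weighted sums of the |y_j|; they have finite expectations because the
    coordinates are independent and the mean of exp(b_j |y_j|) is 1 + O(b_j)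
    ([wsum_moments]); for beta = 1 this is where b_j < 1 enters. The mean of the
    j-th increment is therefore O(b_j^2), and for a nonincreasing sequence in l^p
    the sum of the b_j^2 over j >= s is O(s^(1 - 2/p)) ([lp_tail]). No derivative
    in the parameters is taken.

    The Bochner integral is constructed along with its bound. Parameters are
    rounded to finitely many values by an odd map that does not increase any |y_j|
    and commutes with truncation ([rounding]). The solution at the rounded
    parameter is a simple map; the energy estimates show that it converges
    pointwise with an integrable majorant, and the completeness of H^1_0(D) yields
    the integral ([bochner_exists]). The symmetry argument is carried out on the
    rounded maps, where pairing with a fixed vector turns vector integrals into
    scalar ones ([simple_integral_pairing], [telescoped_bound]), and its conclusion
    passes to the limit. The Galerkin solutions satisfy the same estimates, so both
    claims are instances of [weak_error_rate].

    The remaining parts show that H^1_0(D), as a set of functions with a gradient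
    seminorm, is complete ([H10_complete]). This rests on the uniqueness of weak
    derivatives ([fundamental_lemma]), on integration by parts
    ([integral_partial_eq0]), on the inequality of Poincare ([poincare]) and on
    the completeness of L^2 ([L2_complete]). *)

(** * Lebesgue measure on row vectors *)

Section RowMeasurable.
Context {R : realType} {n : nat}.

Lemma coord_le_norm (x : 'rV[R]_n) i : `|x ord0 i| <= `|x|.
Proof.
rewrite [leRHS]mx_normrE.
by rewrite (le_trans _ (@le_bigmax _ _ _ _ (fun ij => `|x ij.1 ij.2|) (ord0, i))).
Qed.

Definition open_box (a b : 'rV[R]_n) : set 'rV[R]_n :=
  [set x | forall i, x ord0 i \in `]a ord0 i, b ord0 i[].

Definition closed_box (a b : 'rV[R]_n) : set 'rV[R]_n :=
  [set x | forall i, x ord0 i \in `[a ord0 i, b ord0 i]].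

Lemma sub_open_closed_box a b : open_box a b `<=` closed_box a b.
Proof. by move=> x abx i; apply: subset_itv_oo_cc (abx i). Qed.

(** There are countably many rational boxes, so that a local statement about the
    points of an open set reduces to countably many boxes. *)
Lemma open_rat_box (D : set 'rV[R]_n) (x : 'rV[R]_n) : open D -> D x ->
  exists a b : 'rV[rat]_n,
    open_box (map_mx ratr a) (map_mx ratr b) x /\
    closed_box (map_mx ratr a) (map_mx ratr b) `<=` D.
Proof.
rewrite openE => /[apply] /nbhs_ballP[e /= e0 eD].
have h1 i : exists r : rat, ratr r \in `](x ord0 i - e), (x ord0 i)[.
  by apply: rat_in_itvoo; rewrite ltrBlDr ltrDl.
have h2 i : exists r : rat, ratr r \in `](x ord0 i), (x ord0 i + e)[.
  by apply: rat_in_itvoo; rewrite ltrDl.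
exists (\row_i xchoose (h1 i)), (\row_i xchoose (h2 i)); split.
  move=> i; rewrite !mxE in_itv/=.
  have := xchooseP (h1 i); have := xchooseP (h2 i).
  by rewrite !in_itv/= => /andP[-> _] /andP[_ ->].
move=> y abx; apply: eD; split => // i j; rewrite ord1 /ball/=.
have := abx j; rewrite !mxE in_itv/= => /andP[y1 y2].
have := xchooseP (h1 j); have := xchooseP (h2 j).
rewrite !in_itv/= => /andP[_ p2] /andP[p1 _].
rewrite ltr_distlC; apply/andP; split.
  exact: lt_le_trans p1 y1.
exact: le_lt_trans y2 p2.
Qed.

Lemma measurable_rV_set (B : 'I_n -> set R) :
  (forall i, measurable (B i : set (measurableTypeR R))) ->
  measurable [set x : 'rV[R]_n | forall i, B i (x ord0 i)].
Proof.
move=> mB.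
rewrite (_ : mkset _ = \bigcap_(i in [set: 'I_n])
    ((fun v : 'rV[R]_n => v ord0 i : measurableTypeR R) @^-1` B i)); last first.
  by apply/seteqP; split=> [x Bx i _|x Bx i]; [exact: Bx|exact: Bx].
apply: fin_bigcap_measurable => [|i _]; first exact: finite_finset.
by rewrite -[X in measurable X]setTI; exact: measurable_coord_rV.
Qed.

Lemma measurable_open_box a b : measurable (open_box a b).
Proof.
apply: (measurable_rV_set (B := fun i => `]a ord0 i, b ord0 i[%classic)) => i.
exact: measurable_itv.
Qed.

Lemma open_measurable_rV (D : set 'rV[R]_n) : open D -> measurable D.
Proof.
move=> oD.
pose box (k : 'rV[rat]_n * 'rV[rat]_n) : set 'rV[R]_n :=
  open_box (map_mx ratr k.1) (map_mx ratr k.2).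
pose F k := if `[< box k `<=` D >] then box k else set0.
have -> : D = \bigcup_k F k.
  apply/seteqP; split => [x Dx|x [k _]]; last first.
    by rewrite /F; case: asboolP => // + bx; apply.
  have [a [b [abx abD]]] := open_rat_box oD Dx.
  exists (a, b) => //; rewrite /F; case: asboolP => // -[].
  exact: subset_trans (@sub_open_closed_box _ _) abD.
apply: countable_bigcupT_measurable; first exact: countableP.
by move=> k; rewrite /F; case: asboolP => // _; exact: measurable_open_box.
Qed.

Lemma continuous_measurable_rV (f : 'rV[R]_n -> R) :
  continuous f -> measurable_fun setT f.
Proof.
move=> cf; apply: (measurability _ (RGenOInfty.measurableE R)).
move=> _ [_ [a ->] <-]; rewrite setTI; apply: open_measurable_rV.
by apply: open_comp => // x _; exact: cf.
Qed.

End RowMeasurable.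

Section Translation.
Context {R : realType}.

Lemma measurable_shift (c : R) :
  measurable_fun setT ((fun x => x + c) : measurableTypeR R -> measurableTypeR R).
Proof.
by apply: continuous_measurable_fun => x; apply: cvgD => //; exact: cvg_cst.
Qed.

Lemma lebesgue_measure_shift (c : R) (A : set (measurableTypeR R)) :
  measurable A ->
  lebesgue_measure ((fun x => x + c) @^-1` A) = lebesgue_measure A.
Proof.
move=> mA; apply/esym.
have -> : lebesgue_measure ((fun x => x + c) @^-1` A) = pushforward lebesgue_measure
  ((fun x => x + c) : measurableTypeR R -> measurableTypeR R) A by [].
apply: lebesgue_measure_unique => //=; first exact: measurable_shift.
move=> _ _ [[a b]] _ <-.
rewrite /pushforward (_ : _ @^-1` _ = `](a - c), (b - c)]%classic).
  by rewrite !lebesgue_measure_itv/= !lte_fin ltrD2r -!EFinB opprB addrA subrK.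
by apply/seteqP; split=> x /=; rewrite !in_itv/= ltrBlDr lerBrDr.
Qed.

Lemma measurable_shift_rV n (c : 'rV[R]_n) :
  measurable_fun setT (fun x : 'rV[R]_n => x + c).
Proof.
apply: measurable_fun_rV => i.
rewrite (_ : (fun t => _) = ((fun x => x + c ord0 i) : measurableTypeR R -> measurableTypeR R)
    \o (fun v : 'rV[R]_n => v ord0 i)).
  by apply: measurableT_comp; [exact: measurable_shift|exact: measurable_coord_rV].
by apply/funext => x; rewrite /= mxE.
Qed.

(** One coordinate at a time, by uniqueness of the product measure. *)
Lemma lebesgue_rV_shift n (c : 'rV[R]_n) (A : set 'rV[R]_n) :
  measurable A ->
  lebesgue_rV n ((fun x => x + c) @^-1` A) = lebesgue_rV n A.
Proof.
elim: n => [|n IH] in c A * => mA.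
  rewrite /= (_ : _ @^-1` _ = A)//; apply/seteqP; split => x /=;
  by rewrite (_ : x + c = x)//; apply/rowP => -[].
pose c' : 'rV[R]_n := \row_j c ord0 (lift ord0 j).
pose s (p : measurableTypeR R * 'rV[R]_n) := (p.1 + c ord0 ord0 : measurableTypeR R, p.2 + c').
have ms : measurable_fun setT s.
  apply/measurable_fun_pairP; split.
    by apply: (measurableT_comp (measurable_shift _)); exact: measurable_fst.
  by apply: (measurableT_comp (measurable_shift_rV _)); exact: measurable_snd.
rewrite /= /lebesgue_rV_succ /pushforward.
have -> : @cons_rV R n @^-1` ((fun x => x + c) @^-1` A) = s @^-1` (@cons_rV R n @^-1` A).
  have e p : cons_rV p + c = cons_rV (s p).
    apply/rowP => i; rewrite /cons_rV !mxE.
    by have [j ->|->] := unliftP ord0 i; rewrite ?liftK ?unlift_none/= ?mxE.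
  by apply/seteqP; split => p /=; rewrite e.
have mcA : measurable (@cons_rV R n @^-1` A).
  by rewrite -[X in measurable X]setTI; exact: measurable_cons_rV.
have := @product_measure_unique _ _ _ _ R lebesgue_measure (lebesgue_rV n)
  (pushforward (lebesgue_measure \x lebesgue_rV n)%E s).
move=> /(_ ms) h; apply/esym; apply: h => // B C mB mC.
rewrite /= /pushforward (_ : s @^-1` _ = (fun x => x + c ord0 ord0) @^-1` B `*` (fun x => x + c') @^-1` C)//.
rewrite product_measure1E//.
- by congr (_ * _)%E; [exact: lebesgue_measure_shift|exact: IH].
- by rewrite -[X in measurable X]setTI; exact: measurable_shift.
- by rewrite -[X in measurable X]setTI; exact: measurable_shift_rV.
Qed.

Lemma lebesgue_rV_box n (B : 'I_n -> set R) :
  (forall i, measurable (B i : set (measurableTypeR R))) ->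
  lebesgue_rV n [set x : 'rV[R]_n | forall i, B i (x ord0 i)] =
  (\prod_(i < n) lebesgue_measure (B i : set (measurableTypeR R)))%E.
Proof.
elim: n => [|n IH] in B * => mB.
  rewrite big_ord0 /= (_ : mkset _ = setT) ?diracT//.
  by apply/seteqP; split => // x _ [].
rewrite big_ord_recl/= /lebesgue_rV_succ /pushforward -IH; last by [].
transitivity ((@lebesgue_measure R \x lebesgue_rV n)%E
    (B ord0 `*` [set x : 'rV[R]_n | forall i : 'I_n, B (lift ord0 i) (x ord0 i)])); last first.
  rewrite product_measure1E//; apply: (measurable_rV_set (B := fun i => B (lift ord0 i))) => i; exact: mB.
congr ((_ \x _)%E _).
apply/seteqP; split => -[t v] /=.
  move=> h; split; first by have := h ord0; rewrite /cons_rV mxE unlift_none.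
  by move=> i; have := h (lift ord0 i); rewrite /cons_rV mxE liftK.
move=> [h1 h2] i; rewrite /cons_rV mxE.
by have [j ->|->] := unliftP ord0 i; rewrite ?liftK ?unlift_none/=.
Qed.

Lemma bounded_lebesgue_rV_fin n (D : set 'rV[R]_n) : measurable D -> bounded_set D ->
  (lebesgue_rV n D < +oo)%E.
Proof.
move=> mD [M [_ /(_ (`|M| + 1))]].
rewrite (le_lt_trans (ler_norm M)) ?ltrDl// => /(_ isT) MD.
pose B (i : 'I_n) : set R := `[- (`|M| + 1), `|M| + 1]%classic.
apply: (@le_lt_trans _ _ (lebesgue_rV n [set x | forall i, B i (x ord0 i)])).
  apply: le_measure; rewrite ?inE//; first by apply: measurable_rV_set => i; exact: measurable_itv.
  move=> x Dx i; rewrite /B/= in_itv/= -ler_norml.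
  apply: le_trans (MD _ Dx).
  exact: coord_le_norm.
rewrite lebesgue_rV_box//; last by move=> i; exact: measurable_itv.
rewrite -ge0_fin_numE ?prode_fin_num//; first by move=> i _; rewrite lebesgue_measure_itv/=; case: ifP.
by apply: prode_ge0 => i _; exact: measure_ge0.
Qed.

End Translation.

(** * Smooth bump functions *)

Section FlatExp.
Context {R : realType}.

Lemma is_derive_quadratic (f : R -> R) (C : R) : (forall h, `|f h| <= C * h ^+ 2) ->
  is_derive (0 : R) 1 f 0.
Proof.
move=> fC.
have f0 : f 0 = 0.
  by apply/eqP; rewrite -normr_le0 (le_trans (fC 0))// expr0n/= mulr0.
have C0 : 0 <= C by have := fC 1; rewrite expr1n mulr1; exact: le_trans.
have lim0 : (fun h => h^-1 *: ((f \o shift 0) (h *: 1) - f 0)) @ 0^' --> (0 : R).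
  apply/cvgrPdist_le => e e0; near=> h.
  rewrite sub0r normrN f0 subr0 /= addr0 [h%:A]mulr1 normrZ normfV.
  have h0 : h != 0 by near: h; exact: nbhs_dnbhs_neq.
  rewrite ler_pdivrMl ?normr_gt0// (le_trans (fC h))//.
  rewrite -real_normK ?num_real// expr2 mulrCA ler_wpM2l//.
  have he : `|h| <= e / (C + 1).
    near: h; apply: dnbhs0_le; rewrite divr_gt0// ltr_wpDl//.
  rewrite (le_trans (ler_wpM2l C0 he))// mulrCA ger_pMr//.
  by rewrite ler_pdivrMr ?mul1r ?lerDl// ltr_wpDl.
apply: DeriveDef; last exact/cvg_lim.
by apply/cvg_ex; exists 0.
Unshelve. all: by end_near. Qed.

(** This is what makes every expression q(1/t) exp(-1/t) vanish at 0 faster than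
    any power of t. *)
Lemma poly_le_expR (p : {poly R}) : exists C : R, forall s, 0 <= s -> `|p.[s]| <= C * expR s.
Proof.
exists (\sum_(i < size p) `|p`_i| * i`!%:R) => s s0.
rewrite horner_coef (le_trans (ler_norm_sum _ _ _))// big_distrl/=.
apply: ler_sum => i _; rewrite normrM -mulrA ler_wpM2l//.
rewrite ger0_norm ?exprn_ge0//; case: (nat_of_ord i) => [|k].
  by rewrite expr0 fact0 mul1r -expR0 ler_expR.
have := expR_ge1Dxn k s0.
rewrite addrC -lerBrDr => h.
rewrite mulrC -ler_pdivrMr ?ltr0n ?fact_gt0//.
by rewrite (le_trans h)// gerBl.
Qed.

(** The family of functions q(1/t) exp(-1/t), cut off at 0, is closed under
    differentiation, so differentiability of its members implies smoothness. *)
Definition flat_exp (q : {poly R}) (t : R) : R :=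
  if 0 < t then q.[t^-1] * expR (- t^-1) else 0.

Lemma is_derive_flat_exp (q : {poly R}) (t : R) :
  is_derive t 1 (flat_exp q) (flat_exp ((q - q^`()) * 'X^2) t).
Proof.
have [t0|t0|->] := ltgtP t 0.
- rewrite {2}/flat_exp ltNge (ltW t0)/=.
  apply: near_eq_is_derive (is_derive_cst (0 : R) t 1).
  near=> s; rewrite /flat_exp ltNge.
  have -> // : s <= 0.
  by apply: ltW; near: s; exact: lt_nbhsl.
- rewrite {2}/flat_exp t0.
  apply: (@near_eq_is_derive _ _ _ ((fun s => q.[s] * expR (- s)) \o (fun s => s^-1))).
    near=> s; rewrite /flat_exp.
    have -> // : 0 < s by near: s; exact: lt_nbhsr.
  have dinv : is_derive t 1 (fun s : R => s^-1) (- t ^- 2).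
    apply: DeriveDef.
      by apply: (@derivableV _ _ id) => //; rewrite gt_eqF.
    by rewrite (@deriveV _ _ id)//= ?gt_eqF// derive_id [LHS]mulr1.
  have dexp : is_derive (t^-1) 1 (fun s : R => expR (- s)) (expR (- t^-1) * - 1).
    exact: (@is_derive1_comp _ expR -%R).
  have dpr : is_derive (t^-1) 1 (horner q * (fun s : R => expR (- s)))
      (q.[t^-1] *: (expR (- t^-1) * - 1) + expR (- t^-1) *: q^`().[t^-1]).
    exact: is_deriveM.
  apply: is_derive_eq.
  rewrite hornerM hornerXn hornerD hornerN exprVn -![_ *: _]/(_ * _).
  ring.
- rewrite {2}/flat_exp ltxx.
  have [C hC] := poly_le_expR (q * 'X^2).
  apply: (@is_derive_quadratic _ `|C|) => h.
  rewrite /flat_exp; case: ifPn => [h0|_]; last by rewrite normr0 mulr_ge0// sqr_ge0.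
  have h1 : 0 <= h^-1 by rewrite invr_ge0 ltW.
  have := hC _ h1; rewrite hornerM hornerXn normrM (ger0_norm (exprn_ge0 2 h1)).
  rewrite exprVn ler_pdivrMr ?exprn_gt0// => h2.
  rewrite normrM (ger0_norm (expR_ge0 _)) expRN ler_pdivrMr ?expR_gt0//.
  rewrite (le_trans h2)// mulrAC ler_wpM2r ?expR_ge0// ler_wpM2r ?sqr_ge0//.
  exact: ler_norm.
Unshelve. all: by end_near. Qed.

End FlatExp.

Section Bumps.
Context {R : realType} {n : nat}.

(** The algebra generated by flat functions of affine functions of one
    coordinate. It is closed under partial derivatives, hence consists of smooth
    functions as soon as its generators are differentiable. *)
Inductive elementary_smooth : ('rV[R]_n -> R) -> Prop :=
| es_flat q (c e : R) i : elementary_smooth (fun x => flat_exp q (c * x ord0 i + e))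
| es_cst c : elementary_smooth (cst c)
| es_add f g : elementary_smooth f -> elementary_smooth g -> elementary_smooth (f + g)
| es_mul f g : elementary_smooth f -> elementary_smooth g -> elementary_smooth (f * g).

Lemma differentiable_flat q (c e : R) i (x : 'rV[R]_n) :
  differentiable (fun x : 'rV[R]_n => flat_exp q (c * x ord0 i + e)) x.
Proof.
apply: (@differentiable_comp _ _ _ _ (fun x : 'rV[R]_n => c * x ord0 i + e) (flat_exp q)).
  apply: differentiableD; last exact: differentiable_cst.
  by apply: differentiableM => //; exact: differentiable_coord.
apply/derivable1_diffP; exact: (@ex_derive _ _ _ _ _ _ _ (is_derive_flat_exp q _)).
Qed.

Lemma elementary_smooth_diff f : elementary_smooth f -> forall x, differentiable f x.
Proof.
elim => [q c e i|c|{}f g _ IHf _ IHg|{}f g _ IHf _ IHg] x.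
- exact: differentiable_flat.
- exact: differentiable_cst.
- exact: differentiableD.
- exact: differentiableM.
Qed.

Lemma partial_flat q (c e : R) i j :
  partial j (fun x : 'rV[R]_n => flat_exp q (c * x ord0 i + e)) =
  cst (c * (i == j)%:R) * (fun x => flat_exp ((q - q^`()) * 'X^2) (c * x ord0 i + e)).
Proof.
apply/funext => x.
pose k : R := c * (i == j)%:R; pose a := c * x ord0 i + e.
rewrite [RHS]/(k * _).
have -> : partial j (fun x : 'rV[R]_n => flat_exp q (c * x ord0 i + e)) x =
    'D_1 (flat_exp q \o (fun s => k * s + a)) 0.
  rewrite /partial /derive; apply: (congr1 (fun g : R -> R => lim (g @ 0^'))).
  apply/funext => h /=; rewrite !mxE addr0 mulr0 add0r [h%:A]mulr1 -/a.
  congr (h^-1 *: (flat_exp q _ - _)); rewrite /a /k eqxx/= (eq_sym i).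
  by ring.
have dl : is_derive (0 : R) 1 (fun s : R => k * s + a) k.
  apply: is_derive_eq; rewrite addr0.
  by rewrite [LHS]mulr1.
have := is_derive_flat_exp q a.
rewrite -{1}[a]add0r -{1}(mulr0 k) => df.
have /@derive_val -> := @is_derive1_comp _ _ (fun s => k * s + a) _ _ _ df dl.
by rewrite mulrC.
Qed.

Lemma elementary_smooth_partial j f : elementary_smooth f -> elementary_smooth (partial j f).
Proof.
elim => [q c e i|c|{}f g fs IHf gs IHg|{}f g fs IHf gs IHg].
- by rewrite partial_flat; apply: es_mul; [exact: es_cst|exact: es_flat].
- rewrite (_ : partial _ _ = cst 0); first exact: es_cst.
  by apply/funext => x; rewrite /partial derive_cst.
- rewrite (_ : partial _ _ = partial j f + partial j g); first exact: es_add.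
  apply/funext => x; rewrite /partial deriveD//; apply: diff_derivable;
  exact: elementary_smooth_diff.
- rewrite (_ : partial _ _ = f * partial j g + g * partial j f).
    by apply: es_add; exact: es_mul.
  apply/funext => x; rewrite /partial deriveM//; apply: diff_derivable;
  exact: elementary_smooth_diff.
Qed.

Lemma elementary_smooth_smooth f : elementary_smooth f -> smooth f.
Proof.
move=> fs s; apply: elementary_smooth_diff.
by elim: s => //= j s; exact: elementary_smooth_partial.
Qed.

End Bumps.

(** * The fundamental lemma of the calculus of variations *)

Section Fundamental.
Context {R : realType} {n : nat}.
Local Notation leb := (@lebesgue_rV R n).

(** Each factor vanishes outside one of the half-spaces that cut out the box and
    tends to 1 inside it as m grows. *)
Definition box_bump (a b : 'rV[R]_n) (m : R) : 'rV[R]_n -> R :=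
  \prod_(i < n) ((fun x : 'rV[R]_n => flat_exp 1 (m * x ord0 i + - (m * a ord0 i))) *
                 (fun x : 'rV[R]_n => flat_exp 1 (- m * x ord0 i + m * b ord0 i))).

Lemma box_bumpE a b m x : box_bump a b m x =
  \prod_(i < n) (flat_exp 1 (m * (x ord0 i - a ord0 i)) * flat_exp 1 (m * (b ord0 i - x ord0 i))).
Proof.
rewrite /box_bump fct_prodE; apply: eq_bigr => i _ /=.
by rewrite -[LHS]/(_ * _) mulrBr mulrBr [m * b _ _ - _]addrC mulNr.
Qed.

Lemma flat_exp_gt0 (t : R) : (flat_exp 1 t != 0) = (0 < t).
Proof.
rewrite /flat_exp; case: ifPn => t0; last by rewrite eqxx.
by rewrite hornerC mul1r gt_eqF ?expR_gt0.
Qed.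

Lemma flat_exp_itv (t : R) : 0 <= flat_exp 1 t <= 1.
Proof.
rewrite /flat_exp; case: ifPn => t0; last by rewrite lexx ler01.
by rewrite hornerC mul1r expR_ge0/= -expR0 ler_expR oppr_le0 invr_ge0 ltW.
Qed.

Lemma flat_exp_cvg (t : R) :
  (fun k : nat => flat_exp 1 (k.+1%:R * t)) @ \oo --> ((0 < t)%R%:R : R).
Proof.
have [t0|t0] := ltP 0 t; last first.
  rewrite (_ : (fun k => _) = cst 0); first exact: cvg_cst.
  by apply/funext => k; rewrite /flat_exp ltNge pmulr_rle0 ?t0// ltr0n.
rewrite -[X in _ --> X]expR0 (_ : (fun k => _) = fun k : nat => expR (- (k.+1%:R^-1 * t^-1))); last first.
  by apply/funext => k; rewrite /flat_exp pmulr_rgt0 ?ltr0n// t0 hornerC mul1r invfM.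
apply: continuous_cvg; first exact: continuous_expR.
rewrite -oppr0; apply: cvgN; rewrite -[X in _ --> X](mul0r t^-1).
by apply: cvgM; [exact: cvg_harmonic|exact: cvg_cst].
Qed.

Lemma box_bump_supp a b (m : R) : 0 < m -> [set x | box_bump a b m x != 0] `<=` open_box a b.
Proof.
move=> m0 x /=; rewrite box_bumpE => /prodf_neq0 h i.
have := h i isT; rewrite mulf_eq0 negb_or !flat_exp_gt0 !pmulr_rgt0// !subr_gt0.
by rewrite in_itv.
Qed.

Lemma open_boxI (a1 b1 a2 b2 : 'rV[R]_n) : open_box a1 b1 `&` open_box a2 b2 =
  open_box (\row_i Num.max (a1 ord0 i) (a2 ord0 i))
           (\row_i Num.min (b1 ord0 i) (b2 ord0 i)).
Proof.
apply/seteqP; split => x.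
  move=> [h1 h2] i; have := h1 i; have := h2 i.
  by rewrite !in_itv/= !mxE gt_max lt_min => /andP[-> ->] /andP[-> ->].
by move=> h; split => i; have := h i; rewrite !in_itv/= !mxE gt_max lt_min =>
  /andP[/andP[? ?] /andP[? ?]]; apply/andP.
Qed.

Lemma closed_closed_box (a b : 'rV[R]_n) : closed (closed_box a b).
Proof.
rewrite (_ : closed_box a b = \bigcap_(i in [set: 'I_n])
   ((fun x : 'rV[R]_n => x ord0 i) @^-1` `[a ord0 i, b ord0 i]%classic)); last first.
  by apply/seteqP; split => [x h i _|x h i]; [exact: h|exact: (h i)].
apply: closed_bigI => i _; apply: preimage_closed; last exact: itv_closed.
by move=> x _; exact: coord_continuous.
Qed.

Lemma bounded_closed_box (a b : 'rV[R]_n) : bounded_set (closed_box a b).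
Proof.
exists (`|a| + `|b|); split; first exact: num_real.
move=> M abM x abx /=; rewrite [leLHS]mx_normrE.
apply: bigmax_le; first by rewrite (le_trans _ (ltW abM))// addr_ge0.
move=> [i j] _ /=; rewrite ord1; have := abx j; rewrite in_itv/= => /andP[h1 h2].
rewrite (le_trans _ (ltW abM))// ler_norml.
have := coord_le_norm a j; have := coord_le_norm b j; rewrite !ler_norml => /andP[b1 b2] /andP[a1 a2].
by apply/andP; split; have := normr_ge0 a; have := normr_ge0 b; lra.
Qed.

Lemma box_bump_test (D : set 'rV[R]_n) a b (m : R) : 0 < m -> closed_box a b `<=` D ->
  test_function D (box_bump a b m).
Proof.
move=> m0 abD.
have sub : closure [set x | box_bump a b m x != 0] `<=` closed_box a b.
  have /closure_id -> := @closed_closed_box a b.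
  apply: closure_subset; apply: subset_trans (box_bump_supp m0) _.
  exact: sub_open_closed_box.
split; last exact: subset_trans sub abD.
- apply: elementary_smooth_smooth; rewrite /box_bump.
  elim/big_ind : _ => [|f g|i _]; [exact: (es_cst 1)|exact: es_mul|].
  by apply: es_mul; exact: es_flat.
- apply: (subclosed_compact _ _ sub); first exact: closed_closure.
  by apply: bounded_closed_compact; [exact: bounded_closed_box|exact: closed_closed_box].
Qed.

Lemma box_bump_itv a b m x : 0 <= box_bump a b m x <= 1.
Proof.
rewrite box_bumpE; apply/andP; split.
  apply: prodr_ge0 => i _; apply: mulr_ge0; first by have /andP[] := flat_exp_itv (m * (x ord0 i - a ord0 i)).
  by have /andP[] := flat_exp_itv (m * (b ord0 i - x ord0 i)).
apply: prodr_ile1 => i _.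
have /andP[h1 h2] := flat_exp_itv (m * (x ord0 i - a ord0 i)).
have /andP[h3 h4] := flat_exp_itv (m * (b ord0 i - x ord0 i)).
by rewrite mulr_ge0//= mulr_ile1.
Qed.

Lemma box_bump_cvg a b x :
  (fun k : nat => box_bump a b k.+1%:R x) @ \oo --> (\1_(open_box a b) x : R).
Proof.
have -> : \1_(open_box a b) x =
    \prod_(i < n) ((0 < x ord0 i - a ord0 i)%R%:R * (0 < b ord0 i - x ord0 i)%R%:R) :> R.
  rewrite indicE; case: (boolP (x \in _)) => [/set_mem abx|/negP abx].
    rewrite big1// => i _; have := abx i.
    by rewrite in_itv/= !subr_gt0 => /andP[-> ->]; rewrite mulr1.
  apply/esym/eqP; apply/negPn/negP => /prodf_neq0 h; apply: abx; apply/mem_set => i.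
  have := h i isT; rewrite !subr_gt0 in_itv/=.
  by case: (_ < _); case: (_ < _); rewrite ?mulr0 ?mul0r ?eqxx.
under eq_fun do rewrite box_bumpE.
apply: (@cvg_big R 'I_n *%R 1 xpredT _ _ _ _ (fun i (k : nat) =>
   flat_exp 1 (k.+1%:R * (x ord0 i - a ord0 i)) * flat_exp 1 (k.+1%:R * (b ord0 i - x ord0 i)))).
  exact: mul_continuous.
by move=> i _; apply: cvgM; exact: flat_exp_cvg.
Qed.

Let boxes : set (set 'rV[R]_n) := [set A | exists a b, A = open_box a b].

(** A half-space is a countable union of boxes. *)
Lemma measurable_boxes (E : set 'rV[R]_n) : measurable E -> <<s boxes >> E.
Proof.
move: E; apply: smallest_sub; first exact: smallest_sigma_algebra.
move=> A; rewrite -bigcup_seq/= => -[i _ [Y + <-]]; rewrite setTI.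
pose H : set (set R) := [set Y | <<s boxes >> ((fun v : 'rV[R]_n => v ord0 i) @^-1` Y)].
rewrite (RGenOInfty.measurableE R).
suff : <<s @RGenOInfty.G R >> `<=` H by exact.
apply: smallest_sub.
  split; rewrite /H /=.
  - by rewrite preimage_set0; exact: sigma_algebra0.
  - by move=> B HB; rewrite setTD preimage_setC; exact: sigma_algebraC.
  - by move=> F HF; rewrite preimage_bigcup; exact: sigma_algebra_bigcup.
move=> _ [x ->]; rewrite /H/=.
rewrite (_ : _ @^-1` _ = \bigcup_k open_box
    (\row_j (if j == i then x else - k%:R)) (const_mx k%:R)).
  apply: sigma_algebra_bigcup => k; apply: sub_sigma_algebra.
  by eexists; eexists.
apply/seteqP; split => [v|v [k _ /(_ i)]]; rewrite /= in_itv/= ?andbT; last first.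
  by rewrite !mxE eqxx in_itv/= andbT => /andP[].
move=> xv; exists (Num.trunc `|v|).+1 => // j; rewrite in_itv/= !mxE.
have /andP[h1 h2] : - (Num.trunc `|v|).+1%:R < v ord0 j < (Num.trunc `|v|).+1%:R.
  rewrite -ltr_norml (le_lt_trans _ (truncnS_gt _))//.
  exact: coord_le_norm.
by rewrite h2 andbT; case: eqP => [->|].
Qed.

Lemma integral_open_box_eq0 (D : set 'rV[R]_n) (g : 'rV[R]_n -> R) a b :
  measurable D -> leb.-integrable D (EFin \o g) ->
  (forall phi, test_function D phi -> \int[leb]_(x in D) (g x * phi x) = 0) ->
  closed_box a b `<=` D ->
  (\int[leb]_(x in open_box a b) (g x)%:E = 0)%E.
Proof.
move=> mD ig g0 abD.
have sub : open_box a b `<=` D by apply: subset_trans abD; exact: sub_open_closed_box.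
have mg : measurable_fun D g by apply/measurable_EFinP; exact: (measurable_int leb).
have mphi k : measurable_fun D (box_bump a b k.+1%:R).
  apply: measurable_funTS; apply: continuous_measurable_rV => x.
  have [sm _ _] := @box_bump_test D a b k.+1%:R (ltr0Sn _ _) abD.
  by apply: differentiable_continuous; exact: (sm [::] x).
have -> : (\int[leb]_(x in open_box a b) (g x)%:E =
    \int[leb]_(x in D) (g x * \1_(open_box a b) x)%:E)%E.
  rewrite -{1}(setIidr sub) integral_mkcondr; apply: eq_integral => x _.
  by rewrite patchE indicE; case: (x \in _); rewrite ?mulr1 ?mulr0.
have h : (fun k => \int[leb]_(x in D) (g x * box_bump a b k.+1%:R x)%:E)%E @ \oo -->
    (\int[leb]_(x in D) (g x * \1_(open_box a b) x)%:E)%E.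
  apply: (@dominated_cvg _ _ _ _ D mD _ _ (fun x => `|(g x)%:E|%E)) => //.
  - by move=> k; apply/measurable_EFinP; exact: measurable_funM.
  - move=> x _; apply: cvg_EFin; first exact: nearW.
    by apply: cvgM; [exact: cvg_cst|exact: box_bump_cvg].
  - exact: integrable_abse.
  - move=> k x _ /=; rewrite lee_fin normrM ler_piMr//.
    by have /andP[h1 h2] := box_bump_itv a b k.+1%:R x; rewrite ger0_norm.
apply: (cvg_unique _ h) => //.
rewrite (_ : (fun _ => _) = cst 0%E); first exact: cvg_cst.
apply/funext => k.
have /g0 := @box_bump_test D a b k.+1%:R (ltr0Sn _ _) abD.
rewrite /Rintegral/= => e; rewrite -[LHS]fineK ?e//.
apply: integrable_fin_num => //.
apply: le_integrable ig => //; first by apply/measurable_EFinP; exact: measurable_funM.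
move=> x _ /=; rewrite lee_fin normrM ler_piMr//.
have /andP[h1 h2] := box_bump_itv a b k.+1%:R x.
by rewrite ger0_norm.
Qed.

(** Boxes are stable under intersection, so the sets over which g has integral 0
    include the sigma-algebra that they generate. *)
Lemma integral_in_open_box_eq0 (D : set 'rV[R]_n) (g : 'rV[R]_n -> R) a b :
  measurable D -> leb.-integrable D (EFin \o g) ->
  (forall phi, test_function D phi -> \int[leb]_(x in D) (g x * phi x) = 0) ->
  closed_box a b `<=` D -> forall E, measurable E ->
  (\int[leb]_(x in E `&` open_box a b) (g x)%:E = 0)%E.
Proof.
move=> mD ig g0 abD E mE.
have sub : open_box a b `<=` D by apply: subset_trans abD; exact: sub_open_closed_box.
have mB : measurable (open_box a b) by exact: measurable_open_box.
have igB F : measurable F -> F `<=` open_box a b -> leb.-integrable F (EFin \o g).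
  by move=> mF FB; apply: integrableS ig => //; exact: subset_trans sub.
pose H : set (set 'rV[R]_n) := [set E | measurable E /\
  (\int[leb]_(x in E `&` open_box a b) (g x)%:E = 0)%E].
suff : <<s boxes >> `<=` H by move=> /(_ E (measurable_boxes mE))[].
apply: lambda_system_subset => //.
- move=> _ _ [a1 [b1 ->]] [a2 [b2 ->]].
  by rewrite open_boxI; eexists; eexists.
- apply/dynkin_lambda_system; split.
  + split; first exact: measurableT.
    by rewrite setTI; exact: (integral_open_box_eq0 mD ig g0 abD).
  + move=> F [mF F0]; split; first exact: measurableC.
    have := integral_open_box_eq0 mD ig g0 abD.
    rewrite -[X in integral _ X](setUIDK (open_box a b) F) integral_setU.
    * by rewrite setIC F0 add0e setDE setIC.
    * exact: measurableI.
    * exact: measurableD.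
    * by rewrite setUIDK; exact: (measurable_int leb (igB _ mB _)).
    * by apply/disj_setPS => x [[_ Fx] [_ /(_ Fx)]].
  + move=> F tF HF; split; first by apply: bigcup_measurable => k _; have [] := HF k.
    rewrite setI_bigcupl integral_bigcup.
    * by rewrite eseries0// => k _ _; have [] := HF k.
    * exact: trivIset_setIr.
    * by move=> k; apply: measurableI => //; have [] := HF k.
    * apply: igB; last by move=> x [k _ []].
      by apply: bigcup_measurable => k _; apply: measurableI => //; have [] := HF k.
- move=> _ [a1 [b1 ->]]; split; first exact: measurable_open_box.
  rewrite open_boxI; apply: (integral_open_box_eq0 mD ig g0).
  move=> x h; apply: abD => i; have := h i; rewrite !in_itv/= !mxE ge_max le_min.
  by move=> /andP[/andP[_ ->] /andP[_ ->]].
Qed.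

(** Indicators of boxes are limits of test functions, hence g has integral zero
    over the measurable subsets of each of the countably many rational boxes that
    cover D. *)
Lemma fundamental_lemma (D : set 'rV[R]_n) (g : 'rV[R]_n -> R) :
  open D -> leb.-integrable D (EFin \o g) ->
  (forall phi, test_function D phi -> \int[leb]_(x in D) (g x * phi x) = 0) ->
  {ae leb, forall x, D x -> g x = 0}.
Proof.
move=> oD ig g0; have mD := open_measurable_rV oD.
pose I := ('rV[rat]_n * 'rV[rat]_n)%type.
pose F (k : nat) : set 'rV[R]_n :=
  if unpickle k is Some (a, b) then
    if `[< closed_box (map_mx ratr a) (map_mx ratr b) `<=` D >]
    then [set x | open_box (map_mx ratr a) (map_mx ratr b) x /\ g x != 0] else set0
  else set0.
apply: (negligibleS (A := \bigcup_k F k)).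
  move=> x /= /not_implyP[Dx gx].
  have [a [b [abx abD]]] := open_rat_box oD Dx.
  exists (pickle ((a, b) : I)) => //; rewrite /F pickleK.
  by case: asboolP => // _; split => //; exact/eqP.
apply: negligible_bigcup => k; rewrite /F; case: unpickle => [[a b]|]; last exact: negligible_set0.
case: asboolP => abD; last exact: negligible_set0.
set a' := map_mx _ a; set b' := map_mx _ b.
have sub : open_box a' b' `<=` D by apply: subset_trans abD; exact: sub_open_closed_box.
have := @integral_ae_eq _ _ R leb (open_box a' b') (measurable_open_box a' b')
   (cst 0%E) (EFin \o g).
case.
- by apply: integrableS ig => //; exact: measurable_open_box.
- exact: measurable_cst.
- move=> E EB mE; rewrite integral0 -(setIidl EB).
  exact: (integral_in_open_box_eq0 mD ig g0 abD).
- move=> N [mN N0 sN]; exists N; split => // x [xab /eqP gx]; apply: sN => /= h.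
  by apply: gx; have [] := h xab.
Qed.

End Fundamental.

(** * Square-integrable functions and semidefinite forms *)

Section AlmostEverywhere.
Context {R : realType} {d : measure_display} {T : measurableType d}.
Variables (mu : {measure set T -> \bar R}) (D : set T).
Hypothesis mD : measurable D.
Local Notation intg f := (mu.-integrable D (EFin \o f)).
Implicit Types f g u v : T -> R.

Lemma intg_measurable f : intg f -> measurable_fun D f.
Proof. by move=> /measurable_int /measurable_EFinP. Qed.

Lemma intg_ae_dom f g : measurable_fun D f -> intg g ->
  {ae mu, forall x, D x -> `|f x| <= g x} -> intg f.
Proof.
move=> mf ig fg; apply/integrableP; split; first exact/measurable_EFinP.
have /integrableP[mg] := ig; apply: le_lt_trans.
apply: ae_ge0_le_integral => //.
- by apply: measurableT_comp => //; exact/measurable_EFinP.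
- exact: measurableT_comp.
- apply: filterS fg => x /[apply] h /=; rewrite lee_fin (le_trans h)//.
  exact: ler_norm.
Qed.

Lemma intg_dom f g : measurable_fun D f -> intg g ->
  (forall x, D x -> `|f x| <= g x) -> intg f.
Proof. by move=> mf ig fg; apply: intg_ae_dom ig _ => //; exact: aeW. Qed.

Lemma intgD f g : intg f -> intg g -> intg (fun x => f x + g x).
Proof. by move=> fi gi; have := integrableD mD fi gi. Qed.

Lemma intgZ (c : R) f : intg f -> intg (fun x => c * f x).
Proof. by move=> fi; have := integrableZl mD c fi. Qed.

Lemma intgB f g : intg f -> intg g -> intg (fun x => f x - g x).
Proof. by move=> fi gi; have := integrableB mD fi gi. Qed.

Lemma intg_sum (n : nat) (F : 'I_n -> T -> R) : (forall i, intg (F i)) ->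
  intg (fun x => \sum_(i < n) F i x).
Proof.
move=> h; rewrite (_ : _ \o _ = fun x => (\sum_(i < n) (F i x)%:E)%E).
  by apply: integrable_sum => // i _; exact: h.
by apply/funext => x /=; rewrite sumEFin.
Qed.

Lemma Rintegral_sum (n : nat) (F : 'I_n -> T -> R) : (forall i, intg (F i)) ->
  \int[mu]_(x in D) (\sum_(i < n) F i x) = \sum_(i < n) \int[mu]_(x in D) F i x.
Proof.
elim: n F => [|n IH] F iF.
  rewrite big_ord0 (_ : Rintegral _ _ _ = \int[mu]_(x in D) 0); last first.
    by apply: eq_Rintegral => x _; rewrite big_ord0.
  by rewrite /Rintegral integral0.
rewrite big_ord_recl -IH// -RintegralD//; last exact: intg_sum.
by apply: eq_Rintegral => x _; rewrite big_ord_recl.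
Qed.

Lemma ae_eq_Rintegral f g : measurable_fun D f -> measurable_fun D g ->
  {ae mu, forall x, D x -> f x = g x} ->
  \int[mu]_(x in D) f x = \int[mu]_(x in D) g x.
Proof.
move=> mf mg fg; rewrite /Rintegral; congr fine; apply: ae_eq_integral => //.
- exact/measurable_EFinP.
- exact/measurable_EFinP.
- by apply: filterS fg => x /[apply] /= ->.
Qed.

Lemma ae_le_Rintegral f g : intg f -> intg g ->
  {ae mu, forall x, D x -> f x <= g x} ->
  \int[mu]_(x in D) f x <= \int[mu]_(x in D) g x.
Proof.
move=> fi gi fg.
have mf := intg_measurable fi; have mg := intg_measurable gi.
have mm : measurable_fun D (fun x => Num.max (f x) (g x)) by exact: measurable_maxr.
rewrite (@ae_eq_Rintegral g (fun x => Num.max (f x) (g x)))//; last first.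
  by apply: filterS fg => x /[apply] h; rewrite max_r.
apply: le_Rintegral => //; last by move=> x _; rewrite le_max lexx.
apply: (@intg_dom _ (fun x => `|f x| + `|g x|)) => //.
  by apply: intgD; [move: fi|move: gi] => /integrable_abse.
by move=> x _; case: (leP (f x) (g x)) => _; rewrite ?lerDl ?lerDr.
Qed.

Lemma intg_cst (c : R) : (mu D < +oo)%E -> intg (fun=> c).
Proof.
move=> fD; apply/integrableP; split; first exact: measurable_cst.
rewrite (eq_integral (fun=> `|c|%:E))// integral_cst//.
by rewrite lte_mul_pinfty.
Qed.

Lemma intg_indic (B : set T) : measurable B -> (mu B < +oo)%E ->
  mu.-integrable setT (EFin \o (\1_B : T -> R)).
Proof.
move=> mB fB; apply/integrableP; split; first by apply/measurable_EFinP; exact: measurable_indic.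
under eq_integral => x _ do rewrite gee0_abs ?lee_fin//.
by rewrite integral_indic// setIT.
Qed.

End AlmostEverywhere.

Section SquareIntegrable.
Context {R : realType} {d : measure_display} {T : measurableType d}.
Variables (mu : {measure set T -> \bar R}) (D : set T).
Hypothesis mD : measurable D.
Local Notation intg f := (mu.-integrable D (EFin \o f)).
Implicit Types f g u v : T -> R.

Definition L2 v := measurable_fun D v /\ intg (fun x => v x ^+ 2).

Lemma L2_mul u v : L2 u -> L2 v -> intg (fun x => u x * v x).
Proof.
move=> [mu_ iu] [mv iv]; apply: (intg_dom mD _ (intgD mD iu iv)).
  exact: measurable_funM.
move=> x _; rewrite normrM -(real_normK (num_real (u x))) -(real_normK (num_real (v x))).
have := sqr_ge0 (`|u x| - `|v x|); have := mulr_ge0 (normr_ge0 (u x)) (normr_ge0 (v x)).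
by nra.
Qed.

Lemma L2_lin (c : R) u v : L2 u -> L2 v -> L2 (fun x => c * u x + v x).
Proof.
move=> lu lv; have [mu_ iu] := lu; have [mv iv] := lv; split.
  by apply: measurable_funD => //; exact: measurable_funM.
rewrite (_ : _ \o _ = EFin \o (fun x => c ^+ 2 * u x ^+ 2 + ((2 * c) * (u x * v x) + v x ^+ 2))).
  by apply: intgD => //; [exact: intgZ|apply: intgD => //; apply: intgZ => //; exact: L2_mul].
by apply/funext => x /=; congr EFin; ring.
Qed.

Lemma L20 : L2 (fun=> 0).
Proof.
split; first exact: measurable_cst.
rewrite (_ : _ \o _ = cst 0%E); first exact: integrable0.
by apply/funext => x /=; rewrite expr0n.
Qed.

Lemma L2B u v : L2 u -> L2 v -> L2 (fun x => u x - v x).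
Proof.
move=> lu lv; have := L2_lin (-1) lv lu.
by congr L2; apply/funext => x; rewrite mulN1r addrC.
Qed.

Definition bounded_weight (a : T -> R) := measurable_fun D a /\
  exists M, {ae mu, forall x, D x -> `|a x| <= M}.

Lemma L2_wmul (a : T -> R) u v : bounded_weight a -> L2 u -> L2 v ->
  intg (fun x => a x * (u x * v x)).
Proof.
move=> [ma [M aM]] lu lv.
have iuv := L2_mul lu lv.
apply: (@intg_ae_dom _ _ _ _ _ mD _ (fun x => M * `|u x * v x|)).
- by apply: measurable_funM => //; exact: intg_measurable iuv.
- by apply: intgZ => //; move/integrable_abse: iuv.
- by apply: filterS aM => x /[apply] h; rewrite normrM ler_wpM2r.
Qed.

Lemma L2_intg v : (mu D < +oo)%E -> L2 v -> intg v.
Proof.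
move=> fD [mv iv].
have i1 : intg (fun=> 1) by exact: intg_cst.
apply: (intg_dom mD mv (intgD mD i1 iv)) => x _.
rewrite -(real_normK (num_real (v x))); have := sqr_ge0 (`|v x| - 2^-1).
by rewrite sqrrB; nra.
Qed.

Lemma L2_bounded v (M : R) : (mu D < +oo)%E -> measurable_fun D v ->
  (forall x, D x -> `|v x| <= M) -> L2 v.
Proof.
move=> fD mv vM; split => //.
have i1 : intg (fun=> M ^+ 2) by exact: intg_cst.
apply: (intg_dom mD _ i1); first exact: measurable_funX.
move=> x Dx; rewrite normrX; have := vM _ Dx; have := normr_ge0 (v x); nra.
Qed.

(** Riesz-Fischer. Along a subsequence whose k-th increment has squared norm at
    most 4^(-k), the squared increments weighted by 2^k have an integrable sum;
    where it is finite the increments are absolutely summable. Fatou gives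
    convergence in norm. *)
Lemma L2_complete (v : nat -> T -> R) : (forall n, L2 (v n)) ->
  (forall e : R, 0 < e -> exists N, forall m n, (N <= m)%N -> (N <= n)%N ->
     \int[mu]_(x in D) ((v m x - v n x) ^+ 2) <= e) ->
  exists w, L2 w /\ (fun n => \int[mu]_(x in D) ((v n x - w x) ^+ 2)) @ \oo --> (0 : R).
Proof.
move=> v2 cau.
have h4 (k : nat) : 0 < (4^-1 : R) ^+ k by rewrite exprn_gt0.
pose N k := projT1 (cid (cau _ (h4 k))).
have hN k m n : (N k <= m)%N -> (N k <= n)%N ->
    \int[mu]_(x in D) ((v m x - v n x) ^+ 2) <= 4^-1 ^+ k.
  exact: (projT2 (cid (cau _ (h4 k)))).
pose s k := maxn k (\max_(j < k.+1) N j).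
have sk k : (k <= s k)%N by rewrite leq_maxl.
have sN j k : (j <= k)%N -> (N j <= s k)%N.
  move=> jk; rewrite /s leq_max; apply/orP; right.
  by have /= := @leq_bigmax _ (fun i : 'I_k.+1 => N i) (Ordinal (jk : j < k.+1)%N).
pose dd k x := v (s k.+1) x - v (s k) x.
have i2 m n : intg (fun x => (v m x - v n x) ^+ 2) by have [] := L2B (v2 m) (v2 n).
pose G x := (\sum_(0 <= k <oo) (2 ^+ k * dd k x ^+ 2)%:E)%E.
have mdd k : measurable_fun D (fun x => (2 ^+ k * dd k x ^+ 2)%:E).
  by apply/measurable_EFinP; apply: intg_measurable; apply: intgZ => //; exact: i2.
have dd0 k x : (0 <= (2 ^+ k * dd k x ^+ 2)%:E)%E.
  by rewrite lee_fin mulr_ge0 ?sqr_ge0// exprn_ge0.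
have mG : measurable_fun D G.
  by apply: ge0_emeasurable_sum => // k x _ _; exact: dd0.
have G0 x : (0 <= G x)%E by apply: nneseries_ge0 => k _ _; exact: dd0.
have iG : mu.-integrable D G.
  apply/integrableP; split => //.
  under eq_integral => x _ do rewrite gee0_abs//.
  rewrite integral_nneseries//.
  apply: (@le_lt_trans _ _ (\sum_(0 <= k <oo) (2^-1 ^+ k)%:E)%E).
    apply: lee_nneseries => [*|k _]; first exact: integral_ge0.
    rewrite -[leLHS]fineK; last by apply: integrable_fin_num => //; apply: intgZ => //; exact: i2.
    rewrite lee_fin [leLHS]RintegralZl//; last exact: i2.
    have := hN k (s k.+1) (s k) (sN _ _ (leqnSn _)) (sN _ _ (leqnn _)).
    move=> /(ler_wpM2l (exprn_ge0 k (@ler0n R 2))) /le_trans; apply.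
    by rewrite -exprMn (_ : 2 * 4^-1 = 2^-1 :> R)//; field.
  have := @cvg_geometric_series R 1 2^-1.
  rewrite ger0_norm ?invr_ge0// invf_lt1// ltr1n => /(_ isT) h.
  have <- : (1 / (1 - 2^-1))%:E = (\sum_(0 <= k <oo) (2^-1 ^+ k)%:E : \bar R)%E.
    apply/esym/cvg_lim => //.
    rewrite (_ : (fun _ => _) = EFin \o (series (geometric 1 2^-1))).
      by apply: cvg_EFin; [exact: nearW|exact: h].
    by apply/funext => n; rewrite /= sumEFin /series/=; congr EFin; apply: eq_bigr => i _; rewrite mul1r.
  exact: ltry.
pose good := D `&` [set x | (G x < +oo)%E].
have mgood : measurable good by exact: emeasurable_fun_infty_o.
pose v' k x := v (s k) x * \1_good x.
have mv' k : measurable_fun D (v' k).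
  by apply: measurable_funM; [have [] := v2 (s k)|exact: measurable_indic].
have cv' x : D x -> cvgn (v' ^~ x).
  move=> Dx; rewrite /v' indicE.
  case: (boolP (x \in good)) => [/set_mem[_ /= Gx]|_]; last first.
    rewrite (_ : (fun _ => _) = cst 0); first exact: is_cvg_cst.
    by apply/funext => k; rewrite mulr0.
  have -> : (fun k => v (s k) x * true%:R) = (fun k => v (s 0%N) x + series (fun k => dd k x) k).
    apply/funext => k; rewrite mulr1 /series/= /dd telescope_sumr//.
    by rewrite addrC subrK.
  apply: is_cvgD; first exact: is_cvg_cst.
  apply: normed_cvg.
  have c1 : cvgn (series (fun k => 2^-1 ^+ k + 2 ^+ k * dd k x ^+ 2)).
    rewrite seriesD; apply: is_cvgD.
      have := @is_cvg_geometric_series R 1 2^-1.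
      rewrite ger0_norm ?invr_ge0// invf_lt1// ltr1n => /(_ isT).
      by congr (cvgn (series _)); apply/funext => k /=; rewrite mul1r.
    by apply: nnseries_is_cvg => // k; have := dd0 k x; rewrite lee_fin.
  apply: series_le_cvg c1 => k //=.
    by rewrite addr_ge0// ?exprn_ge0 ?invr_ge0//; have := dd0 k x; rewrite lee_fin.
  rewrite -(real_normK (num_real (dd k x))).
  have p2 : 0 < (2 : R) ^+ k by rewrite exprn_gt0.
  rewrite exprVn -(@ler_pM2l _ (2 ^+ k))// mulrDr divff ?gt_eqF//.
  have := sqr_ge0 (2 ^+ k * `|dd k x| - 2^-1).
  by rewrite sqrrB; nra.
pose w x := limn (v' ^~ x).
have mw : measurable_fun D w.
  by apply: (@measurable_fun_cvg _ _ _ _ v') => // x Dx; exact: cv'.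
have aeg : {ae mu, forall x, D x -> good x}.
  apply: filterS (integrable_ae mD iG) => x h Dx; split => //=.
  by have := h Dx; rewrite ge0_fin_numE.
have key (e : R) : 0 < e -> exists N, forall m, (N <= m)%N ->
    (\int[mu]_(x in D) ((v m x - w x) ^+ 2)%:E <= e%:E)%E.
  move=> e0; have [M hM] := cau _ e0; exists M => m Mm.
  have mf k : measurable_fun D (fun x => ((v m x - v' k x) ^+ 2)%:E).
    apply/measurable_EFinP; apply: measurable_funX; apply: measurable_funB => //.
    by have [] := v2 m.
  have f0 k x : D x -> (0 <= ((v m x - v' k x) ^+ 2)%:E)%E.
    by rewrite lee_fin sqr_ge0.
  have fat := fatou mu mD mf f0.
  rewrite (_ : (\int[mu]_(x in D) ((v m x - w x) ^+ 2)%:E)%E =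
    (\int[mu]_(x in D) limn_einf (fun k => ((v m x - v' k x) ^+ 2)%:E))%E); last first.
    apply: eq_integral => x /set_mem Dx.
    apply/esym; apply: (cvg_limn_einf_sup _).1.
    apply: cvg_EFin; first exact: nearW.
    rewrite expr2; under eq_fun do rewrite expr2.
    by apply: cvgM; apply: cvgB; (exact: cvg_cst || exact: cv').
  apply: (le_trans fat); rewrite limn_einf_lim; apply: lime_le.
    exact: is_cvg_einfs.
  near=> k; apply: (@le_trans _ _ (\int[mu]_(x in D) ((v m x - v' k x) ^+ 2)%:E)%E).
    by apply: ereal_inf_lbound; exists k => /=.
  rewrite (_ : integral _ _ _ = (\int[mu]_(x in D) ((v m x - v (s k) x) ^+ 2)%:E)%E).
    rewrite -[leLHS]fineK; last by apply: integrable_fin_num => //; exact: i2.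
    rewrite lee_fin; apply: hM => //; apply: leq_trans (sk _).
    by near: k; exact: nbhs_infty_ge.
  apply: ae_eq_integral => //; first by have := measurable_int _ (i2 m (s k)).
  apply: filterS aeg => x /[apply] gx /=; congr (_ ^+ 2)%:E.
  by rewrite /v' indicE mem_set// mulr1.
have [N1 hN1] := key 1 ltr01.
have idiff m : (N1 <= m)%N -> L2 (fun x => v m x - w x).
  move=> /hN1 h; have [mvm _] := v2 m.
  have mvw : measurable_fun D (fun x => v m x - w x) by exact: measurable_funB.
  split => //; apply/integrableP; split.
    by apply/measurable_EFinP; exact: measurable_funX.
  under eq_integral => x _ do rewrite gee0_abs ?lee_fin ?sqr_ge0//.
  exact: le_lt_trans h (ltry _).
have w2 : L2 w.
  have := L2B (v2 N1) (idiff _ (leqnn _)).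
  by congr L2; apply/funext => x; rewrite opprB addrC subrK.
exists w; split => //.
apply/cvgrPdist_le => e e0; have [N2 hN2] := key _ e0.
near=> m; rewrite sub0r normrN ger0_norm.
  rewrite -lee_fin fineK ?hN2//; first by near: m; exact: nbhs_infty_ge.
  by apply: integrable_fin_num => //; have [] := L2B (v2 m) w2.
by apply: Rintegral_ge0 => x _; exact: sqr_ge0.
Unshelve. all: by end_near. Qed.

End SquareIntegrable.

Section Forms.
Context {R : realType} {V : lmodType R}.
Implicit Types (E : set V) (B : V -> V -> R) (u v w : V).

(** Elements of function spaces are represented by functions defined everywhere,
    so a space is a subset E of a larger vector space, and its norm only a
    seminorm on E. *)
Definition is_subspace E := E 0 /\ forall (c : R) u v, E u -> E v -> E (c *: u + v).

Definition psd_form E B := [/\ (forall c u v w, E u -> E v -> E w ->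
   B (c *: u + v) w = c * B u w + B v w),
   (forall u v, E u -> E v -> B u v = B v u) & forall u, E u -> 0 <= B u u].

Lemma psd_form_sub E E' B : E' `<=` E -> psd_form E B -> psd_form E' B.
Proof.
move=> sub [l s q]; split.
- by move=> c u v w /sub Eu /sub Ev /sub Ew; exact: l.
- by move=> u v /sub Eu /sub Ev; exact: s.
- by move=> u /sub; exact: q.
Qed.

Definition form_norm B u := Num.sqrt (B u u).

Variables (E : set V) (B : V -> V -> R).
Hypotheses (hE : is_subspace E) (hB : psd_form E B).

Lemma subspaceD u v : E u -> E v -> E (u + v).
Proof. by move=> Eu Ev; rewrite -[u]scale1r; exact: hE.2. Qed.
Lemma subspaceZ c u : E u -> E (c *: u).
Proof. by move=> Eu; rewrite -[_ *: _]addr0; apply: hE.2 => //; exact: hE.1. Qed.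
Lemma subspaceB u v : E u -> E v -> E (u - v).
Proof. by move=> Eu Ev; rewrite addrC -scaleN1r; exact: hE.2. Qed.
Lemma subspace_sum (I : finType) (F : I -> V) : (forall i, E (F i)) -> E (\sum_i F i).
Proof.
by move=> EF; elim/big_ind : _ => //; [exact: hE.1|exact: subspaceD].
Qed.

Lemma formDl u v w : E u -> E v -> E w -> B (u + v) w = B u w + B v w.
Proof. by case: hB => l _ _ Eu Ev Ew; rewrite -[u]scale1r l// mul1r scale1r. Qed.
Lemma form0l w : E w -> B 0 w = 0.
Proof.
case: hB => l _ _ Ew; have := l 1 0 0 w hE.1 hE.1 Ew.
by rewrite scaler0 addr0 mul1r => h; lra.
Qed.
Lemma formZl c u w : E u -> E w -> B (c *: u) w = c * B u w.
Proof.
by case: hB => l _ _ Eu Ew; rewrite -[_ *: _]addr0 l//; [rewrite form0l// addr0|exact: hE.1].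
Qed.
Lemma formBl u v w : E u -> E v -> E w -> B (u - v) w = B u w - B v w.
Proof.
by case: hB => l _ _ Eu Ev Ew; rewrite addrC -scaleN1r l// mulN1r addrC.
Qed.
Lemma form_suml (I : finType) (F : I -> V) w : (forall i, E (F i)) -> E w ->
  B (\sum_i F i) w = \sum_i B (F i) w.
Proof.
move=> EF Ew.
have [//] : E (\sum_i F i) /\ B (\sum_i F i) w = \sum_i B (F i) w.
elim/big_ind2 : _ => [|u1 r1 u2 r2 [E1 <-] [E2 <-]|i _].
- by split; [exact: hE.1|exact: form0l].
- by split; [exact: subspaceD|exact: formDl].
- by split.
Qed.

Lemma formDr u v w : E u -> E v -> E w -> B w (u + v) = B w u + B w v.
Proof.
case: (hB) => _ s _ Eu Ev Ew; rewrite s//; last exact: subspaceD.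
by rewrite formDl// (s u)// (s v).
Qed.
Lemma formZr c u w : E u -> E w -> B w (c *: u) = c * B w u.
Proof.
by case: (hB) => _ s _ Eu Ew; rewrite s ?formZl 1?s//; exact: subspaceZ.
Qed.

Lemma form_norm_ge0 u : 0 <= form_norm B u. Proof. exact: sqrtr_ge0. Qed.

Lemma form_norm_sqr u : E u -> form_norm B u ^+ 2 = B u u.
Proof. by case: hB => _ _ p Eu; rewrite sqr_sqrtr// p. Qed.

Lemma form_cs u v : E u -> E v -> `|B u v| <= form_norm B u * form_norm B v.
Proof.
move=> Eu Ev; have [l s p] := hB.
rewrite -(@ler_pXn2r _ 2)// ?nnegrE ?mulr_ge0 ?form_norm_ge0// real_normK ?num_real//.
rewrite exprMn !form_norm_sqr//.
have q t : 0 <= t ^+ 2 * B u u + 2 * t * B u v + B v v.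
  have : 0 <= B (t *: u + v) (t *: u + v) by apply: p; exact: hE.2.
  rewrite l//; last exact: hE.2.
  rewrite !formDr ?formZr//; [|exact: subspaceZ|exact: subspaceZ].
  rewrite (s v u)//; congr (_ <= _); ring.
have [uu0|uu0] := eqVneq (B u u) 0.
  rewrite uu0 mul0r.
  have [->|uv0] := eqVneq (B u v) 0; first by rewrite expr0n.
  have := q (- (B v v + 1) / (2 * B u v)); rewrite uu0 mulr0 add0r.
  have -> : 2 * (- (B v v + 1) / (2 * B u v)) * B u v = - (B v v + 1) by field.
  by move=> h; exfalso; lra.
have u0 : 0 < B u u by rewrite lt_neqAle eq_sym uu0 p.
have := q (- B u v / B u u).
have -> : (- B u v / B u u) ^+ 2 * B u u + 2 * (- B u v / B u u) * B u v + B v v =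
  (B u u * B v v - B u v ^+ 2) / B u u by field.
by rewrite pmulr_lge0 ?invr_gt0// subr_ge0.
Qed.

Lemma form_tri u v : E u -> E v -> form_norm B (u + v) <= form_norm B u + form_norm B v.
Proof.
move=> Eu Ev; have [l s p] := hB.
rewrite -(@ler_pXn2r _ 2)// ?nnegrE ?addr_ge0 ?form_norm_ge0//.
have Euv := subspaceD Eu Ev.
rewrite form_norm_sqr// formDl// !formDr// sqrrD !form_norm_sqr// (s v u)//.
have := form_cs Eu Ev; rewrite ler_norml => /andP[_ h].
by rewrite mulr2n; lra.
Qed.

Lemma form_normZ c u : E u -> form_norm B (c *: u) = `|c| * form_norm B u.
Proof.
move=> Eu; rewrite /form_norm formZl//; last exact: subspaceZ.
by rewrite formZr// mulrA -expr2 sqrtrM ?sqr_ge0// sqrtr_sqr.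
Qed.

Lemma form_normN u : E u -> form_norm B (- u) = form_norm B u.
Proof. by move=> Eu; rewrite -scaleN1r form_normZ// normrN1 mul1r. Qed.

Lemma form_normBC u v : E u -> E v -> form_norm B (u - v) = form_norm B (v - u).
Proof. by move=> Eu Ev; rewrite -opprB form_normN//; exact: subspaceB. Qed.

Lemma form_triB u v w : E u -> E v -> E w ->
  form_norm B (u - w) <= form_norm B (u - v) + form_norm B (v - w).
Proof.
move=> Eu Ev Ew; rewrite -[u - w](subrKA v).
by apply: form_tri; exact: subspaceB.
Qed.

End Forms.

(** * Integration by parts *)

Section IntegrationByParts.
Context {R : realType} {d : nat}.
Local Notation leb := (@lebesgue_rV R d).
Implicit Types (f g h phi : 'rV[R]_d -> R) (i : 'I_d).

Lemma continuous_bounded_on f (M : R) : continuous f ->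
  exists K, 0 <= K /\ forall x, `|x| <= M -> `|f x| <= K.
Proof.
move=> cf.
have cB : compact (closed_box (const_mx (- M) : 'rV[R]_d) (const_mx M)).
  by apply: bounded_closed_compact; [exact: bounded_closed_box|exact: closed_closed_box].
have /compact_bounded[K [_ hK]] : compact (f @` closed_box (const_mx (- M) : 'rV[R]_d) (const_mx M)).
  by apply: continuous_compact => //; exact: continuous_subspaceT.
exists (`|K| + 1); split; first by rewrite addr_ge0.
move=> x xM; apply: (hK (`|K| + 1)); first by rewrite (le_lt_trans (ler_norm K)) ?ltrDl.
exists x => // j; rewrite in_itv/= !mxE -ler_norml (le_trans _ xM)//.
exact: coord_le_norm.
Qed.

Lemma integral_shift_rV f (c : 'rV[R]_d) : leb.-integrable setT (EFin \o f) ->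
  leb.-integrable setT (EFin \o (fun x => f (x + c))) ->
  \int[leb]_x f (x + c) = \int[leb]_x f x.
Proof.
move=> fi fci; rewrite /Rintegral; congr fine.
have := @integral_pushforward _ _ _ _ R (fun x : 'rV[R]_d => x + c) (measurable_shift_rV c)
  leb setT (EFin \o f) (measurable_int _ fi).
rewrite preimage_setT => /(_ fci measurableT) <-.
apply: eq_measure_integral; first exact: measurable_shift_rV.
by move=> mT A mA _; exact: lebesgue_rV_shift.
Qed.

Lemma partial_eq0 f i x : (\forall y \near x, f y = 0) -> partial i f x = 0.
Proof. by move=> fx; rewrite /partial (@near_eq_derive _ _ _ f (cst 0))// derive_cst. Qed.

(** A compactly supported derivative integrates to zero: difference quotients
    do by translation invariance. *)
Lemma integral_partial_eq0 f i (M : R) : (forall x, differentiable f x) ->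
  continuous (partial i f) -> (forall x, M <= `|x| -> f x = 0) ->
  leb.-integrable setT (EFin \o partial i f) /\ \int[leb]_x partial i f x = 0.
Proof.
move=> df cpf fM.
set e := delta_mx ord0 i : 'rV[R]_d.
have ne : `|e| <= 1.
  rewrite [leLHS]mx_normrE; apply: bigmax_le => // -[a b] _ /=.
  by rewrite mxE; case: (_ && _); rewrite ?normr1 ?normr0.
have pfM x : M < `|x| -> partial i f x = 0.
  move=> Mx; apply: partial_eq0; near=> y; apply: fM; apply: ltW; near: y.
  have : (fun y : 'rV[R]_d => `|y|) y @[y --> x] --> `|x| by exact: norm_continuous.
  by move=> /cvgr_gt; apply.
have [K [K0 hK]] := continuous_bounded_on (M + 2) cpf.
have hK' x : `|partial i f x| <= K.
  by have [/hK//|Mx] := leP `|x| (M + 2); rewrite pfM ?normr0//; lra.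
pose B : set 'rV[R]_d := closed_box (const_mx (- (M + 2))) (const_mx (M + 2)).
have mB : measurable B.
  by apply: (measurable_rV_set (B := fun j => `[_, _]%classic)) => j; exact: measurable_itv.
have fB : (leb B < +oo)%E by apply: bounded_lebesgue_rV_fin => //; exact: bounded_closed_box.
have outB x : ~ B x -> M + 2 < `|x|.
  move=> nB; rewrite ltNge; apply/negP => xM; apply: nB => j.
  rewrite in_itv/= !mxE -ler_norml (le_trans _ xM)//.
  exact: coord_le_norm.
have dom g : measurable_fun setT g -> (forall x, `|g x| <= K * \1_B x) ->
    leb.-integrable setT (EFin \o g).
  move=> mg gB; apply: (intg_dom measurableT mg _ (g := fun x => K * \1_B x)) => //.
  apply: intgZ => //; exact: intg_indic.
have mf : measurable_fun setT f.
  by apply: continuous_measurable_rV => x; exact/differentiable_continuous.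
have mfs (c : 'rV[R]_d) : measurable_fun setT (fun x : 'rV[R]_d => f (x + c)).
  by apply: measurableT_comp => //; exact: measurable_shift_rV.
have [L [L0 hL]] : exists L, 0 <= L /\ forall x, `|f x| <= L * \1_B x.
  have cf : continuous f by move=> x; exact/differentiable_continuous.
  have [L [L0 hL]] := continuous_bounded_on (M + 2) cf.
  exists L; split => // x; rewrite indicE; case: (boolP (x \in B)) => [/set_mem Bx|/negP nB].
    rewrite mulr1; have [/hL//|Mx] := leP `|x| (M + 2).
    by rewrite fM ?normr0//; lra.
  rewrite mulr0 fM ?normr0//.
  by have := outB x (fun Bx => nB (mem_set Bx)); lra.
have ipf : leb.-integrable setT (EFin \o partial i f).
  apply: dom; first exact: continuous_measurable_rV.
  move=> x; rewrite indicE; case: (boolP (x \in B)) => [_|/negP nB]; first by rewrite mulr1.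
  rewrite pfM ?normr0 ?mulr0//.
  by have := outB x (fun Bx => nB (mem_set Bx)); lra.
split => //.
pose t (k : nat) : R := k.+1%:R^-1.
have t0 k : 0 < t k by rewrite invr_gt0.
have t1 k : t k <= 1 by rewrite invf_le1// ler1n.
pose q k x := (t k)^-1 * (f (x + t k *: e) - f x).
have mq k : measurable_fun setT (q k).
  by apply: measurable_funM => //; exact: measurable_funB.
have qB k x : `|q k x| <= K * \1_B x.
  pose g s := f (s *: e + x).
  have dg (s : R) : is_derive s 1 g (partial i f (s *: e + x)).
    have ds : derivable f (s *: e + x) e by apply: diff_derivable; exact: df.
    apply: DeriveDef; last first.
      rewrite /partial -/e /derive; apply: (congr1 (fun h : R -> R => lim (h @ 0^'))).
      by apply/funext => h /=; rewrite /g addrA -scalerDl [h%:A]mulr1.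
    apply/derivable1P; move/derivable1P: ds.
    have -> // : (fun h : R => g (h *: 1 + s)) = (fun h : R => f (h *: e + (s *: e + x))).
    by apply/funext => h; rewrite /g addrA -scalerDl [h%:A]mulr1.
  have [|s /[!in_itv]/= /andP[s0 s1] gs] := @MVT R g (fun s => partial i f (s *: e + x)) 0 (t k) (t0 k) (fun s _ => dg s).
    apply: derivable_within_continuous => s _; exact: ex_derive.
  have -> : q k x = partial i f (s *: e + x).
    move: gs; rewrite /g subr0 scale0r add0r /q [x + _]addrC => ->.
    by rewrite mulrC mulfK// gt_eqF.
  rewrite indicE; case: (boolP (x \in B)) => [_|/negP nB]; first by rewrite mulr1.
  rewrite pfM ?normr0 ?mulr0//.
  have := outB x (fun Bx => nB (mem_set Bx)).
  have : `|x| <= `|s *: e + x| + `|s *: e|.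
    by rewrite -[X in `|X| <= _](addKr (s *: e) x) addrC (le_trans (ler_normB _ _)).
  have : `|s *: e| <= 1.
    rewrite normrZ (gtr0_norm s0); apply: mulr_ile1 => //; first exact: ltW.
    exact: le_trans (ltW s1) (t1 k).
  by lra.
have iq k : leb.-integrable setT (EFin \o q k) by exact: dom.
have fi : leb.-integrable setT (EFin \o f).
  apply: (intg_dom measurableT mf _ (fun x _ => hL x)).
  by apply: intgZ => //; exact: intg_indic.
have q0 k : \int[leb]_x q k x = 0.
  have fci : leb.-integrable setT (EFin \o (fun x => f (x + t k *: e))).
    rewrite (_ : _ \o _ = EFin \o (fun x => t k * q k x + f x)).
      by apply: intgD => //; exact: intgZ.
    by apply/funext => x /=; rewrite /q mulrA divff ?gt_eqF// mul1r subrK.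
  rewrite RintegralZl//; last exact: intgB.
  by rewrite RintegralB// integral_shift_rV// subrr mulr0.
have cvgI : (fun k => \int[leb]_x (q k x)%:E)%E @ \oo --> (\int[leb]_x (partial i f x)%:E)%E.
  apply: (@dominated_cvg _ _ _ _ setT measurableT _ _ (fun x => (K * \1_B x)%:E)) => //.
  - by move=> k; exact/measurable_EFinP.
  - move=> x _; apply: cvg_EFin; first exact: nearW.
    have /(_ x) dx : forall x, derivable f x e by move=> y; apply: diff_derivable; exact: df.
    have : (fun h : R => h^-1 *: ((f \o shift x) (h *: e) - f x)) @ 0^' --> partial i f x by exact: dx.
    move=> /cvgr_dnbhsP; move=> /(_ t) h.
    rewrite (_ : fine \o _ = (fun k => (t k)^-1 *: ((f \o shift x) (t k *: e) - f x))); last first.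
      by apply/funext => k /=; rewrite /q [x + _]addrC.
    apply: h; split; first by move=> k; rewrite gt_eqF.
    exact: cvg_harmonic.
  - by apply: intgZ => //; exact: intg_indic.
  - by move=> k x _ /=; rewrite lee_fin.
have : (\int[leb]_x (partial i f x)%:E = 0)%E.
  apply: (cvg_unique _ cvgI) => //.
  rewrite (_ : (fun _ => _) = cst 0%E); first exact: cvg_cst.
  apply/funext => k; rewrite -[LHS]fineK; last by apply: integrable_fin_num => //; exact: iq.
  by have := q0 k; rewrite /Rintegral => ->.
by rewrite /Rintegral => ->.
Unshelve. all: by end_near. Qed.

End IntegrationByParts.

(** * The Sobolev spaces *)

Section Sobolev.
Context {R : realType} {d : nat}.
Local Notation leb := (@lebesgue_rV R d).
Local Notation fT := ('rV[R]_d -> R).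
Implicit Types (u v g phi theta : fT) (i : 'I_d).
Variable D : set 'rV[R]_d.
Hypotheses (oD : open D) (bD : bounded_set D).

Let mD : measurable D := open_measurable_rV oD.
Let fD : (leb D < +oo)%E := bounded_lebesgue_rV_fin mD bD.

Lemma Lspace2P v : Lspace_on 2%:E D v <-> L2 leb D v.
Proof.
have sq : (fun x => (v \_ D) x ^+ 2) = (fun x => v x ^+ 2) \_ D.
  by apply/funext => x; rewrite !patchE; case: (x \in D); rewrite ?expr0n.
split.
  move=> h; split.
    by apply/(measurable_restrictT _ mD); move: h; rewrite /Lspace_on inE => /andP[/[!inE]].
  have := Lfun2_integrable_sqr h; rewrite sq => h2.
  by apply/(integrable_mkcond _ mD); rewrite restrict_EFin.
move=> [mv iv]; rewrite /Lspace_on inE; apply/andP; rewrite !inE; split.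
  exact/(measurable_restrictT _ mD).
rewrite /= /finite_norm unlock.
apply: poweR_lty; have /integrableP[_] := iv; apply: le_lt_trans.
rewrite [leRHS]integral_mkcond le_eqVlt; apply/orP; left; apply/eqP.
apply: eq_integral => x _; rewrite /= !patchE; case: (x \in D) => /=.
  by rewrite normrX powR_mulrn.
by rewrite normr0 powR0.
Qed.

Lemma test_facts phi : test_function D phi -> [/\ forall x, differentiable phi x,
  continuous phi, (exists M, forall x, M <= `|x| -> phi x = 0) &
  forall x, ~ D x -> phi x = 0].
Proof.
move=> [sm cpt sub].
have df x : differentiable phi x := sm [::] x.
split => //; first by move=> x; exact: differentiable_continuous.
  have [M [_ hM]] := compact_bounded cpt.
  exists (`|M| + 2) => x Mx; apply/eqP; apply: contraTT Mx => px.
  rewrite -ltNge (le_lt_trans (hM (`|M| + 1) _ x _))//.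
  - by rewrite (le_lt_trans (ler_norm M)) ?ltrDl.
  - exact: subset_closure.
  - by rewrite ltrD2l ltr1n.
move=> x nDx; apply/eqP; apply: contra_notT nDx => px; apply: sub.
exact: subset_closure.
Qed.

Lemma partial_test i phi : test_function D phi -> test_function D (partial i phi).
Proof.
move=> [sm cpt sub].
have cl : closure [set x | partial i phi x != 0] `<=` closure [set x | phi x != 0].
  rewrite [X in _ `<=` X]((closure_id _).1 (@closed_closure _ [set x | phi x != 0])).
  apply: closure_subset => x /= pn; apply: contrapT => nx; move/eqP: pn; apply.
  apply: partial_eq0.
  have : open (~` closure [set x | phi x != 0]) by exact/closed_openC/closed_closure.
  rewrite openE => /(_ _ nx); apply: filterS => y ny; apply/eqP.
  by apply: contra_notT ny => py; exact: subset_closure.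
split.
- by move=> s x; have := sm (rcons s i) x; rewrite foldr_rcons.
- by apply: subclosed_compact cl => //; exact: closed_closure.
- exact: subset_trans sub.
Qed.

Lemma test_bounded phi : test_function D phi -> exists K, forall x, `|phi x| <= K.
Proof.
move=> /test_facts[_ c [M hM] _].
have [K [K0 hK]] := continuous_bounded_on M c.
by exists K => x; have [/hK//|/ltW/hM->] := leP `|x| M; rewrite normr0.
Qed.

Lemma test_L2 phi : test_function D phi -> L2 leb D phi.
Proof.
move=> tp; have [K hK] := test_bounded tp; have [_ c _ _] := test_facts tp.
apply: (L2_bounded mD (M := K)) => //.
exact: measurable_funTS (continuous_measurable_rV c).
Qed.

Lemma Rintegral_supp g : (forall x, ~ D x -> g x = 0) ->
  \int[leb]_(x in D) g x = \int[leb]_x g x.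
Proof.
move=> g0; rewrite Rintegral_mkcond; apply: eq_Rintegral => x _.
by rewrite patchE; case: ifPn => // /negP nD; rewrite g0// => /mem_set.
Qed.

Lemma continuousM_rV (f g : fT) : continuous f -> continuous g ->
  continuous (fun x => f x * g x).
Proof. by move=> cf cg x; exact: (continuousM (cf x) (cg x)). Qed.

Lemma continuousD_rV (f g : fT) : continuous f -> continuous g ->
  continuous (fun x => f x + g x).
Proof. by move=> cf cg x; exact: (continuousD (cf x) (cg x)). Qed.

Lemma test_is_weak_partial i phi : test_function D phi ->
  is_weak_partial D i phi (partial i phi).
Proof.
move=> tp theta tt.
have [dp cp [M hM] p0] := test_facts tp; have [dt ct _ t0] := test_facts tt.
have [_ cp' _ _] := test_facts (partial_test i tp).
have [_ ct' _ _] := test_facts (partial_test i tt).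
have pE : partial i (phi * theta) = (fun x => phi x * partial i theta x + theta x * partial i phi x).
  by apply/funext => x; rewrite /partial deriveM//; exact: diff_derivable.
have [||| _] := @integral_partial_eq0 _ _ (phi * theta) i M.
- by move=> x; exact: differentiableM.
- by rewrite pE; apply: continuousD_rV; exact: continuousM_rV.
- by move=> x /hM p; rewrite -[LHS]/(_ * _) p mul0r.
rewrite pE -Rintegral_supp; last by move=> x Dx; rewrite p0// t0// !mul0r addr0.
rewrite RintegralD//.
- move/eqP; rewrite addr_eq0 => /eqP ->; congr (- _).
  by apply: eq_Rintegral => x _; rewrite mulrC.
- by apply: L2_mul => //; apply: test_L2 => //; exact: partial_test.
- by apply: L2_mul => //; apply: test_L2 => //; exact: partial_test.
Qed.

Lemma weak_partial_unique i v g g' : L2 leb D g -> L2 leb D g' ->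
  is_weak_partial D i v g -> is_weak_partial D i v g' ->
  {ae leb, forall x, D x -> g x = g' x}.
Proof.
move=> l l' w w'.
have ll := L2B mD l l'.
have := @fundamental_lemma _ _ D (fun x => g x - g' x) oD (L2_intg mD fD ll).
have h phi : test_function D phi -> \int[leb]_(x in D) ((g x - g' x) * phi x) = 0.
  move=> tp; have lp := test_L2 tp.
  have := w _ tp; rewrite w'// => /oppr_inj h.
  under eq_Rintegral do rewrite mulrBl.
  by rewrite RintegralB ?h ?subrr//; exact: L2_mul.
by move=> /(_ h); apply: filterS => x /[apply] /eqP; rewrite subr_eq0 => /eqP.
Qed.

Lemma H1_L2 v : H1 D v -> L2 leb D v.
Proof. by move=> [/Lspace2P]. Qed.

Lemma weak_partialP i v : H1 D v ->
  L2 leb D (weak_partial D i v) /\ is_weak_partial D i v (weak_partial D i v).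
Proof.
move=> [_ /(_ i) [g gP]].
have [/= l w] := @xgetPex _ (fun=> 0) [set g | Lspace_on 2%:E D g /\ is_weak_partial D i v g] (ex_intro _ g gP).
by split => //; exact/Lspace2P.
Qed.

Lemma weak_partial_eq i v g : H1 D v -> L2 leb D g -> is_weak_partial D i v g ->
  {ae leb, forall x, D x -> weak_partial D i v x = g x}.
Proof.
by move=> hv lg wg; have [l w] := weak_partialP i hv; exact: weak_partial_unique l lg w wg.
Qed.

Lemma is_weak_partial_lin i (c : R) u v gu gv :
  L2 leb D u -> L2 leb D v -> L2 leb D gu -> L2 leb D gv ->
  is_weak_partial D i u gu -> is_weak_partial D i v gv ->
  is_weak_partial D i (c *: u + v) (c *: gu + gv).
Proof.
move=> lu lv lgu lgv wu wv phi tp.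
have lp := test_L2 tp; have lp' := test_L2 (partial_test i tp).
have E (a b t : fT) : L2 leb D a -> L2 leb D b -> L2 leb D t ->
    \int[leb]_(x in D) ((c *: a + b) x * t x) =
    c * \int[leb]_(x in D) (a x * t x) + \int[leb]_(x in D) (b x * t x).
  move=> la lb lt.
  rewrite -RintegralZl//; last exact: L2_mul.
  rewrite -RintegralD//; last 2 first.
    by apply: intgZ => //; exact: L2_mul.
    exact: L2_mul.
  by apply: eq_Rintegral => x _; rewrite -[(c *: a + b) x]/(c * a x + b x) mulrDl mulrA.
by rewrite !E// wu// wv// mulrN -opprD.
Qed.

Lemma H1_lin (c : R) u v : H1 D u -> H1 D v -> H1 D (c *: u + v).
Proof.
move=> hu hv; have lu := H1_L2 hu; have lv := H1_L2 hv.
split; first by apply/Lspace2P; exact: L2_lin.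
move=> i; have [lgu wu] := weak_partialP i hu; have [lgv wv] := weak_partialP i hv.
exists (c *: weak_partial D i u + weak_partial D i v); split.
  by apply/Lspace2P; exact: L2_lin.
exact: is_weak_partial_lin.
Qed.

Lemma weak_partial_lin i (c : R) u v : H1 D u -> H1 D v ->
  {ae leb, forall x, D x -> weak_partial D i (c *: u + v) x =
    c * weak_partial D i u x + weak_partial D i v x}.
Proof.
move=> hu hv; have [lgu wu] := weak_partialP i hu; have [lgv wv] := weak_partialP i hv.
apply: weak_partial_eq; first exact: H1_lin.
  exact: L2_lin.
by apply: is_weak_partial_lin => //; exact: H1_L2.
Qed.

Lemma test_H1 phi : test_function D phi -> H1 D phi.
Proof.
move=> tp; split; first by apply/Lspace2P; exact: test_L2.
move=> i; exists (partial i phi); split; last exact: test_is_weak_partial.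
by apply/Lspace2P; apply: test_L2; exact: partial_test.
Qed.

Lemma test0 : test_function D (fun=> 0).
Proof.
have e : [set x : 'rV[R]_d | (0 : R) != 0] = set0 by apply/seteqP; split => x //=; rewrite eqxx.
split; [|by rewrite e closure0; exact: compact0|by rewrite e closure0].
move=> s; have -> : foldr partial (fun=> 0) s = cst (0 : R) :> fT.
  elim: s => //= i s ->; apply/funext => x; exact: derive_cst.
by move=> x; exact: differentiable_cst.
Qed.

Lemma H1_subspace : is_subspace (H1 D : set fT).
Proof. by split; [exact: (test_H1 test0)|exact: H1_lin]. Qed.

Definition wform (a : fT) u v : R := \int[leb]_(x in D) (a x * grad_dot D u v x).

Lemma wform_sumE a u v : bounded_weight leb D a -> H1 D u -> H1 D v ->
  (forall i, leb.-integrable D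
     (EFin \o (fun x => a x * (weak_partial D i u x * weak_partial D i v x)))) /\
  wform a u v = \sum_(i < d) \int[leb]_(x in D)
    (a x * (weak_partial D i u x * weak_partial D i v x)).
Proof.
move=> ba hu hv.
have ii i : leb.-integrable D
     (EFin \o (fun x => a x * (weak_partial D i u x * weak_partial D i v x))).
  by apply: (L2_wmul mD) => //; [exact: (weak_partialP i hu).1|exact: (weak_partialP i hv).1].
split => //; rewrite -Rintegral_sum//.
by apply: eq_Rintegral => x _; rewrite /grad_dot big_distrr.
Qed.

Lemma wform_intg a u v : bounded_weight leb D a -> H1 D u -> H1 D v ->
  leb.-integrable D (EFin \o (fun x => a x * grad_dot D u v x)).
Proof.
move=> ba hu hv; have [ii _] := wform_sumE ba hu hv.
have := intg_sum mD ii; congr (leb.-integrable D (EFin \o _)).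
by apply/funext => x; rewrite /grad_dot big_distrr.
Qed.

Lemma wform_psd a : bounded_weight leb D a -> {ae leb, forall x, D x -> 0 <= a x} ->
  psd_form (H1 D : set fT) (wform a).
Proof.
move=> ba a0; have [ma _] := ba; split.
- move=> c u v w hu hv hw.
  have hl := H1_lin c hu hv.
  have [iu ->] := wform_sumE ba hu hw; have [iv ->] := wform_sumE ba hv hw.
  have [il ->] := wform_sumE ba hl hw.
  rewrite big_distrr/= -big_split/=; apply: eq_bigr => i _.
  rewrite -RintegralZl// -RintegralD//; last exact: intgZ.
  apply: ae_eq_Rintegral => //.
  + exact: intg_measurable (il i).
  + by apply: measurable_funD; [apply: measurable_funM => //|]; exact: intg_measurable.
  + by apply: filterS (weak_partial_lin i c hu hv) => x /[apply] ->; ring.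
- move=> u v _ _; apply: eq_Rintegral => x _; congr (_ * _).
  by apply: eq_bigr => i _; rewrite mulrC.
- move=> u hu; rewrite -[X in X <= _](_ : \int[leb]_(x in D) 0 = 0); last first.
    by rewrite /Rintegral integral0.
  apply: ae_le_Rintegral => //.
  + exact: intg_cst.
  + exact: wform_intg.
  + apply: filterS a0 => x /[apply] a0; rewrite mulr_ge0//.
    by apply: sumr_ge0 => i _; rewrite -expr2 sqr_ge0.
Qed.

(* Keeps unification from unfolding integrals when it compares atoms. *)
Opaque Rintegral.

Lemma wformD a b u v : bounded_weight leb D a -> bounded_weight leb D b ->
  H1 D u -> H1 D v ->
  wform (fun x => a x + b x) u v = wform a u v + wform b u v.
Proof.
move=> ba bb hu hv; rewrite /wform -RintegralD//.
- by apply: eq_Rintegral => x _; rewrite mulrDl.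
- exact: wform_intg.
- exact: wform_intg.
Qed.

Lemma wformZ (c : R) a u v : bounded_weight leb D a -> H1 D u -> H1 D v ->
  wform (fun x => c * a x) u v = c * wform a u v.
Proof.
move=> ba hu hv; rewrite /wform -RintegralZl//; last exact: wform_intg.
by apply: eq_Rintegral => x _; rewrite mulrA.
Qed.

Lemma bounded_weightD a b : bounded_weight leb D a -> bounded_weight leb D b ->
  bounded_weight leb D (fun x => a x + b x).
Proof.
move=> [ma [M aM]] [mb [N bN]]; split; first exact: measurable_funD.
exists (M + N); apply: filterS2 aM bN => x + + Dx => /(_ Dx) h1 /(_ Dx) h2.
by rewrite (le_trans (ler_normD _ _))// lerD.
Qed.

Lemma bounded_weightZ (c : R) a : bounded_weight leb D a ->
  bounded_weight leb D (fun x => c * a x).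
Proof.
move=> [ma [M aM]]; split; first exact: measurable_funM.
by exists (`|c| * M); apply: filterS aM => x /[apply] h; rewrite normrM ler_wpM2l.
Qed.

Lemma bounded_weightB a b : bounded_weight leb D a -> bounded_weight leb D b ->
  bounded_weight leb D (fun x => a x - b x).
Proof.
move=> ba /(bounded_weightZ (-1)) bb; have := bounded_weightD ba bb.
by congr bounded_weight; apply/funext => x; rewrite mulN1r.
Qed.

Lemma wformB a b u v : bounded_weight leb D a -> bounded_weight leb D b ->
  H1 D u -> H1 D v ->
  wform (fun x => a x - b x) u v = wform a u v - wform b u v.
Proof.
move=> ba bb hu hv; rewrite -mulN1r -wformZ// -wformD//; last exact: bounded_weightZ.
by congr wform; apply/funext => x; rewrite mulN1r.
Qed.

Lemma wform_ge0 a u : bounded_weight leb D a -> {ae leb, forall x, D x -> 0 <= a x} ->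
  H1 D u -> 0 <= wform a u u.
Proof. by move=> ba a0 hu; have [_ _] := wform_psd ba a0; exact. Qed.

Lemma wform_mono a b u : bounded_weight leb D a -> bounded_weight leb D b ->
  {ae leb, forall x, D x -> a x <= b x} -> H1 D u -> wform a u u <= wform b u u.
Proof.
move=> ba bb ab hu; rewrite -subr_ge0 -wformB//; apply: wform_ge0 => //.
  exact: bounded_weightB.
by apply: filterS ab => x /[apply]; rewrite subr_ge0.
Qed.

Lemma lagrange_norm (k a1 b1 c1 a2 b2 c2 : R) : 0 <= k -> 0 <= a1 -> 0 <= b1 ->
  0 <= c1 -> 0 <= a2 -> 0 <= b2 -> 0 <= c2 ->
  a1 ^+ 2 + b1 ^+ 2 = 2 * k * c1 ^+ 2 -> a2 ^+ 2 + b2 ^+ 2 = 2 * k * c2 ^+ 2 ->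
  a1 * a2 + b1 * b2 <= 2 * k * (c1 * c2).
Proof.
move=> k0 a10 b10 c10 a20 b20 c20 e1 e2.
rewrite -(@ler_pXn2r _ 2)// ?nnegrE ?addr_ge0 ?mulr_ge0//.
rewrite (_ : (2 * k * (c1 * c2)) ^+ 2 = (2 * k * c1 ^+ 2) * (2 * k * c2 ^+ 2)); last by ring.
rewrite -e1 -e2 -subr_ge0 (_ : _ - _ = (a1 * b2 - b1 * a2) ^+ 2) ?sqr_ge0//; ring.
Qed.

(** The weight [a] splits as half the difference of the nonnegative weights
    [k b + a] and [k b - a]; the bound is Cauchy-Schwarz for each of these. *)
Lemma wform_cs (k : R) a b u v : bounded_weight leb D a -> bounded_weight leb D b ->
  {ae leb, forall x, D x -> `|a x| <= k * b x} -> 0 <= k ->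
  {ae leb, forall x, D x -> 0 <= b x} -> H1 D u -> H1 D v ->
  `|wform a u v| <= k * (form_norm (wform b) u * form_norm (wform b) v).
Proof.
move=> ba bb ab k0 b0 hu hv.
have bkb := bounded_weightZ k bb.
have bp := bounded_weightD bkb ba; have bm := bounded_weightB bkb ba.
set p := fun x => k * b x + a x; set m := fun x => k * b x - a x.
have pp : psd_form (H1 D : set fT) (wform p).
  apply: wform_psd => //; apply: filterS ab => x /[apply].
  by rewrite ler_norml => /andP[h _]; rewrite /p -(opprK (a x)) subr_ge0 lerNl.
have pm : psd_form (H1 D : set fT) (wform m).
  apply: wform_psd => //; apply: filterS ab => x /[apply].
  by rewrite ler_norml => /andP[_ h]; rewrite /m subr_ge0.
have pb := wform_psd bb b0.
have e : wform a u v = 2^-1 * (wform p u v - wform m u v).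
  by rewrite wformD// wformB//; lra.
have s w : H1 D w -> form_norm (wform p) w ^+ 2 + form_norm (wform m) w ^+ 2 =
    2 * k * form_norm (wform b) w ^+ 2.
  move=> hw; rewrite !(form_norm_sqr pp, form_norm_sqr pm, form_norm_sqr pb)//.
  have E1 : wform p w w = wform (fun x => k * b x) w w + wform a w w := wformD bkb ba hw hw.
  have E2 : wform m w w = wform (fun x => k * b x) w w - wform a w w := wformB bkb ba hw hw.
  rewrite E1 E2 (wformZ k bb hw hw).
  by move: (wform a w w) (wform b w w) => X Y; ring.
have c1 := form_cs H1_subspace pp hu hv; have c2 := form_cs H1_subspace pm hu hv.
have := s _ hu; have := s _ hv.
have := form_norm_ge0 (wform p) u; have := form_norm_ge0 (wform p) v.
have := form_norm_ge0 (wform m) u; have := form_norm_ge0 (wform m) v.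
have := form_norm_ge0 (wform b) u; have := form_norm_ge0 (wform b) v.
move: c1 c2; set a1 := form_norm _ u; set a2 := form_norm _ v.
set b1 := form_norm _ u; set b2 := form_norm _ v.
set c1 := form_norm _ u; set c2 := form_norm _ v.
move=> h1 h2 c20 c10 b20 b10 a20 a10 e2 e1.
have key : a1 * a2 + b1 * b2 <= 2 * k * (c1 * c2).
  exact: (lagrange_norm k0 a10 b10 c10 a20 b20 c20 e1 e2).
rewrite e normrM ger0_norm// (le_trans (ler_wpM2l _ (ler_normB _ _)))//.
rewrite (_ : k * (c1 * c2) = 2^-1 * (2 * k * (c1 * c2))); last by field.
by rewrite ler_wpM2l// (le_trans _ key)// lerD.
Qed.

(** The inner product of H^1(D); without the zeroth-order term it is the one
    that defines the norm of H^1_0(D). *)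
Definition dirichlet u v : R := wform (fun=> 1) u v.
Definition h1form u v : R := \int[leb]_(x in D) (u x * v x) + dirichlet u v.

Lemma bounded_weight1 : bounded_weight leb D (fun=> 1).
Proof.
by split; [exact: measurable_cst|exists 1; apply: aeW => x _; rewrite normr1].
Qed.

Lemma dirichlet_psd : psd_form (H1 D : set fT) dirichlet.
Proof. by apply: wform_psd; [exact: bounded_weight1|exact: aeW]. Qed.

Lemma L2_subspace : is_subspace ([set u | L2 leb D u] : set fT).
Proof. by split; [exact: L20|move=> c u v; exact: L2_lin]. Qed.

Lemma L2_psd : psd_form ([set u | L2 leb D u] : set fT)
  (fun u v => \int[leb]_(x in D) (u x * v x)).
Proof.
split=> [c u v w lu lv lw|u v _ _|u _].
- rewrite -RintegralZl//; last exact: L2_mul.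
  rewrite -RintegralD//; last 2 first.
    by apply: intgZ => //; exact: L2_mul.
    exact: L2_mul.
  by apply: eq_Rintegral => x _; rewrite -[(c *: u + v) x]/(c * u x + v x) mulrDl mulrA.
- by apply: eq_Rintegral => x _; rewrite mulrC.
- by apply: Rintegral_ge0 => x _; rewrite -expr2 sqr_ge0.
Qed.

Lemma l2form_psd : psd_form (H1 D : set fT) (fun u v => \int[leb]_(x in D) (u x * v x)).
Proof. by apply: psd_form_sub L2_psd => u; exact: H1_L2. Qed.

Lemma h1form_psd : psd_form (H1 D : set fT) h1form.
Proof.
have [l1 s1 p1] := l2form_psd; have [l2 s2 p2] := dirichlet_psd; split.
- by move=> c u v w hu hv hw; rewrite /h1form l1// l2// mulrDr addrACA.
- by move=> u v hu hv; rewrite /h1form (s1 u v hu hv) (s2 u v hu hv).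
- by move=> u hu; rewrite /h1form addr_ge0// ?p1// p2.
Qed.

Lemma H10_normE v : H10_norm D v = form_norm dirichlet v.
Proof.
by rewrite /H10_norm /form_norm; congr Num.sqrt; apply: eq_Rintegral => x _; rewrite mul1r.
Qed.

Lemma H1_normE v : H1_norm D v = form_norm h1form v.
Proof.
rewrite /H1_norm /form_norm /h1form; congr (Num.sqrt (_ + _)).
by apply: eq_Rintegral => x _; rewrite mul1r.
Qed.

Lemma dirichlet_le_h1 v : H1 D v -> form_norm dirichlet v <= form_norm h1form v.
Proof.
move=> hv; rewrite /form_norm ler_wsqrtr// /h1form lerDr.
by have [_ _] := l2form_psd; exact.
Qed.

Lemma H10P v : H10 D v <-> H1 D v /\ forall eps : R, 0 < eps ->
  exists phi, test_function D phi /\ form_norm h1form (v - phi) < eps.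
Proof.
rewrite /H10/=; split => -[hv h]; split => // e /h[phi [tp] he]; exists phi; split => //.
  by move: he; rewrite H1_normE.
by rewrite H1_normE.
Qed.

Lemma testD (c : R) phi theta : test_function D phi -> test_function D theta ->
  test_function D (c *: phi + theta).
Proof.
move=> [s1 c1 d1] [s2 c2 d2].
have cl : closure [set x | (c *: phi + theta) x != 0] `<=`
    closure [set x | phi x != 0] `|` closure [set x | theta x != 0].
  rewrite -closureU; apply: closure_subset => x /=.
  have [p0|p0] := eqVneq (phi x) 0; last by left.
  have [t0|t0] := eqVneq (theta x) 0; last by right.
  by rewrite -[(c *: phi + theta) x]/(c * phi x + theta x) p0 t0 mulr0 addr0 eqxx.
split.
- move=> s; have -> : foldr partial (c *: phi + theta) s = c *: foldr partial phi s + foldr partial theta s.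
    elim: s => //= i s ->; apply/funext => x; rewrite /partial deriveD//; last first.
      by apply: diff_derivable; exact: s2.
      by apply: derivableZ; apply: diff_derivable; exact: s1.
    by rewrite deriveZ//; apply: diff_derivable; exact: s1.
  by move=> x; apply: differentiableD; [apply: differentiableZ; exact: s1|exact: s2].
- apply: subclosed_compact cl; first exact: closed_closure.
  exact: compactU.
- by apply: subset_trans cl _ => x [/d1|/d2].
Qed.

Lemma test_H10 phi : test_function D phi -> H10 D phi.
Proof.
move=> tp; apply/H10P; split; first exact: test_H1.
move=> e e0; exists phi; split => //.
by rewrite subrr /form_norm (form0l H1_subspace h1form_psd) ?sqrtr0//; exact: H1_subspace.1.
Qed.

Lemma H10_H1 v : H10 D v -> H1 D v. Proof. by move=> /H10P[]. Qed.

Lemma H10_subspace : is_subspace (H10 D : set fT).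
Proof.
split; first exact: (test_H10 test0).
move=> c u v /H10P[hu au] /H10P[hv av]; apply/H10P; split; first exact: H1_lin.
move=> e e0.
have e1 : 0 < e / 2 / (`|c| + 1) by rewrite !divr_gt0// ltr_wpDl.
have [phi [tp hp]] := au _ e1; have [theta [tt ht]] := av _ (divr_gt0 e0 (ltr0Sn _ 1)).
exists (c *: phi + theta); split; first exact: testD.
have hpH := test_H1 tp; have htH := test_H1 tt.
rewrite (_ : _ - _ = c *: (u - phi) + (v - theta)); last first.
  by rewrite scalerBr opprD addrACA.
have sB := subspaceB H1_subspace.
apply: le_lt_trans (form_tri H1_subspace h1form_psd _ _) _.
- by apply: (subspaceZ H1_subspace); exact: sB.
- exact: sB.
rewrite (form_normZ H1_subspace h1form_psd); last exact: sB.
rewrite (splitr e); apply: ler_ltD => //.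
apply: le_trans (ler_wpM2l (normr_ge0 c) (ltW hp)) _.
by rewrite mulrCA ger_pMr ?divr_gt0// ler_pdivrMr ?mul1r ?lerDl// ltr_wpDl.
Qed.

Lemma poincare_test (j : 'I_d) phi (M : R) : (forall x, D x -> `|x| <= M) ->
  test_function D phi ->
  \int[leb]_(x in D) (phi x * phi x) <= 4 * M ^+ 2 * dirichlet phi phi.
Proof.
move=> DM tp; have [dp cp [N hN] p0] := test_facts tp.
have tp' := partial_test j tp; have [_ cp' _ p0'] := test_facts tp'.
have lp := test_L2 tp; have lp' := test_L2 tp'; have hp := test_H1 tp.
pose X : fT := fun x => x ord0 j.
have dX x : differentiable X x by exact: differentiable_coord.
have cX : continuous X by move=> x; exact/differentiable_continuous.
have pX x : partial j X x = 1.
  have -> : partial j X x = 'D_1 (shift (x ord0 j)) (0 : R).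
    rewrite /partial /derive; apply: (congr1 (fun g : R -> R => lim (g @ 0^'))).
    apply/funext => h; rewrite /X/= !mxE !eqxx [h%:A]mulr1/=; congr (_ *: _).
    by ring.
  by have /@derive_val := is_derive_shift (0 : R) 1 (x ord0 j).
have pE : partial j (X * (phi * phi)) =
    (fun x => phi x * phi x + 2 * (X x * (phi x * partial j phi x))).
  apply/funext => x; rewrite /partial deriveM//; last 2 first.
    exact: diff_derivable.
    by apply: diff_derivable; exact: differentiableM.
  rewrite deriveM//; last 2 first.
    exact: diff_derivable.
    exact: diff_derivable.
  rewrite -/(partial j phi x) -/(partial j X x) pX.
  by rewrite -![_ *: _]/(_ * _) -[(phi * phi) x]/(phi x * phi x); ring.
have bX : bounded_weight leb D X.
  split; first exact: measurable_funTS (continuous_measurable_rV cX).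
  exists M; apply: aeW => x Dx; apply: le_trans (DM x Dx).
  exact: coord_le_norm.
have [||| _] := @integral_partial_eq0 _ _ (X * (phi * phi)) j N.
- by move=> x; apply: differentiableM => //; exact: differentiableM.
- rewrite pE; apply: continuousD_rV; first exact: continuousM_rV.
  apply: continuousM_rV; first by move=> x; exact: cst_continuous.
  by apply: continuousM_rV => //; exact: continuousM_rV.
- by move=> x /hN p; rewrite -[LHS]/(X x * (phi x * phi x)) p !mulr0.
rewrite pE -Rintegral_supp; last by move=> x Dx; rewrite p0// !mul0r !mulr0 addr0.
have ipp := L2_mul mD lp lp.
have iXp := L2_wmul mD bX lp lp'.
rewrite RintegralD//; last exact: intgZ.
rewrite RintegralZl// => h.
have ipp' := L2_mul mD lp' lp'.
have : - (2 * \int[leb]_(x in D) (X x * (phi x * partial j phi x))) <=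
    2^-1 * \int[leb]_(x in D) (phi x * phi x) +
    2 * M ^+ 2 * \int[leb]_(x in D) (partial j phi x * partial j phi x).
  rewrite -mulNr -!RintegralZl// -RintegralD//; last 2 first.
    exact: intgZ.
    exact: intgZ.
  apply: le_Rintegral => //; first exact: intgZ.
    by apply: intgD => //; exact: intgZ.
  move=> x Dx.
  have XM : `|X x| <= M.
    by apply: le_trans (DM x Dx); exact: coord_le_norm.
  have X2 : X x ^+ 2 <= M ^+ 2.
    by rewrite -(real_normK (num_real (X x))) lerXn2r// nnegrE// (le_trans _ XM).
  have := ler_wpM2r (sqr_ge0 (partial j phi x)) X2.
  have := sqr_ge0 (phi x + 2 * X x * partial j phi x).
  by rewrite !expr2; move: (phi x) (X x) (partial j phi x) => a b c; nra.
have : \int[leb]_(x in D) (partial j phi x * partial j phi x) <= dirichlet phi phi.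
  rewrite /dirichlet; have [ii ->] := wform_sumE bounded_weight1 hp hp.
  rewrite (bigD1 j)//= -[leLHS]addr0 lerD//.
    rewrite le_eqVlt; apply/orP; left; apply/eqP; apply: ae_eq_Rintegral => //.
    - exact: intg_measurable ipp'.
    - exact: intg_measurable (ii j).
    - apply: filterS (weak_partial_eq hp lp' (test_is_weak_partial j tp)) => x /[apply] ->.
      by rewrite mul1r.
  by apply: sumr_ge0 => i _; apply: Rintegral_ge0 => x _; rewrite mul1r -expr2 sqr_ge0.
have M2 : 0 <= 2 * M ^+ 2 by rewrite mulr_ge0// sqr_ge0.
move=> h1 h2; have := ler_wpM2l M2 h1; lra.
Qed.

Local Notation l2norm := (form_norm (fun u v : fT => \int[leb]_(x in D) (u x * v x))).

Lemma l2norm_le_h1 v : H1 D v -> l2norm v <= form_norm h1form v.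
Proof.
move=> hv; rewrite /form_norm ler_wsqrtr// /h1form lerDl.
by have [_ _ p] := dirichlet_psd; exact: p.
Qed.

Hypothesis d0 : (0 < d)%N.

Lemma poincare_arith (x y M e : R) : x * (1 + 2 * M) = e ->
  x + 2 * M * (y + x) <= 2 * M * y + e.
Proof. by move=> <-; lra. Qed.

(** Integrating the derivative of x_j phi^2 gives the inequality for test
    functions; it passes to limits in H^1. *)
Lemma poincare : exists C, 0 <= C /\ forall v, H10 D v ->
  l2norm v <= C * form_norm dirichlet v.
Proof.
have [M0 [_ /(_ (`|M0| + 1))]] := bD.
rewrite (le_lt_trans (ler_norm M0)) ?ltrDl// => /(_ isT) DM.
set M := `|M0| + 1 in DM; have M_ge0 : 0 <= M by rewrite addr_ge0.
exists (2 * M); have C0 : 0 <= 2 * M by rewrite mulr_ge0.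
split => // v hv.
have test phi : test_function D phi -> l2norm phi <= 2 * M * form_norm dirichlet phi.
  move=> tp; have := poincare_test (Ordinal d0) DM tp.
  rewrite (_ : 4 * M ^+ 2 = (2 * M) ^+ 2); last by ring.
  move=> /ler_wsqrtr; rewrite sqrtrM ?sqr_ge0// sqrtr_sqr ger0_norm//.
apply/ler_addgt0Pr => e e0.
have de : 0 < e / (1 + 2 * M) by rewrite divr_gt0// ltr_wpDr.
have hv1 := H10_H1 hv.
have /H10P[_ /(_ _ de)[phi [tp hp]]] := hv.
have hphi := test_H1 tp.
have hd := subspaceB H1_subspace hv1 hphi.
have a1 : l2norm v <= l2norm (v - phi) + l2norm phi.
  have := form_tri H1_subspace l2form_psd hd hphi.
  by rewrite subrK.
have a2 := le_trans (l2norm_le_h1 hd) (ltW hp).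
have a3 := test _ tp.
have a4 : form_norm dirichlet phi <= form_norm dirichlet v + form_norm dirichlet (v - phi).
  rewrite (form_normBC H1_subspace dirichlet_psd hv1 hphi).
  have hd' := subspaceB H1_subspace hphi hv1.
  have := form_tri H1_subspace dirichlet_psd hv1 hd'.
  by rewrite addrC subrK.
have a5 := le_trans (dirichlet_le_h1 hd) (ltW hp).
apply: (le_trans a1); apply: le_trans (lerD a2 a3) _.
have a6 := le_trans a4 (lerD (lexx _) a5).
apply: le_trans (lerD (lexx _) (ler_wpM2l C0 a6)) _.
have : e / (1 + 2 * M) * (1 + 2 * M) = e by rewrite divfK// gt_eqF// ltr_wpDr.
exact: poincare_arith.
Qed.

Lemma h1norm_le_dirichlet : exists C, 0 <= C /\ forall v, H10 D v ->
  form_norm h1form v <= C * form_norm dirichlet v.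
Proof.
have [C [C0 hC]] := poincare; exists (C + 1); split; first by rewrite addr_ge0.
move=> v hv; have hv1 := H10_H1 hv.
have p2 := form_norm_ge0 dirichlet v.
have p1 := form_norm_ge0 (fun u v : fT => \int[leb]_(x in D) (u x * v x)) v.
rewrite -(@ler_pXn2r _ 2)// ?nnegrE ?form_norm_ge0 ?mulr_ge0 ?addr_ge0//.
rewrite (form_norm_sqr h1form_psd hv1) /h1form.
rewrite -(form_norm_sqr l2form_psd hv1) -(form_norm_sqr dirichlet_psd hv1).
have := hC v hv.
move: p1 p2; move: (l2norm v) (form_norm dirichlet v) => x y x0 y0 xy.
have Cy : 0 <= C * y by rewrite mulr_ge0.
have : x ^+ 2 <= (C * y) ^+ 2 by rewrite lerXn2r// nnegrE.
by rewrite !exprMn sqrrD expr1n mulr1 !mulrDl mul1r => h; have := sqr_ge0 y; nra.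
Qed.

Lemma sqr_cvg0 (f q : nat -> R) (K : R) : 0 <= K ->
  (forall n, f n ^+ 2 <= K * q n) -> q @ \oo --> (0 : R) -> f @ \oo --> (0 : R).
Proof.
move=> K0 fq q0; apply/cvgrPdist_le => e e0.
have e1 : 0 < e ^+ 2 / (K + 1) by rewrite divr_gt0 ?exprn_gt0// ltr_wpDl.
move/cvgrPdist_le : q0 => /(_ _ e1); apply: filterS => n.
rewrite !sub0r !normrN => /(le_trans (ler_norm _)) /(ler_wpM2l K0) h.
rewrite -(@ler_pXn2r _ 2)// ?nnegrE ?(ltW e0)// real_normK ?num_real//.
apply: le_trans (fq n) (le_trans h _).
rewrite mulrCA ger_pMr ?exprn_gt0//.
by rewrite ler_pdivrMr ?mul1r ?lerDl// ltr_wpDl.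
Qed.

Lemma l2_cvg_mul (v : nat -> fT) w phi : (forall n, L2 leb D (v n)) -> L2 leb D w ->
  L2 leb D phi -> (fun n => \int[leb]_(x in D) ((v n x - w x) ^+ 2)) @ \oo --> (0 : R) ->
  (fun n => \int[leb]_(x in D) (v n x * phi x)) @ \oo --> \int[leb]_(x in D) (w x * phi x).
Proof.
move=> lv lw lp vw.
have [K K0 hK] : exists2 K, 0 <= K & forall n, (\int[leb]_(x in D) (v n x * phi x) - \int[leb]_(x in D) (w x * phi x)) ^+ 2 <=
    K * \int[leb]_(x in D) ((v n x - w x) ^+ 2).
  exists (\int[leb]_(x in D) (phi x * phi x)).
    by apply: Rintegral_ge0 => x _; rewrite -expr2 sqr_ge0.
  move=> n; have ld := subspaceB L2_subspace (lv n) lw.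
  have := form_cs L2_subspace L2_psd ld lp.
  rewrite (formBl L2_psd (lv n) lw lp).
  rewrite -[leLHS]normr_id => /(@lerXn2r _ 2) h.
  have := h (normr_ge0 _) (mulr_ge0 (form_norm_ge0 _ _) (form_norm_ge0 _ _)).
  rewrite normr_id real_normK ?num_real// exprMn !(form_norm_sqr L2_psd)// mulrC.
  move=> /le_trans; apply; rewrite le_eqVlt; apply/orP; left; apply/eqP; congr (_ * _).
by apply/subr_cvg0; exact: sqr_cvg0 K0 hK vw.
Qed.

(** A Cauchy sequence of H^1_0(D) and its weak gradients converge in L^2; weak
    derivatives pass to the limit, and the approximating test functions are
    inherited. *)
Lemma H10_complete (v : nat -> fT) : (forall n, H10 D (v n)) ->
  (forall e : R, 0 < e -> exists N, forall m n, (N <= m)%N -> (N <= n)%N ->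
     form_norm dirichlet (v m - v n) <= e) ->
  exists w, H10 D w /\ (fun n => form_norm dirichlet (v n - w)) @ \oo --> (0 : R).
Proof.
move=> hv cau.
have [C [C0 hC]] := h1norm_le_dirichlet.
have hv1 n := H10_H1 (hv n).
have sB := subspaceB H1_subspace.
have sB0 := subspaceB H10_subspace.
have cau1 (e : R) : 0 < e -> exists N, forall m n, (N <= m)%N -> (N <= n)%N ->
    form_norm h1form (v m - v n) ^+ 2 <= e.
  move=> e0.
  have e1 : 0 < Num.sqrt e / (C + 1) by rewrite divr_gt0 ?sqrtr_gt0// ltr_wpDl.
  have [N hN] := cau _ e1; exists N => m n Nm Nn.
  have := le_trans (hC _ (sB0 _ _ (hv m) (hv n))) (ler_wpM2l C0 (hN _ _ Nm Nn)).
  move=> h; rewrite -(sqr_sqrtr (ltW e0)) lerXn2r ?nnegrE ?form_norm_ge0 ?sqrtr_ge0//.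
  rewrite (le_trans h)// mulrCA ger_pMr ?sqrtr_gt0//.
  by rewrite ler_pdivrMr ?mul1r ?lerDl// ltr_wpDl.
have lv n : L2 leb D (v n) by exact: H1_L2.
have lg n i : L2 leb D (weak_partial D i (v n)) by exact: (weak_partialP i (hv1 n)).1.
have le1 u : H1 D u -> \int[leb]_(x in D) (u x ^+ 2) <= form_norm h1form u ^+ 2.
  move=> hu; rewrite (form_norm_sqr h1form_psd)// /h1form.
  rewrite (_ : \int[leb]_(x in D) (u x ^+ 2) = \int[leb]_(x in D) (u x * u x)); last first.
    by apply: eq_Rintegral => x _; rewrite expr2.
  by rewrite lerDl; have [_ _ p] := dirichlet_psd; exact: p.
have le2 i u : H1 D u -> \int[leb]_(x in D) (weak_partial D i u x ^+ 2) <= form_norm h1form u ^+ 2.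
  move=> hu; rewrite (form_norm_sqr h1form_psd)// /h1form.
  apply: (@le_trans _ _ (dirichlet u u)); last first.
    by rewrite lerDr; have [_ _ p] := l2form_psd; exact: p.
  rewrite /dirichlet; have [ii ->] := wform_sumE bounded_weight1 hu hu.
  rewrite (bigD1 i)//= -[leLHS]addr0 lerD//.
    by rewrite le_eqVlt; apply/orP; left; apply/eqP; apply: eq_Rintegral => x _; rewrite mul1r expr2.
  by apply: sumr_ge0 => k _; apply: Rintegral_ge0 => x _; rewrite mul1r -expr2 sqr_ge0.
have [|w [lw cw]] := L2_complete mD lv.
  move=> e /cau1[N hN]; exists N => m n Nm Nn.
  by apply: le_trans (hN _ _ Nm Nn); apply: (le1 (v m - v n)); exact: sB.
have hg i : exists g, L2 leb D g /\
    (fun n => \int[leb]_(x in D) ((weak_partial D i (v n) x - g x) ^+ 2)) @ \oo --> (0 : R).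
  apply: (L2_complete mD (fun n => lg n i)).
  move=> e /cau1[N hN]; exists N => m n Nm Nn.
  apply: le_trans (hN _ _ Nm Nn); apply: le_trans (le2 i _ (sB _ _ (hv1 m) (hv1 n))).
  rewrite le_eqVlt; apply/orP; left; apply/eqP; apply: ae_eq_Rintegral => //.
  - by apply: measurable_funX; apply: measurable_funB; [case: (lg m i)|case: (lg n i)].
  - by apply: measurable_funX; case: (weak_partialP i (sB _ _ (hv1 m) (hv1 n))) => -[].
  - apply: filterS (weak_partial_lin i (-1) (hv1 n) (hv1 m)) => x /[apply].
    by rewrite scaleN1r addrC => ->; rewrite mulN1r addrC.
pose g i := projT1 (cid (hg i)).
have lgi i : L2 leb D (g i) by have [] := projT2 (cid (hg i)).
have cgi i : (fun n => \int[leb]_(x in D) ((weak_partial D i (v n) x - g i x) ^+ 2)) @ \oo --> (0 : R).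
  by have [] := projT2 (cid (hg i)).
have wg i : is_weak_partial D i w (g i).
  move=> phi tp.
  have c1 := l2_cvg_mul lv lw (test_L2 (partial_test i tp)) cw.
  have c2 := l2_cvg_mul (fun n => lg n i) (lgi i) (test_L2 tp) (cgi i).
  apply: (cvg_unique _ c1) => //.
  rewrite (_ : (fun n => _) = fun n => - \int[leb]_(x in D) (weak_partial D i (v n) x * phi x)).
    exact: cvgN.
  by apply/funext => n; have [_ ->] := weak_partialP i (hv1 n).
have hw : H1 D w.
  split; first exact/Lspace2P.
  by move=> i; exists (g i); split => //; exact/Lspace2P.
have E n : form_norm h1form (v n - w) ^+ 2 =
    \int[leb]_(x in D) ((v n x - w x) ^+ 2) +
    \sum_(i < d) \int[leb]_(x in D) ((weak_partial D i (v n) x - g i x) ^+ 2).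
  have hd := sB _ _ (hv1 n) hw.
  rewrite (form_norm_sqr h1form_psd)// /h1form; congr (_ + _).
  rewrite /dirichlet; have [ii ->] := wform_sumE bounded_weight1 hd hd.
  apply: eq_bigr => i _; apply: ae_eq_Rintegral => //.
  - exact: intg_measurable (ii i).
  - by apply: measurable_funX; apply: measurable_funB; [case: (lg n i)|case: (lgi i)].
  - apply: filterS2 (weak_partial_lin i (-1) hw (hv1 n)) (weak_partial_eq hw (lgi i) (wg i)) => x.
    move=> + + Dx => /(_ Dx) + /(_ Dx) e.
    by rewrite scaleN1r addrC => ->; rewrite e mulN1r mul1r expr2 addrC.
have cE : (fun n => form_norm h1form (v n - w) ^+ 2) @ \oo --> (0 : R).
  rewrite (_ : (fun n => _) = fun n => \int[leb]_(x in D) ((v n x - w x) ^+ 2) +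
    \sum_(i < d) \int[leb]_(x in D) ((weak_partial D i (v n) x - g i x) ^+ 2)); last first.
    by apply/funext => n; rewrite E.
  rewrite -[X in _ --> X]addr0; apply: cvgD => //.
  rewrite -[X in _ --> X](_ : \sum_(i < d) (0 : R) = 0); last by rewrite big1.
  apply: (@cvg_big R 'I_d +%R 0 xpredT _ _ _ _ (fun i n =>
    \int[leb]_(x in D) ((weak_partial D i (v n) x - g i x) ^+ 2))) => //.
  exact: add_continuous.
have cN : (fun n => form_norm h1form (v n - w)) @ \oo --> (0 : R).
  by apply: sqr_cvg0 (@ler01 R) _ cE => n; rewrite mul1r.
exists w; split.
  apply/H10P; split => // e e0.
  have e2 : 0 < e / 2 by rewrite divr_gt0.
  have [n _ hn] : \forall n \near \oo, form_norm h1form (v n - w) < e / 2.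
    by move/cvgrPdist_lt : cN => /(_ _ e2); apply: filterS => n;
      rewrite sub0r normrN ger0_norm// form_norm_ge0.
  have /H10P[_ /(_ _ e2)[phi [tp hp]]] := hv n.
  exists phi; split => //; have ht := test_H1 tp.
  apply: le_lt_trans (form_triB H1_subspace h1form_psd hw (hv1 n) ht) _.
  rewrite (splitr e); apply: ltrD; last exact: hp.
  rewrite (form_normBC H1_subspace h1form_psd hw (hv1 n)).
  exact: (hn n (leqnn n)).
apply: squeeze_cvgr (cvg_cst 0) cN; apply: nearW => n.
by rewrite form_norm_ge0/= dirichlet_le_h1//; exact: sB.
Qed.

Transparent Rintegral.

End Sobolev.

(** * Nonnegative series and summable sequences *)

Section NonnegSeries.
Context {R : realType}.
Implicit Types (c : nat -> R).

(** Real value of the sum, meaningful when the extended sum is finite. *)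
Definition nnsum c : R := fine (\sum_(0 <= j <oo) (c j)%:E)%E.

Lemma nnsumE c : (forall j, 0 <= c j) -> (\sum_(0 <= j <oo) (c j)%:E < +oo)%E ->
  (\sum_(0 <= j <oo) (c j)%:E)%E = (nnsum c)%:E.
Proof.
move=> c0 cf; rewrite /nnsum fineK// ge0_fin_numE//.
by apply: nneseries_ge0 => j _ _; rewrite lee_fin.
Qed.

Lemma nnsum_ge c n : (forall j, 0 <= c j) -> (\sum_(0 <= j <oo) (c j)%:E < +oo)%E ->
  \sum_(j < n) c j <= nnsum c.
Proof.
move=> c0 cf; rewrite -lee_fin -(nnsumE c0 cf) -sumEFin.
rewrite -(big_mkord xpredT (fun j => (c j)%:E)).
by apply: nneseries_lim_ge => j _ _; rewrite lee_fin.
Qed.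

Lemma nnsum_le c (A : R) : (forall j, 0 <= c j) -> (forall n, \sum_(j < n) c j <= A) ->
  (\sum_(0 <= j <oo) (c j)%:E < +oo)%E /\ nnsum c <= A.
Proof.
move=> c0 cA.
have h : (\sum_(0 <= j <oo) (c j)%:E <= A%:E)%E.
  apply: lime_le; first by apply: is_cvg_nneseries => j _ _; rewrite lee_fin.
  by apply: nearW => n; rewrite big_mkord sumEFin lee_fin.
have hf := le_lt_trans h (ltry A); split => //.
by rewrite -lee_fin -(nnsumE c0 hf).
Qed.

Lemma nnsum_ge0 c : (forall j, 0 <= c j) -> 0 <= nnsum c.
Proof. by move=> c0; apply: fine_ge0; apply: nneseries_ge0 => j _ _; rewrite lee_fin. Qed.

Lemma nnsum_cvg c : (forall j, 0 <= c j) -> (\sum_(0 <= j <oo) (c j)%:E < +oo)%E ->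
  (fun n => \sum_(j < n) c j) @ \oo --> nnsum c.
Proof.
move=> c0 cf.
have -> : (fun n => \sum_(j < n) c j) = fine \o (fun n => \sum_(0 <= j < n) (c j)%:E)%E.
  by apply/funext => n /=; rewrite big_mkord sumEFin.
apply: fine_cvg; rewrite -(nnsumE c0 cf).
by apply: is_cvg_nneseries => j _ _; rewrite lee_fin.
Qed.

Lemma nnsum_mono c c' : (forall j, 0 <= c j <= c' j) ->
  (\sum_(0 <= j <oo) (c' j)%:E < +oo)%E ->
  (\sum_(0 <= j <oo) (c j)%:E < +oo)%E /\ nnsum c <= nnsum c'.
Proof.
move=> cc cf; apply: nnsum_le => [j|n]; first by case/andP: (cc j).
apply: (@le_trans _ _ (\sum_(j < n) c' j)); first by apply: ler_sum => j _; case/andP: (cc j).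
by apply: nnsum_ge => // j; case/andP: (cc j) => /le_trans h /h.
Qed.

Lemma nnsum_finite c n : (forall j, 0 <= c j) -> (forall j, (n <= j)%N -> c j = 0) ->
  (\sum_(0 <= j <oo) (c j)%:E < +oo)%E /\ nnsum c <= \sum_(j < n) c j.
Proof.
move=> c0 cn; apply: nnsum_le => // m.
have [mn|/ltnW nm] := leqP m n.
  rewrite -!(big_mkord xpredT c) (big_cat_nat (leq0n m) mn)//= lerDl.
  by rewrite big_nat; apply: sumr_ge0.
rewrite -!(big_mkord xpredT c) (big_cat_nat (leq0n n) nm)//=.
have -> : \sum_(n <= j < m) c j = 0.
  by rewrite big_nat big1// => j /andP[nj _]; exact: cn.
by rewrite addr0.
Qed.

(** Splitting off a finite part reduces termwise convergence to convergence of
    the sums (Tannery). *)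
Lemma nnsum_tannery (c : nat -> R) (e : nat -> nat -> R) :
  (forall j, 0 <= c j) -> (\sum_(0 <= j <oo) (c j)%:E < +oo)%E ->
  (forall n j, 0 <= e n j <= c j) -> (forall j, (fun n => e n j) @ \oo --> (0 : R)) ->
  (fun n => nnsum (e n)) @ \oo --> (0 : R).
Proof.
move=> c0 cf ec e0; apply/cvgrPdist_le => eps eps0.
have e20 : 0 < eps / 2 by rewrite divr_gt0.
have [m _ /(_ m (leqnn m)) hm] := (cvgrPdist_le _ _).1 (nnsum_cvg c0 cf) _ e20.
have hs : (fun n => \sum_(j < m) e n j) @ \oo --> (0 : R).
  rewrite [X in _ --> X](_ : 0 = \sum_(j < m) (0 : R)); last by rewrite big1.
  by apply: cvg_big => [|j _]; [exact: add_continuous|exact: e0].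
have hs2 : \forall n \near \oo, `|0 - \sum_(j < m) e n j| <= eps / 2.
  exact: ((cvgrPdist_le _ _).1 hs _ e20).
move: hs2; apply: filterS => n; rewrite !sub0r !normrN => hn.
have en0 j : 0 <= e n j by case/andP: (ec n j).
have [ef _] := nnsum_mono (ec n) cf.
rewrite ger0_norm ?nnsum_ge0//.
suff hk k : \sum_(j < k) e n j <= eps by have [] := nnsum_le en0 hk.
have h1 : \sum_(j < k) e n j <= \sum_(j < maxn k m) e n j.
  rewrite -!(big_mkord xpredT (e n)) (big_cat_nat (leq0n k) (leq_maxl k m))//= lerDl.
  by rewrite big_nat; apply: sumr_ge0.
apply: (le_trans h1); rewrite -(big_mkord xpredT (e n)) (big_cat_nat (leq0n m) (leq_maxr k m))//=.
rewrite [eps](splitr eps); apply: lerD.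
  by rewrite big_mkord; exact: le_trans (ler_norm _) hn.
apply: (@le_trans _ _ (\sum_(m <= j < maxn k m) c j)).
  by apply: ler_sum => j _; case/andP: (ec n j).
have := nnsum_ge (maxn k m) c0 cf.
rewrite -(big_mkord xpredT c) (big_cat_nat (leq0n m) (leq_maxr k m))//= big_mkord => h2.
move: hm; rewrite ler_norml => /andP[_ hm]; lra.
Qed.

End NonnegSeries.

Section SummableSequences.
Context {R : realType}.
Variables (b : nat -> R) (p : R).
Hypotheses (b0 : forall j, 0 <= b j) (bmono : forall j, b j.+1 <= b j)
  (hp : 0 < p < 1) (hbp : (\sum_(0 <= j <oo) (b j `^ p)%:E < +oo)%E).

Lemma antitone i j : (i <= j)%N -> b j <= b i.
Proof.
move=> /subnK <-; elim: (j - i)%N => // k IH.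
by rewrite addSn; exact: le_trans (bmono _) IH.
Qed.

Local Notation A := (nnsum (fun j => b j `^ p)).

Lemma lp_ge0 : 0 <= A.
Proof. by apply: nnsum_ge0 => j; exact: powR_ge0. Qed.

Lemma lp_sum n : \sum_(j < n) b j `^ p <= A.
Proof. by apply: nnsum_ge => // j; exact: powR_ge0. Qed.

Lemma powR_split (x q : R) : 0 <= x -> 0 < q -> p <= q -> x `^ q = x `^ p * x `^ (q - p).
Proof.
move=> x0 q0 pq; rewrite -powRD ?subrKC//.
by rewrite gt_eqF.
Qed.

Lemma lp_l1 : exists B, forall n, \sum_(j < n) b j <= B.
Proof.
have [p0 p1] := andP hp.
exists (b 0%N `^ (1 - p) * A) => n.
apply: (@le_trans _ _ (\sum_(j < n) b 0%N `^ (1 - p) * b j `^ p)).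
  apply: ler_sum => j _; rewrite -[leLHS]powRr1// (powR_split _ ltr01 (ltW p1))//.
  rewrite mulrC ler_wpM2r ?powR_ge0// ge0_ler_powR ?nnegrE ?subr_ge0 ?(ltW p1)//.
  exact: antitone.
by rewrite -mulr_sumr ler_wpM2l ?powR_ge0// lp_sum.
Qed.

(** As b is nonincreasing, the first s+1 terms of the sum of the b_j^p are at least
    b_s^p. *)
Lemma lp_decay s : b s <= (A / s.+1%:R) `^ p^-1.
Proof.
have [p0 p1] := andP hp.
rewrite -[leLHS]powRr1// -[X in b s `^ X](@mulfV _ p) ?gt_eqF// powRrM.
apply: ge0_ler_powR; rewrite ?nnegrE ?powR_ge0 ?divr_ge0 ?lp_ge0// ?invr_ge0 ?(ltW p0)//.
rewrite ler_pdivlMr// mulr_natr -[X in _ *+ X]card_ord -sumr_const.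
apply: le_trans (lp_sum s.+1); apply: ler_sum => j _.
rewrite ge0_ler_powR ?nnegrE ?(ltW p0)//; apply: antitone; exact: (ltn_ord j).
Qed.

Lemma lp_small (e : R) : 0 < e -> exists s, (0 < s)%N /\ forall j, (s <= j)%N -> b j <= e.
Proof.
have [p0 p1] := andP hp => e0.
have ep : 0 < e `^ p by exact: powR_gt0.
have := archi_boundP (divr_ge0 lp_ge0 (ltW ep)).
set s := Num.bound _ => hs.
exists s.+1; split => // j /ltnW sj; apply: (le_trans (antitone sj)).
apply: (le_trans (lp_decay s)).
rewrite -[leRHS]powRr1 ?(ltW e0)// -[X in e `^ X](@mulfV _ p) ?gt_eqF// powRrM.
apply: ge0_ler_powR; rewrite ?nnegrE ?powR_ge0 ?divr_ge0 ?lp_ge0// ?invr_ge0 ?(ltW p0)//.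
move: hs; rewrite ler_pdivrMr// ltr_pdivrMr// => /ltW hs; apply: (le_trans hs).
by rewrite mulrC ler_wpM2l ?powR_ge0// ler_nat.
Qed.

(** Each tail term is at most b_j^p b_s^(2-p), and b_s is at most of order s^(-1/p). *)
Lemma lp_tail : exists C, 0 <= C /\ forall s n, (0 < s)%N ->
  \sum_(s <= j < n) b j ^+ 2 <= C * s%:R `^ (- (2 / p) + 1).
Proof.
have [p0 p1] := andP hp.
have p2 : p <= 2 by lra.
have q0 : 0 <= 2 - p by lra.
exists (A * A `^ (2 / p - 1)); split; first by rewrite mulr_ge0 ?powR_ge0 ?lp_ge0.
move=> s n s0.
have s0R : (0 : R) < s%:R by rewrite ltr0n.
have hbs : b s <= (A / s%:R) `^ p^-1.
  apply: (le_trans (lp_decay s)); apply: ge0_ler_powR; rewrite ?nnegrE ?invr_ge0 ?(ltW p0)// ?divr_ge0 ?lp_ge0//.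
  by rewrite ler_wpM2l ?lp_ge0// lef_pV2 ?posrE ?ltr0n// ler_nat.
have hs : b s `^ (2 - p) <= A `^ (2 / p - 1) * s%:R `^ (- (2 / p) + 1).
  apply: (@le_trans _ _ (((A / s%:R) `^ p^-1) `^ (2 - p))).
    by apply: ge0_ler_powR; rewrite ?nnegrE ?powR_ge0.
  rewrite -powRrM powRM ?lp_ge0 ?invr_ge0 ?(ltW s0R)//.
  have -> : p^-1 * (2 - p) = 2 / p - 1 by rewrite mulrBr mulVf ?gt_eqF// mulrC.
  by rewrite -[s%:R^-1]powR_inv1 ?(ltW s0R)// -powRrM mulN1r opprB [- (2 / p) + 1]addrC.
apply: (@le_trans _ _ (\sum_(s <= j < n) b j `^ p * b s `^ (2 - p))).
  rewrite [leLHS]big_nat_cond [leRHS]big_nat_cond; apply: ler_sum => j /andP[/andP[sj _] _].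
  rewrite -powR_mulrn// (powR_split (b0 j) _ p2)// ler_wpM2l ?powR_ge0//.
  by apply: ge0_ler_powR; rewrite ?nnegrE//; exact: antitone.
rewrite -mulr_suml -mulrA; apply: ler_pM => //.
- by apply: sumr_ge0 => j _; exact: powR_ge0.
- exact: powR_ge0.
have [ns|/ltnW sn] := leqP n s; first by rewrite big_geq// lp_ge0.
apply: le_trans (lp_sum n); rewrite -(big_mkord xpredT (fun j => b j `^ p)).
rewrite (big_cat_nat (leq0n s) sn)//= lerDr big_nat; apply: sumr_ge0 => j _; exact: powR_ge0.
Qed.

End SummableSequences.

(** * The product measure on the parameter space *)

Lemma eseries_geometric {R : realType} (a z : R) : `|z| < 1 ->
  (\sum_(0 <= k <oo) (a * z ^+ k)%:E = (a / (1 - z))%:E)%E.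
Proof.
move=> z1; apply/cvg_lim => //.
rewrite (_ : (fun _ => _) = EFin \o (series (geometric a z))).
  by apply: cvg_EFin; [exact: nearW|exact: cvg_geometric_series].
by apply/funext => n; rewrite /= sumEFin.
Qed.

Section InfiniteProduct.
Context {R : realType}.
Local Notation RN := (@RN R).
Implicit Types (y z : RN) (A : nat -> set (measurableTypeR R)).

Lemma measurable_coord_RN j : measurable_fun [set: RN] (fun y => y j : measurableTypeR R).
Proof.
move=> _ B mB; rewrite setTI; apply: sub_sigma_algebra.
by exists j, B.
Qed.

Lemma measurable_fun_RN d (T : measurableType d) (f : T -> RN) :
  (forall j, measurable_fun [set: T] (fun t => f t j : measurableTypeR R)) ->
  measurable_fun [set: T] f.
Proof.
move=> mf _ A; rewrite setTI; move: A.
pose G : set (set RN) := fun B => measurable (f @^-1` B).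
suff : <<s (@coord_cylinders R) >> `<=` G by [].
apply: smallest_sub.
  split; rewrite /G /=.
  - by rewrite preimage_set0; exact: measurable0.
  - by move=> A mA; rewrite setTD preimage_setC; exact: measurableC.
  - by move=> F mF; rewrite preimage_bigcup; exact: bigcup_measurable.
move=> _ [j [B [mB ->]]]; rewrite /G -[X in measurable X]setTI.
exact: mf.
Qed.

Definition rectangle (n : nat) A : set RN := [set y | forall j, (j < n)%N -> A j (y j)].

Lemma measurable_rectangle n A : (forall j, measurable (A j)) -> measurable (rectangle n A).
Proof.
move=> mA; rewrite (_ : rectangle n A = \bigcap_(j in `I_n) ((fun y : RN => y j) @^-1` A j)).
  apply: fin_bigcap_measurable => [|j _]; first exact: finite_II.
  by rewrite -[X in measurable X]setTI; exact: measurable_coord_RN.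
by apply/seteqP; split => y h j; exact: h.
Qed.

(** Rectangles are stable under intersection and generate the product
    sigma-algebra. *)
Lemma rectangle_measure_unique (m1 m2 : {measure set RN -> \bar R}) :
  (m1 setT < +oo)%E ->
  (forall n A, (forall j, measurable (A j)) -> m1 (rectangle n A) = m2 (rectangle n A)) ->
  forall E, measurable E -> m1 E = m2 E.
Proof.
move=> m1fin m12 E mE.
pose G : set (set RN) := [set X | exists n A, (forall j, measurable (A j)) /\ X = rectangle n A].
have GT : G setT.
  exists 0%N, (fun=> setT); split; first by move=> j; exact: measurableT.
  by apply/seteqP; split.
apply: (@g_sigma_algebra_measure_unique _ _ _ G _ (fun=> setT)) => //.
- by move=> _ [n [A [mA ->]]]; exact: measurable_rectangle.
- by apply/seteqP; split => // y _; exists 0%N.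
- move=> _ _ [n [A [mA ->]]] [m [B [mB ->]]].
  exists (maxn n m), (fun j => (if (j < n)%N then A j else setT) `&` (if (j < m)%N then B j else setT)).
  split.
    by move=> j; apply: measurableI; case: ifP => // _; exact: measurableT.
  apply/seteqP; split => y.
    by move=> [h1 h2] j _; split; case: ifP => // ?; [exact: h1|exact: h2].
  move=> h; split => j jn; have [] := h j _; rewrite ?leq_max ?jn ?orbT//.
- by move=> _ [n [A [mA ->]]]; exact: m12.
- have : measurable E by [].
  move: E {mE}; apply: smallest_sub; first exact: smallest_sigma_algebra.
  move=> _ [j [B [mB ->]]]; apply: sub_sigma_algebra.
  exists j.+1, (fun k => if k == j then B else setT); split.
    by move=> k; case: ifP => // _; exact: measurableT.
  apply/seteqP; split => y /=.
    by move=> By k _; case: eqP => // ->.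
  by move=> /(_ j (ltnSn _)); rewrite eqxx.
Qed.

Definition flip_coord (j : nat) (y : RN) : RN := fun k => if k == j then - y k else y k.

(** Replaces the coordinate j of the first point by that of the second; the law of
    an independent pair makes this an independent copy. *)
Definition resample (j : nat) (p : RN * RN) : RN := fun k => if k == j then p.2 k else p.1 k.

Lemma measurable_opp : measurable_fun setT (-%R : measurableTypeR R -> measurableTypeR R).
Proof. by apply: continuous_measurable_fun => x; exact: opp_continuous. Qed.

Lemma measurable_flip j : measurable_fun setT (flip_coord j).
Proof.
apply: measurable_fun_RN => k; rewrite /flip_coord; case: (k == j); last exact: measurable_coord_RN.
by apply: measurableT_comp; [exact: measurable_opp|exact: measurable_coord_RN].
Qed.

Lemma measurable_resample j : measurable_fun setT (resample j).
Proof.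
apply: measurable_fun_RN => k; rewrite /resample; case: (k == j).
  apply: (measurableT_comp (measurable_coord_RN k)); exact: measurable_snd.
apply: (measurableT_comp (measurable_coord_RN k)); exact: measurable_fst.
Qed.

Variables (beta : R) (P : probability RN R).
Hypothesis hP : is_product_gen_gaussian beta P.
Local Notation gg := (gen_gaussian beta).

Lemma rectangle_law n A : (forall j, measurable (A j)) ->
  P (rectangle n A) = (\prod_(j < n) gg (A j))%E.
Proof. exact: hP. Qed.

Lemma gen_gaussianT : gg setT = 1%E.
Proof.
have := hP 1%N (fun=> @measurableT _ (measurableTypeR R)).
rewrite big_ord1 => <-; rewrite -(@probability_setT _ _ _ P); congr (P _).
by apply/seteqP; split.
Qed.

Lemma gen_gaussian_pdf_ge0 (t : R) : 0 <= gen_gaussian_pdf beta t.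
Proof.
rewrite /gen_gaussian_pdf mulr_ge0 ?expR_ge0// invr_ge0 !mulr_ge0 ?powR_ge0//.
by apply: Rintegral_ge0 => x _; rewrite mulr_ge0 ?powR_ge0 ?expR_ge0.
Qed.

Lemma measurable_gen_gaussian_pdf :
  measurable_fun setT (fun t : measurableTypeR R => (gen_gaussian_pdf beta t)%:E).
Proof.
apply/measurable_EFinP; rewrite /gen_gaussian_pdf.
apply: measurable_funM => //; apply: measurableT_comp => //.
apply: measurableT_comp => //; apply: measurable_funM => //.
apply: (@measurableT_comp _ _ _ _ _ _ (fun x : R => x `^ beta)) => //.
Qed.

Lemma gen_gaussianN (B : set (measurableTypeR R)) : measurable B -> gg (-%R @^-1` B) = gg B.
Proof.
move=> mB; rewrite /gen_gaussian.
have mpdf := measurable_gen_gaussian_pdf.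
have e : (fun y : measurableTypeR R => (gen_gaussian_pdf beta y)%:E) =
    (fun y : measurableTypeR R => (gen_gaussian_pdf beta y)%:E) \o (-%R : measurableTypeR R -> measurableTypeR R).
  by apply/funext => y; rewrite /= /gen_gaussian_pdf normrN.
have := @ge0_integral_pushforward _ _ (measurableTypeR R) (measurableTypeR R) R -%R
  measurable_opp lebesgue_measure B (fun t => (gen_gaussian_pdf beta t)%:E) mB
  (measurable_funTS mpdf) (fun t _ => gen_gaussian_pdf_ge0 t).
rewrite -e => <-.
by apply: eq_measure_integral => A mA _; exact: lebesgue_measureN.
Qed.

Lemma coord_law j (B : set (measurableTypeR R)) : measurable B ->
  P [set y | B (y j)] = gg B.
Proof.
move=> mB.
have := hP j.+1 (A := fun k => if k == j then B else setT).
rewrite (_ : [set y | _] = [set y | B (y j)]); last first.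
  apply/seteqP; split => y /=.
    by move=> /(_ j (ltnSn _)); rewrite eqxx.
  by move=> By k _; case: eqP => // ->.
move=> ->; last by move=> k; case: ifP => // _; exact: measurableT.
rewrite big_ord_recr/= eqxx big1 ?mul1e// => k _.
by rewrite ltn_eqF// gen_gaussianT.
Qed.

(** The density of each coordinate is even. *)
Lemma flip_invariant j (E : set RN) : measurable E -> P (flip_coord j @^-1` E) = P E.
Proof.
move=> mE.
have := @rectangle_measure_unique (pushforward P (flip_coord j)) P.
move=> /(_ (measurable_flip j)); apply => //.
  apply: (@le_lt_trans _ _ 1%E); last exact: ltry.
  apply: probability_le1; rewrite -[X in measurable X]setTI.
  exact: measurable_flip.
move=> n A mA; rewrite -[LHS]/(P (flip_coord j @^-1` rectangle n A)).
rewrite (_ : _ @^-1` _ = rectangle n (fun k => if k == j then -%R @^-1` A k else A k)).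
  rewrite [RHS]rectangle_law// rectangle_law; last first.
    move=> k; case: ifP => // _; rewrite -[X in measurable X]setTI; exact: measurable_opp.
  by apply: eq_bigr => k _; case: ifP => // _; rewrite gen_gaussianN.
by apply/seteqP; split => y h k /h; rewrite /flip_coord; case: ifP.
Qed.

Lemma resample_invariant j (E : set RN) : measurable E ->
  (P \x P)%E (resample j @^-1` E) = P E.
Proof.
move=> mE.
have := @rectangle_measure_unique (pushforward (P \x P)%E (resample j)) P.
move=> /(_ (measurable_resample j)); apply => //.
  rewrite -[X in (X < _)%E]/((P \x P)%E (resample j @^-1` setT)).
  rewrite (_ : _ @^-1` _ = setT `*` setT); last by apply/seteqP; split.
  rewrite product_measure1E//=.
  by rewrite !probability_setT mule1 ltry.
move=> n A mA; rewrite -[LHS]/((P \x P)%E (resample j @^-1` rectangle n A)).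
rewrite (_ : _ @^-1` _ = rectangle n (fun k => if k == j then setT else A k) `*`
   rectangle n (fun k => if k == j then A k else setT)); last first.
  apply/seteqP; split => -[y z] /=.
    move=> h; split => k kn; have := h k kn; rewrite /resample/=; case: ifP => //.
  by move=> [h1 h2] k kn; have := h1 k kn; have := h2 k kn; rewrite /resample/=; case: ifP.
have mm1 k : measurable (if k == j then setT else A k) by case: ifP => // _; exact: measurableT.
have mm2 k : measurable (if k == j then A k else setT) by case: ifP => // _; exact: measurableT.
rewrite product_measure1E//; [|exact: measurable_rectangle|exact: measurable_rectangle].
rewrite /= !rectangle_law// -big_split/=; apply: eq_bigr => k _.
by case: ifP => _; rewrite gen_gaussianT ?mul1e ?mule1.
Qed.

(** Resampling the coordinate j leaves F alone and makes it independent of y_j. *)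
Lemma expectation_mul j (F : RN -> \bar R) (g : R -> \bar R) :
  measurable_fun setT F -> (forall y, 0 <= F y)%E ->
  (forall y z, F (resample j (y, z)) = F y) ->
  measurable_fun setT (g : measurableTypeR R -> \bar R) -> (forall t, 0 <= g t)%E ->
  (\int[P]_y (F y * g (y j)) = \int[P]_y F y * \int[P]_y g (y j))%E.
Proof.
move=> mF F0 Fj mg g0.
have mgj : measurable_fun [set: RN] (fun y => g (y j)).
  by apply: (measurableT_comp mg); exact: measurable_coord_RN.
have mFg : measurable_fun [set: RN] (fun y => F y * g (y j))%E by exact: emeasurable_funM.
have Fg0 y : (0 <= F y * g (y j))%E by exact: mule_ge0.
have -> : (\int[P]_y (F y * g (y j)) =
    \int[P \x P]_p (F (resample j p) * g (resample j p j)))%E.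
  have := @ge0_integral_pushforward _ _ _ _ R _ (measurable_resample j) (P \x P)%E setT
    (fun y => F y * g (y j))%E measurableT mFg (fun y _ => Fg0 y).
  rewrite preimage_setT => <-.
  apply: eq_measure_integral; first exact: measurable_resample.
  by move=> mr E mE _; exact/esym/resample_invariant.
have -> : (fun p : RN * RN => F (resample j p) * g (resample j p j))%E =
    (fun p : RN * RN => F p.1 * g (p.2 j))%E.
  by apply/funext => -[y z]; rewrite Fj /resample eqxx.
rewrite fubini_tonelli1//=; last 2 first.
- apply: emeasurable_funM; first exact: (measurableT_comp mF measurable_fst).
  exact: (measurableT_comp mgj measurable_snd).
- by move=> p; exact: mule_ge0.
transitivity (\int[P]_y (F y * \int[P]_z g (z j)))%E.
  by apply: eq_integral => y _; rewrite /fubini_F/= ge0_integralZl.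
by rewrite ge0_integralZr//; exact: integral_ge0.
Qed.

Lemma emeasurable_prod_coord n (g : nat -> R -> \bar R) :
  (forall j, measurable_fun setT (g j : measurableTypeR R -> \bar R)) ->
  measurable_fun [set: RN] (fun y => \prod_(j < n) g j (y j))%E.
Proof.
move=> mg; elim: n => [|n IH].
  rewrite (_ : (fun y => _) = cst 1%E); first exact: measurable_cst.
  by apply/funext => y; rewrite big_ord0.
rewrite (_ : (fun y => _) = (fun y => \prod_(j < n) g j (y j) * g n (y n))%E); last first.
  by apply/funext => y; rewrite big_ord_recr.
apply: emeasurable_funM => //; apply: (measurableT_comp (mg n)).
exact: measurable_coord_RN.
Qed.

Lemma expectation_prod n (g : nat -> R -> \bar R) :
  (forall j, measurable_fun setT (g j : measurableTypeR R -> \bar R)) ->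
  (forall j t, 0 <= g j t)%E ->
  (\int[P]_y (\prod_(j < n) g j (y j)) = \prod_(j < n) \int[P]_y g j (y j))%E.
Proof.
move=> mg g0; elim: n => [|n IH].
  rewrite big_ord0 -[RHS](@probability_setT _ _ _ P) -[RHS]mul1e -integral_cst//.
  by apply: eq_integral => y _; rewrite big_ord0.
rewrite big_ord_recr/= -IH -expectation_mul//.
- by apply: eq_integral => y _; rewrite big_ord_recr.
- exact: emeasurable_prod_coord.
- by move=> y; apply: prode_ge0.
- move=> y z; apply: eq_bigr => k _; congr (g _ _).
  by rewrite /resample/= ltn_eqF.
Qed.

(** Slicing the line at the integers reduces exponential moments to measures of
    slices. *)
Lemma coord_exp_moment (B : R) : 0 < B ->
  (exists K e : R, 0 < e /\ forall t, gen_gaussian_pdf beta t <= K * expR (- (B + e) * `|t|)) ->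
  exists M : R, forall j, (\int[P]_y (expR (B * `|y j|))%:E <= M%:E)%E.
Proof.
move=> B0 [K0 [e [e0 hK0]]].
pose K := `|K0|.
have hK t : gen_gaussian_pdf beta t <= K * expR (- (B + e) * `|t|).
  by apply: (le_trans (hK0 t)); rewrite ler_wpM2r ?expR_ge0// ler_norm.
have K_ge0 : 0 <= K by exact: normr_ge0.
pose S (k : nat) : set (measurableTypeR R) := [set t | k%:R <= `|t| < k.+1%:R].
have mS k : measurable (S k).
  rewrite (_ : S k = (Num.norm : measurableTypeR R -> measurableTypeR R) @^-1` `[k%:R, k.+1%:R[%classic).
    by rewrite -[X in measurable X]setTI; exact: normr_measurable.
  by apply/seteqP; split => t; rewrite /S/= in_itv.
have gS k : (gg (S k) <= (2 * K * expR (- (B + e) * k%:R))%:E)%E.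
  rewrite /gen_gaussian.
  apply: (@le_trans _ _ (\int[lebesgue_measure]_(y in S k) (cst (K * expR (- (B + e) * k%:R))%:E) y)%E).
    apply: ge0_le_integral => //.
    - by move=> t _; rewrite lee_fin gen_gaussian_pdf_ge0.
    - exact: measurable_funTS measurable_gen_gaussian_pdf.
    - move=> t /andP[h _]; rewrite lee_fin (le_trans (hK t))// ler_wpM2l// ler_expR.
      by rewrite !mulNr lerN2 ler_wpM2l// addr_ge0// ltW.
  rewrite integral_cst// (_ : (2 * K * expR (- (B + e) * k%:R))%:E =
      ((K * expR (- (B + e) * k%:R))%:E * 2%:E)%E); last first.
    by rewrite -EFinM; congr EFin; ring.
  apply: lee_wpmul2l.
    by rewrite lee_fin mulr_ge0// expR_ge0.
  apply: (@le_trans _ _ (lebesgue_measure (`](- k.+1%:R), (- k%:R)]%classic `|` `[k%:R, k.+1%:R[%classic : set R))).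
    apply: le_measure; rewrite ?inE//; first by apply: measurableU; exact: measurable_itv.
    move=> t /andP[h1 h2]; have [t0|t0] := leP 0 t.
      by right; rewrite /= in_itv/=; move: h1 h2; rewrite ger0_norm// => -> ->.
    by left; rewrite /= in_itv/=; move: h1 h2; rewrite ltr0_norm// lerNr ltrNl => -> ->.
  have eq_le (x t : \bar R) : x = t -> (x <= t)%E by move=> ->.
  have len (x t : R) : x < t -> lebesgue_measure (`]x, t]%classic : set R) = (t - x)%:E /\
      lebesgue_measure (`[x, t[%classic : set R) = (t - x)%:E.
    by move=> xt; rewrite !lebesgue_measure_itv/= !lte_fin xt -!EFinB.
  have [l1 _] := len (- k.+1%:R) (- k%:R) ltac:(by rewrite ltrN2 ltr_nat).
  have [_ l2] := len k%:R k.+1%:R ltac:(by rewrite ltr_nat).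
  apply: (le_trans (measureU2 _ _ _)); [exact: measurable_itv|exact: measurable_itv|].
  refine (le_trans (leeD (eq_le _ _ l1) (eq_le _ _ l2)) _); rewrite -EFinD lee_fin.
  by rewrite -addn1 natrD; lra.
exists (2 * K * expR B * (1 - expR (- e))^-1) => j.
have mj : measurable_fun [set: RN] (fun y => (expR (B * `|y j|))%:E).
  apply/measurable_EFinP; apply: measurableT_comp; first exact: measurable_expR.
  apply: measurable_funM => //; apply: measurableT_comp; first exact: normr_measurable.
  exact: measurable_coord_RN.
have Sj k : measurable [set y : RN | S k (y j)].
  by rewrite -[X in measurable X]setTI; exact: measurable_coord_RN.
rewrite (_ : [set: RN] = \bigcup_k [set y : RN | S k (y j)]); last first.
  apply/seteqP; split => // y _; exists (Num.trunc `|y j|) => //=.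
  exact: (truncn_itv (normr_ge0 (y j : R))).
rewrite ge0_integral_bigcup//; last 2 first.
- exact: measurable_funTS.
- apply/trivIsetP => k l _ _ kl; apply/seteqP; split => // y [/= /andP[h1 h2] /andP[h3 h4]].
  move: kl; have := le_lt_trans h1 h4; have := le_lt_trans h3 h2.
  by rewrite !ltr_nat !ltnS => ? ?; rewrite eqn_leq; apply/negP; rewrite negbK; apply/andP.
apply: (@le_trans _ _ (\sum_(0 <= k <oo) (2 * K * expR B * expR (- e) ^+ k)%:E)%E).
  apply: lee_nneseries => [k _ _|k _]; first by apply: integral_ge0 => y _; rewrite lee_fin expR_ge0.
  apply: (@le_trans _ _ (\int[P]_(y in [set y : RN | S k (y j)]) (cst (expR (B * k.+1%:R))%:E) y)%E).
    apply: ge0_le_integral => //.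
    - exact: measurable_funTS.
    - by move=> y /andP[_ h]; rewrite lee_fin ler_expR ler_wpM2l ?ltW.
  rewrite integral_cst//.
  have hS : (P [set y : RN | S k (y j)] <= (2 * K * expR (- (B + e) * k%:R))%:E)%E.
    by rewrite (coord_law j (mS k)).
  refine (le_trans (lee_wpmul2l _ hS) _); first by rewrite lee_fin expR_ge0.
  rewrite -EFinM lee_fin -expRM_natl -addn1 natrD le_eqVlt; apply/orP; left; apply/eqP.
  have h : expR (B * (k%:R + 1)) * expR (- (B + e) * k%:R) = expR B * expR (k%:R * - e).
    by rewrite -!expRD; congr expR; ring.
  by rewrite mulrCA h mulrA.
rewrite eseries_geometric// ger0_norm ?expR_ge0//.
by rewrite -expR0 ltr_expR oppr_lt0.
Qed.

End InfiniteProduct.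

(** * Exponential moments *)

Section Moments.
Context {R : realType}.
Local Notation RN := (@RN R).
Variables (b : nat -> R).
Hypotheses (b0 : forall j, 0 <= b j).

Definition wsum (y : RN) : R := nnsum (fun j => b j * `|y j|).

Lemma weight_ge0 (y : RN) j : 0 <= b j * `|y j|.
Proof. by rewrite mulr_ge0. Qed.

Lemma measurable_weight j (c : R) :
  measurable_fun setT (fun y : RN => c * `|y j| : measurableTypeR R).
Proof.
apply: measurable_funM => //; apply: measurableT_comp; first exact: normr_measurable.
exact: measurable_coord_RN.
Qed.

Lemma measurable_weight_series :
  measurable_fun setT (fun y : RN => (\sum_(0 <= j <oo) (b j * `|y j|)%:E)%E).
Proof.
apply: ge0_emeasurable_sum => [k y _ _|k _]; first by rewrite lee_fin weight_ge0.
by apply/measurable_EFinP; exact: measurable_weight.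
Qed.

Lemma measurable_Uset : measurable (Uset b).
Proof.
rewrite -[X in measurable X]setTI.
exact: emeasurable_fun_infty_o measurableT measurable_weight_series _.
Qed.

Lemma measurable_wsum : measurable_fun setT (wsum : RN -> measurableTypeR R).
Proof.
apply: (measurableT_comp (fine_measurable measurableT)).
exact: measurable_weight_series.
Qed.

Lemma convex_exp_le (x t : R) : 0 <= x <= 1 -> expR (x * t) <= 1 + x * expR t.
Proof.
move=> /andP[x0 x1]; have e0 := expR_ge0 (x * t).
have h1 : expR t >= expR (x * t) * (1 + (1 - x) * t).
  rewrite [X in X <= _]mulrC (_ : expR t = expR ((1 - x) * t) * expR (x * t)); last first.
    by rewrite -expRD; congr expR; ring.
  by rewrite ler_wpM2r// expR_ge1Dx.
have h2 : 1 >= expR (x * t) * (1 - x * t).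
  rewrite -[leRHS](expRxMexpNx_1 (x * t)) ler_wpM2l//.
  by have := expR_ge1Dx (- (x * t)).
have h3 : (1 - x) * (expR (x * t) * (1 - x * t)) <= 1 - x.
  by rewrite -[leRHS]mulr1 ler_wpM2l// subr_ge0.
have h4 : x * (expR (x * t) * (1 + (1 - x) * t)) <= x * expR t by rewrite ler_wpM2l.
have -> : expR (x * t) = (1 - x) * (expR (x * t) * (1 - x * t)) +
   x * (expR (x * t) * (1 + (1 - x) * t)) by ring.
apply: lerD => //; apply: le_trans h3 _; lra.
Qed.

Variables (beta : R) (P : probability RN R).
Hypothesis hP : is_product_gen_gaussian beta P.
Hypotheses (bmono : forall j, b j.+1 <= b j) (bsum : exists A, forall n, \sum_(j < n) b j <= A).
Hypothesis hbeta : 1 < beta \/ (beta = 1 /\ forall j, b j < 1).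

(** For beta > 1 the density decays faster than every exponential, by the inequality
    of Young; for beta = 1 it decays like exp(-|t|), and b_j <= b_0 < 1 leaves room
    for an exponent between b_0 and 1. *)
Lemma pdf_decay : exists B : R, [/\ 0 < B, forall j, b j <= B &
  exists K e : R, 0 < e /\ forall t, gen_gaussian_pdf beta t <= K * expR (- (B + e) * `|t|)].
Proof.
set c := (2 * beta `^ (beta^-1) * Gamma (1 + beta^-1))^-1.
have c0 : 0 <= c.
  rewrite invr_ge0 !mulr_ge0 ?powR_ge0//.
  by apply: Rintegral_ge0 => x _; rewrite mulr_ge0 ?powR_ge0 ?expR_ge0.
have [b1|[be b1]] := hbeta; last first.
  exists ((1 + b 0%N) / 2); have := b1 0%N; have := b0 0%N => b00 b01; split.
  - lra.
  - move=> j; have := antitone bmono (leq0n j); lra.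
  exists c, (1 - (1 + b 0%N) / 2); split; first lra.
  move=> t; rewrite /gen_gaussian_pdf -/c be invr1 powRr1// mulr1.
  by rewrite (_ : (1 + b 0%N) / 2 + _ = 1) ?mulN1r//; ring.
exists (b 0%N + 1); have b00 := b0 0%N; split.
- lra.
- move=> j; have := antitone bmono (leq0n j); lra.
have be0 : 0 < beta by apply: lt_trans b1.
have q0 : 0 < (1 - beta^-1)^-1 by rewrite invr_gt0 subr_gt0 invf_lt1.
set L := b 0%N + 1 + 1.
have L0 : 0 <= L by rewrite /L; lra.
exists (c * expR (L `^ ((1 - beta^-1)^-1) / (1 - beta^-1)^-1)), 1; split => // t.
rewrite /gen_gaussian_pdf -/c -mulrA ler_wpM2l// -expRD ler_expR -/L.
have := conjugate_powR (normr_ge0 t) L0 be0 q0.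
rewrite invrK subrKC => /(_ erefl).
rewrite mulNr [`|t| * L]mulrC; lra.
Qed.

(** By convexity the mean of exp(b_j |y_j|) is at most 1 + C b_j, and the product of
    these bounds converges because the b_j are summable. *)
Lemma exp_moments : exists B K M : R, [/\ 0 < B, 0 <= K, 0 <= M,
  (forall n, \int[P]_y (\prod_(i < n) (expR (b i * `|y i|))%:E) <= K%:E)%E &
  (forall j, \int[P]_y (expR (B * `|y j|))%:E <= M%:E)%E ].
Proof.
have [B [B0 bB dB]] := pdf_decay.
have [M hM] := coord_exp_moment hP B0 dB.
have [A hA] := bsum.
have mexp j (c : R) : measurable_fun setT (fun y : RN => (expR (c * `|y j|))%:E).
  apply/measurable_EFinP; apply: measurableT_comp; first exact: measurable_expR.
  exact: measurable_weight.
have M0 : 0 <= M.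
  rewrite -lee_fin; apply: le_trans (hM 0%N).
  by apply: integral_ge0 => y _; rewrite lee_fin expR_ge0.
have one j : (\int[P]_y (expR (b j * `|y j|))%:E <= (expR ((M / B) * b j))%:E)%E.
  have bj : 0 <= b j / B <= 1.
    by rewrite divr_ge0 ?(ltW B0)//= ler_pdivrMr// mul1r.
  apply: (@le_trans _ _ (\int[P]_y (1%:E + (b j / B)%:E * (expR (B * `|y j|))%:E))%E).
    apply: ge0_le_integral => //.
    - by apply: emeasurable_funD => //; apply: emeasurable_funM => //; exact: measurable_cst.
    - move=> y _; rewrite -EFinM -EFinD lee_fin.
      have := convex_exp_le (B * `|y j|) bj.
      by rewrite (_ : b j / B * (B * `|y j|) = b j * `|y j|)// mulrA divfK// gt_eqF.
  rewrite ge0_integralD//; last 2 first.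
  - by move=> y _; rewrite -EFinM lee_fin mulr_ge0 ?expR_ge0//; case/andP: bj.
  - by apply: emeasurable_funM => //; exact: measurable_cst.
  rewrite integral_cst// mul1e ge0_integralZl//; last by rewrite lee_fin; case/andP: bj.
  apply: (@le_trans _ _ (1%:E + (b j / B)%:E * M%:E)%E).
    apply: leeD; first exact: probability_le1.
    by apply: lee_wpmul2l => //; rewrite lee_fin; case/andP: bj.
  rewrite -EFinM -EFinD lee_fin (_ : b j / B * M = M / B * b j); last by ring.
  exact: expR_ge1Dx.
exists B, (expR (M / B * A)), M; split => //.
move=> n; rewrite (@expectation_prod _ _ _ hP n (fun j t => (expR (b j * `|t|))%:E)).
- apply: (@le_trans _ _ (expR (M / B * \sum_(j < n) b j))%:E).
    elim: n => [|n IH]; first by rewrite !big_ord0 mulr0 expR0.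
    rewrite !big_ord_recr/= mulrDr expRD EFinM; apply: lee_pmul => //.
      apply: prode_ge0 => j _; apply: integral_ge0 => y _; by rewrite lee_fin expR_ge0.
    by apply: integral_ge0 => y _; rewrite lee_fin expR_ge0.
  by rewrite lee_fin ler_expR ler_wpM2l// divr_ge0// ltW.
- move=> j; apply/measurable_EFinP; apply: measurableT_comp; first exact: measurable_expR.
  by apply: measurable_funM => //; exact: normr_measurable.
- by move=> j t; rewrite lee_fin expR_ge0.
Qed.

(** One half of the exponent B t absorbs t^2; the other half absorbs 5 c t, which is
    where c <= B/10 comes from. *)
Lemma sqr_exp_le (B c t : R) : 0 < B -> 0 <= t -> c <= B / 10 ->
  t ^+ 2 * expR (5 * (c * t)) <= 8 / B ^+ 2 * expR (B * t).
Proof.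
move=> B0 t0 cB.
have x0 : 0 <= B * t / 2 by rewrite divr_ge0// mulr_ge0// ltW.
have h1 := expR_ge1Dxn 1%N x0.
have h2 : t ^+ 2 <= 8 / B ^+ 2 * expR (B * t / 2).
  rewrite mulrAC ler_pdivlMr ?exprn_gt0//.
  have : 2`!%:R = 2 :> R by [].
  move: h1 => /[swap] ->.
  rewrite (_ : (B * t / 2) ^+ 2 / 2 = t ^+ 2 * B ^+ 2 / 8); last by field.
  lra.
have h3 : expR (5 * (c * t)) <= expR (B * t / 2).
  rewrite ler_expR mulrA (_ : B * t / 2 = (B / 2) * t); last by field.
  by rewrite ler_wpM2r//; lra.
apply: (le_trans (ler_pM (sqr_ge0 t) (expR_ge0 _) h2 h3)).
rewrite -[leLHS]mulrA -expRD ler_wpM2l//; first by rewrite divr_ge0 ?exprn_ge0// ltW.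
by rewrite ler_expR le_eqVlt; apply/orP; left; apply/eqP; field.
Qed.

(** The first bound serves as an integrable majorant of the norms of solutions, the
    second one controls the second differences in the coordinate j. *)
Lemma wsum_moments : exists B K : R, [/\ 0 < B, 0 <= K,
  (\int[P]_(y in Uset b) (expR (wsum y))%:E <= K%:E)%E &
  forall j, b j <= B / 10 ->
  (\int[P]_y (expR (\sum_(i < j) b i * `|y i|) *
      (`|y j| ^+ 2 * expR (5 * (b j * `|y j|))))%:E <= K%:E)%E ].
Proof.
have [B [K [M [B0 K0 M0 hK hM]]]] := exp_moments.
have mexp j (c : R) : measurable_fun setT (fun y : RN => (expR (c * `|y j|))%:E).
  apply/measurable_EFinP; apply: measurableT_comp; first exact: measurable_expR.
  exact: measurable_weight.
have c0 : 0 <= K * (8 / B ^+ 2 * M) by rewrite !mulr_ge0// invr_ge0 exprn_ge0// ltW.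
have mprod n : measurable_fun setT (fun y : RN => \prod_(i < n) (expR (b i * `|y i|))%:E)%E.
  apply: (@emeasurable_prod_coord _ n (fun i t => (expR (b i * `|t|))%:E)) => j.
  apply/measurable_EFinP; apply: measurableT_comp; first exact: measurable_expR.
  by apply: measurable_funM => //; exact: normr_measurable.
have prodE n (y : RN) : (\prod_(i < n) (expR (b i * `|y i|))%:E)%E =
    (expR (\sum_(i < n) b i * `|y i|))%:E.
  elim: n => [|n IH]; first by rewrite !big_ord0 expR0.
  by rewrite !big_ord_recr/= IH expRD.
exists B, (K + K * (8 / B ^+ 2 * M)); split => //; first by rewrite addr_ge0.
  apply: (@le_trans _ _ K%:E); last by rewrite lee_fin lerDl.
  pose g n (y : RN) : \bar R := (\prod_(i < n) (expR (b i * `|y i|))%:E)%E.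
  have g0 n y : (0 <= g n y)%E by rewrite /g prodE lee_fin expR_ge0.
  have gle n : (\int[P]_(y in Uset b) g n y <= K%:E)%E.
    apply: le_trans (hK n); apply: ge0_subset_integral => //; [exact: measurable_Uset|exact: mprod].
  have gcv y : Uset b y -> g ^~ y @ \oo --> (expR (wsum y))%:E.
    move=> Uy; rewrite (_ : g ^~ y = EFin \o (fun n => expR (\sum_(i < n) b i * `|y i|))); last first.
      by apply/funext => n; exact: prodE.
    apply: cvg_EFin; first exact: nearW.
    apply: (cvg_comp _ _ (nnsum_cvg (weight_ge0 y) Uy)); exact: continuous_expR.
  have nd y : {homo g^~ y : n m / (n <= m)%N >-> (n <= m)%E}.
    move=> n m nm; rewrite /g !prodE lee_fin ler_expR.
    rewrite -!(big_mkord xpredT (fun i => b i * `|y i|)) (big_cat_nat (leq0n n) nm)//= lerDl.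
    by rewrite big_nat; apply: sumr_ge0 => i _; exact: weight_ge0.
  rewrite (eq_integral (fun y => limn (g ^~ y))); last first.
    by move=> y /set_mem Uy; apply/esym/cvg_lim => //; exact: gcv.
  rewrite (monotone_convergence _ measurable_Uset)//; last by move=> n; exact: measurable_funTS (mprod n).
  apply: lime_le; last exact: nearW.
  apply: ereal_nondecreasing_is_cvgn => n m nm; apply: ge0_le_integral => //.
  - exact: measurable_Uset.
  - exact: measurable_funTS (mprod n).
  - exact: measurable_funTS (mprod m).
  - by move=> y _; exact: nd.
move=> j bj.
apply: (@le_trans _ _ (K * (8 / B ^+ 2 * M))%:E); last by rewrite lee_fin lerDr.
rewrite (eq_integral (fun y : RN => (\prod_(i < j) (expR (b i * `|y i|))%:E) *
    (`|y j| ^+ 2 * expR (5 * (b j * `|y j|)))%:E)%E); last by move=> y _; rewrite prodE.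
rewrite (@expectation_mul _ _ _ hP j (fun y : RN => \prod_(i < j) (expR (b i * `|y i|))%:E)%E
   (fun t => (`|t| ^+ 2 * expR (5 * (b j * `|t|)))%:E)).
- rewrite EFinM; apply: lee_pmul => //.
  + by apply: integral_ge0 => y _; rewrite prodE lee_fin expR_ge0.
  + by apply: integral_ge0 => y _; rewrite lee_fin mulr_ge0 ?expR_ge0.
  apply: (@le_trans _ _ (\int[P]_y ((8 / B ^+ 2)%:E * (expR (B * `|y j|))%:E))%E).
    apply: ge0_le_integral => //.
    - apply/measurable_EFinP; apply: measurable_funM.
        apply: measurable_funX; apply: measurableT_comp; first exact: normr_measurable.
        exact: measurable_coord_RN.
      apply: measurableT_comp; first exact: measurable_expR.
      by apply: measurable_funM => //; exact: measurable_weight.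
    - by apply: emeasurable_funM => //; exact: measurable_cst.
    - by move=> y _; rewrite -EFinM lee_fin; exact: sqr_exp_le.
  have B8 : 0 <= 8 / B ^+ 2 by rewrite divr_ge0// exprn_ge0// ltW.
  rewrite ge0_integralZl// [X in (_ <= X)%E]EFinM; apply: lee_wpmul2l; last exact: hM.
  by rewrite lee_fin.
- exact: mprod.
- by move=> y; rewrite prodE lee_fin expR_ge0.
- move=> y z; apply: eq_bigr => k _; congr ((expR (_ * `|_|))%:E).
  by rewrite /resample/= ltn_eqF.
- apply/measurable_EFinP; apply: measurable_funM.
    by apply: measurable_funX; exact: normr_measurable.
  apply: measurableT_comp; first exact: measurable_expR.
  by do 2 apply: measurable_funM => //; exact: normr_measurable.
- by move=> t; rewrite lee_fin mulr_ge0 ?expR_ge0.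
Qed.

End Moments.

(** * The lognormal coefficient *)

Section ExpArith.
Context {R : realType}.
Implicit Types s e t : R.

Lemma expR_dist s e : `|s| <= e -> `|expR s - 1| <= expR e - 1.
Proof.
move=> se; have [h1 h2] := (expR_ge1Dx s, expR_ge1Dx (- s)).
have e0 := expR_gt0 s.
have hs : expR s * expR (- s) = 1 by exact: expRxMexpNx_1.
move: se; rewrite ler_norml => /andP[s1 s2].
have le1 : expR s <= expR e by rewrite ler_expR.
have le2 : expR (- s) <= expR e by rewrite ler_expR; lra.
rewrite ler_norml; apply/andP; split; last lra.
have h3 : 2 <= expR s + expR (- s).
  have : 0 <= (expR s - 1) ^+ 2 * expR (- s) by rewrite mulr_ge0 ?sqr_ge0 ?expR_ge0.
  rewrite (_ : (expR s - 1) ^+ 2 * expR (- s) =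
    expR s * (expR s * expR (- s)) - 2 * (expR s * expR (- s)) + expR (- s)); last by ring.
  rewrite hs; lra.
lra.
Qed.

Lemma expR_sub1_le e : expR e - 1 <= e * expR e.
Proof.
have := expR_ge1Dx (- e); have := expRxMexpNx_1 e => h1 h2.
have : expR e * (1 - e) <= expR e * expR (- e) by rewrite ler_wpM2l ?expR_ge0.
rewrite h1 mulrBr mulr1 mulrC; lra.
Qed.

(** The left-hand side is the square of exp(s/2) - exp(-s/2). *)
Lemma expR_second_diff s e : `|s| <= e ->
  `|expR s + expR (- s) - 2| <= e ^+ 2 * expR e.
Proof.
wlog s0 : s / 0 <= s.
  move=> h; have [/h //|/ltW s0] := leP 0 s.
  rewrite -normrN => /h; rewrite oppr_ge0 opprK => /(_ s0).
  by rewrite [expR (- s) + _]addrC.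
rewrite ger0_norm// => se.
have hh : expR (s / 2) * expR (- (s / 2)) = 1 by exact: expRxMexpNx_1.
have e1 : expR s = expR (s / 2) ^+ 2 by rewrite expr2 -expRD -splitr.
have e2 : expR (- s) = expR (- (s / 2)) ^+ 2 by rewrite expr2 -expRD -opprD -splitr.
have -> : expR s + expR (- s) - 2 = (expR (s / 2) - expR (- (s / 2))) ^+ 2.
  by rewrite sqrrB hh e1 e2; ring.
rewrite ger0_norm ?sqr_ge0//.
have h0 : 0 <= expR (s / 2) - expR (- (s / 2)) by rewrite subr_ge0 ler_expR; lra.
have h1 : expR (s / 2) - expR (- (s / 2)) <= s * expR (s / 2).
  have := expR_sub1_le s; rewrite !e1 => h2.
  have : (expR (s / 2) ^+ 2 - 1) * expR (- (s / 2)) <= (s * expR (s / 2) ^+ 2) * expR (- (s / 2)).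
    by rewrite ler_wpM2r ?expR_ge0.
  rewrite (_ : (expR (s / 2) ^+ 2 - 1) * expR (- (s / 2)) =
    expR (s / 2) * (expR (s / 2) * expR (- (s / 2))) - expR (- (s / 2))); last by ring.
  rewrite (_ : (s * expR (s / 2) ^+ 2) * expR (- (s / 2)) =
    s * expR (s / 2) * (expR (s / 2) * expR (- (s / 2)))); last by ring.
  by rewrite hh !mulr1.
apply: (@le_trans _ _ ((s * expR (s / 2)) ^+ 2)).
  by rewrite ler_pXn2r// nnegrE// mulr_ge0 ?expR_ge0.
rewrite exprMn -e1 ler_pM ?sqr_ge0 ?expR_ge0 ?ler_expR//.
by rewrite ler_pXn2r// nnegrE//; exact: le_trans s0 se.
Qed.

End ExpArith.

Section MeasurableLimit.
Context {R : realType} d (T : measurableType d).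

(** Where the sequence diverges the limit operator takes one fixed value. *)
Lemma measurable_limn (D : set T) (g : nat -> T -> R) : measurable D ->
  (forall n, measurable_fun D (g n)) ->
  measurable_fun D (fun x => limn (g ^~ x) : measurableTypeR R).
Proof.
move=> mD mg.
pose gE n x := (g n x)%:E.
have mgE n : measurable_fun D (gE n) by apply/measurable_EFinP; exact: mg.
pose E x := limn_esup (gE ^~ x); pose e x := limn_einf (gE ^~ x).
have mE : measurable_fun D E by exact: measurable_fun_limn_esup.
have me : measurable_fun D e.
  rewrite (_ : e = fun x => (- limn_esup ((fun n y => - gE n y) ^~ x))%E); last first.
    apply/funext => x; rewrite /e -[LHS]oppeK; congr (- _)%E.
    by rewrite -(limn_esupN (gE ^~ x)).
  apply: measurableT_comp => //; apply: measurable_fun_limn_esup => n.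
  by apply: measurableT_comp.
pose C := (D `&` [set x | E x \is a fin_num]) `\` (D `&` [set x | (e x < E x)%E]).
have mC : measurable C.
  apply: measurableD; first exact: emeasurable_fin_num.
  exact: measurable_lte.
have cvC x : D x -> C x <-> cvgn (g ^~ x).
  move=> Dx; split.
    move=> [[_ Ef] /not_andP[//|/negP]]; rewrite -leNgt => Ee.
    have eE : e x = E x by apply/eqP; rewrite eq_le Ee andbT; exact: limn_einf_sup.
    have c1 : (fun n => gE n x) @ \oo --> E x.
      apply: (@squeeze_cvge _ _ _ _ (einfs (gE ^~ x)) _ (esups (gE ^~ x))).
      - apply: nearW => n; apply/andP; split.
          by apply: ereal_inf_lbound; exists n => /=.
        by apply: ereal_sup_ubound; exists n => /=.
      - by rewrite -eE /e limn_einf_lim; exact: is_cvg_einfs.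
      - by rewrite /E limn_esup_lim; exact: is_cvg_esups.
    apply/cvg_ex; exists (fine (E x)).
    by have := fine_cvg; rewrite -(fineK Ef) in c1; move=> /(_ _ _ _ _ _ _ c1).
  move=> /cvg_ex[l hl].
  have c1 : (gE ^~ x) @ \oo --> l%:E by apply: cvg_EFin => //; exact: nearW.
  have [h1 h2] := cvg_limn_einf_sup c1.
  by split; [split => //; rewrite /= /E h2|move=> [_ /=]; rewrite /e /E h1 h2 ltxx].
have DC : D = C `|` (D `\` C).
  by rewrite setDUK// => x [[]].
rewrite DC; apply/measurable_funU => //; first exact: measurableD.
split.
  apply: (measurable_fun_cvg (h := g)).
    by move=> n; apply: measurable_funS (mg n) => // x [[]].
  by move=> x Cx; have Dx : D x by [case: Cx => -[]]; apply/(cvC _ Dx).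
apply: (eq_measurable_fun (cst point)); last exact: measurable_cst.
move=> x /set_mem[Dx nC]; rewrite /= dvgP//.
by move=> /(cvC _ Dx).
Qed.

End MeasurableLimit.

Section Weights.
Context {R : realType}.
Local Notation RN := (@RN R).
Variable b : nat -> R.
Hypothesis b0 : forall j, 0 <= b j.

(** Weighted distance of parameters; it bounds the distance of the exponents of the
    coefficient. *)
Definition ydist (y z : RN) : R := wsum b (fun j => y j - z j).

Definition set_coord (z : RN) (j : nat) (t : R) : RN := fun k => if k == j then t else z k.

Lemma ydist_fin (y z : RN) : Uset b y -> Uset b z ->
  Uset b (fun j => y j - z j).
Proof.
move=> Uy Uz; have wy := weight_ge0 b0 y; have wz := weight_ge0 b0 z.
suff h n : \sum_(j < n) b j * `|y j - z j| <= wsum b y + wsum b z.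
  by have [] := nnsum_le (weight_ge0 b0 (fun j => y j - z j)) h.
apply: (@le_trans _ _ (\sum_(j < n) (b j * `|y j| + b j * `|z j|))).
  by apply: ler_sum => j _; rewrite -mulrDr ler_wpM2l// ler_normB.
by rewrite big_split/= lerD//; exact: nnsum_ge.
Qed.

Lemma wsum_mono (y z : RN) : Uset b y -> (forall j, `|z j| <= `|y j|) ->
  Uset b z /\ wsum b z <= wsum b y.
Proof.
move=> Uy zy; apply: nnsum_mono Uy => j.
by rewrite weight_ge0//= ler_wpM2l.
Qed.

Lemma sum_delta (c : R) j n : 0 <= c -> \sum_(k < n) (if k == j :> nat then c else 0) <= c.
Proof.
move=> c0; suff -> : \sum_(k < n) (if k == j :> nat then c else 0) = if (j < n)%N then c else 0.
  by case: ifP.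
elim: n => [|n IH]; first by rewrite big_ord0.
by rewrite big_ord_recr/= IH ltnS; case: (ltngtP n j) => _; rewrite ?addr0 ?add0r.
Qed.

Lemma wsum_set_coord (z : RN) j t : Uset b z ->
  Uset b (set_coord z j t) /\ wsum b (set_coord z j t) <= wsum b z + b j * `|t|.
Proof.
move=> Uz; apply: nnsum_le => [k|n]; first exact: weight_ge0.
apply: (@le_trans _ _ (\sum_(k < n) (b k * `|z k| + (if k == j :> nat then b j * `|t| else 0)))).
  apply: ler_sum => k _; rewrite /set_coord; case: eqP => [->|_]; last by rewrite addr0.
  by rewrite lerDr mulr_ge0.
rewrite big_split/= lerD//; first by apply: nnsum_ge => // k; exact: weight_ge0.
by apply: sum_delta; rewrite mulr_ge0.
Qed.

End Weights.

Section Coefficient.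
Context {R : realType} {d : nat}.
Local Notation leb := (@lebesgue_rV R d).
Local Notation RN := (@RN R).
Local Notation fT := ('rV[R]_d -> R).
Variable D : set 'rV[R]_d.
Hypotheses (oD : open D) (bD : bounded_set D).
Let mD : measurable D := open_measurable_rV oD.

Lemma Linf_bound (v : fT) : Lspace_on +oo%E D v ->
  [/\ measurable_fun D v, 0 <= Linf_norm D v &
   {ae leb, forall x, D x -> `|v x| <= Linf_norm D v}].
Proof.
move=> /andP[mv /= fv].
have n0 : 0 <= Linf_norm D v by apply: fine_ge0; exact: Lnorm_ge0.
split => //; first by apply/(measurable_restrictT _ mD); move: mv; rewrite inE.
move: fv n0; rewrite inE/= /finite_norm /Linf_norm unlock.
case: ifPn => [l0|]; last first.
  rewrite -leNgt => l0 _ _; exists setT; split => //.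
  by apply/eqP; rewrite eq_le l0 measure_ge0.
set e := ess_sup _ _ => fv n0.
have h : \forall x \ae leb, (`|((v \_ D) x)%:E| <= e)%E by exact: ess_sup_ge.
have e0 : (0 <= e)%E by apply: ess_sup_gee => //; apply: nearW => x; exact: abse_ge0.
apply: filterS h => x + Dx; rewrite patchE mem_set//= => h.
by rewrite -lee_fin fineK// ge0_fin_numE.
Qed.

Variables (a0 : fT) (psi : nat -> fT) (b : nat -> R) (amin amax : R).
Hypotheses (b0 : forall j, 0 <= b j) (mpsi : forall j, measurable_fun D (psi j))
  (psib : forall j, {ae leb, forall x, D x -> `|psi j x| <= b j})
  (ma0 : measurable_fun D a0) (amin0 : 0 < amin)
  (a0b : {ae leb, forall x, D x -> amin <= a0 x <= amax}).

Definition exponent (y : RN) (x : 'rV[R]_d) : R := limn (series (fun j => y j * psi j x)).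

Local Notation a := (lognormal_coeff a0 psi).

Lemma coeffE y x : a y x = a0 x * expR (exponent y x). Proof. by []. Qed.

Lemma psi_ae : {ae leb, forall x, D x -> forall j, `|psi j x| <= b j}.
Proof.
have := ae_foralln psib; apply: filterS => x h Dx j; exact: h.
Qed.

Lemma exponent_cvg y x : Uset b y -> (forall j, `|psi j x| <= b j) ->
  cvgn (series (fun j => y j * psi j x)).
Proof.
move=> Uy px; apply: normed_cvg.
apply: (@series_le_cvg _ _ (fun j => b j * `|y j|)) => [j|j|j|].
- exact: normr_ge0.
- exact: weight_ge0.
- by rewrite /= normrM mulrC ler_wpM2r.
apply/cvg_ex; exists (wsum b y).
rewrite (_ : series _ = fun n => \sum_(j < n) b j * `|y j|).
  exact: nnsum_cvg (weight_ge0 b0 y) Uy.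
by apply/funext => n; rewrite /series/= big_mkord.
Qed.

Lemma exponent_dist y z x : Uset b y -> Uset b z -> (forall j, `|psi j x| <= b j) ->
  `|exponent y x - exponent z x| <= ydist b y z.
Proof.
move=> Uy Uz px; have cy := exponent_cvg Uy px; have cz := exponent_cvg Uz px.
rewrite /exponent -limB// -lim_norm; last exact: is_cvgB.
apply: limr_le; first by apply: is_cvg_norm; exact: is_cvgB.
apply: nearW => n.
rewrite -[X in `|X|]/(series (fun j => y j * psi j x) n - series (fun j => z j * psi j x) n).
rewrite /series/= -sumrB (le_trans (ler_norm_sum _ _ _))//.
apply: (@le_trans _ _ (\sum_(j < n) b j * `|y j - z j|)).
  by rewrite big_mkord; apply: ler_sum => j _; rewrite -mulrBl normrM mulrC ler_wpM2r.
exact: nnsum_ge (weight_ge0 b0 _) (ydist_fin b0 Uy Uz).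
Qed.

Lemma exponent_le y x : Uset b y -> (forall j, `|psi j x| <= b j) ->
  `|exponent y x| <= wsum b y.
Proof.
move=> Uy px; have cy := exponent_cvg Uy px.
rewrite /exponent -lim_norm//.
apply: limr_le; first exact: is_cvg_norm.
apply: nearW => n; rewrite /series/= (le_trans (ler_norm_sum _ _ _))//.
apply: (@le_trans _ _ (\sum_(j < n) b j * `|y j|)).
  by rewrite big_mkord; apply: ler_sum => j _; rewrite normrM mulrC ler_wpM2r.
exact: nnsum_ge (weight_ge0 b0 _) Uy.
Qed.

Lemma exponent_set_coord z j t x : Uset b z -> z j = 0 -> (forall k, `|psi k x| <= b k) ->
  exponent (set_coord z j t) x = exponent z x + t * psi j x.
Proof.
move=> Uz zj px; have [Ut _] := wsum_set_coord b0 j t Uz.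
have cy := exponent_cvg Ut px; have cz := exponent_cvg Uz px.
apply/eqP; rewrite addrC -subr_eq; apply/eqP; rewrite /exponent -limB//.
apply/cvg_lim => //; apply: cvg_near_cst; exists j.+1 => // n /= jn.
rewrite -[LHS]/(series (fun k => set_coord z j t k * psi k x) n - series (fun k => z k * psi k x) n).
rewrite /series/= -sumrB big_mkord (bigD1 (Ordinal jn))//= big1 ?addr0.
  by rewrite /set_coord eqxx zj mul0r subr0.
by move=> k /negbTE kj; rewrite /set_coord -val_eqE/= in kj *; rewrite kj subrr.
Qed.

Lemma measurable_coeff y : measurable_fun D (a y : _ -> measurableTypeR R).
Proof.
apply: measurable_funM => //; apply: measurableT_comp => //.
apply: measurable_limn => // n; rewrite /series/=.
by apply: measurable_sum => j; apply: measurable_funM.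
Qed.

Lemma coeff_bounds y : Uset b y -> {ae leb, forall x, D x ->
  amin * expR (- wsum b y) <= a y x <= amax * expR (wsum b y)}.
Proof.
move=> Uy; apply: filterS2 psi_ae a0b => x + + Dx => /(_ Dx) px /(_ Dx)/andP[h1 h2].
have := exponent_le Uy px; rewrite ler_norml => /andP[w1 w2].
rewrite coeffE; apply/andP; split.
  by apply: ler_pM; rewrite ?expR_ge0 ?ler_expR// ltW.
apply: ler_pM; rewrite ?expR_ge0 ?ler_expR//.
exact: le_trans (ltW amin0) h1.
Qed.

Lemma coeff_ge0 y : Uset b y -> {ae leb, forall x, D x -> 0 <= a y x}.
Proof.
move=> Uy; apply: filterS (coeff_bounds Uy) => x + Dx => /(_ Dx)/andP[h _].
by apply: le_trans h; rewrite mulr_ge0 ?expR_ge0// ltW.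
Qed.

Lemma coeff_weight y : Uset b y -> bounded_weight leb D (a y).
Proof.
move=> Uy; split; first exact: measurable_coeff.
exists (amax * expR (wsum b y)).
apply: filterS2 (coeff_bounds Uy) (coeff_ge0 Uy) => x + + Dx => /(_ Dx)/andP[_ h] /(_ Dx) h0.
by rewrite ger0_norm.
Qed.

Local Notation Bf y := (wform D (a y)).

Lemma coeff_psd y : Uset b y -> psd_form (H1 D : set fT) (Bf y).
Proof. by move=> Uy; apply: wform_psd => //; [exact: coeff_weight|exact: coeff_ge0]. Qed.

Lemma coeff_coercive y v : Uset b y -> H1 D v ->
  amin * expR (- wsum b y) * dirichlet D v v <= Bf y v v.
Proof.
move=> Uy hv; rewrite /dirichlet -wformZ//; last exact: bounded_weight1.
apply: wform_mono => //; [|exact: coeff_weight|].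
  by apply: bounded_weightZ => //; exact: bounded_weight1.
by apply: filterS (coeff_bounds Uy) => x + Dx => /(_ Dx)/andP[h _]; rewrite mulr1.
Qed.

(** The coefficients at y and z have a quotient between exp(-e) and exp(e). *)
Lemma coeff_compare y z (e : R) : Uset b y -> Uset b z ->
  {ae leb, forall x, D x -> `|exponent z x - exponent y x| <= e} -> 0 <= e ->
  (forall u v, H1 D u -> H1 D v ->
    `|Bf z u v - Bf y u v| <= (expR e - 1) * (form_norm (Bf y) u * form_norm (Bf y) v)) /\
  (forall v, H1 D v -> form_norm (Bf z) v <= expR (e / 2) * form_norm (Bf y) v).
Proof.
move=> Uy Uz he e0; have ee : 0 <= expR e - 1 by rewrite subr_ge0 -expR0 ler_expR.
have wz := coeff_weight Uz; have wy := coeff_weight Uy.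
have zy x : a z x = a y x * expR (exponent z x - exponent y x).
  by rewrite !coeffE -mulrA -expRD subrKC.
split=> [u v hu hv|v hv].
  rewrite -wformB//; apply: wform_cs => //; [exact: bounded_weightB| |exact: coeff_ge0].
  apply: filterS2 he (coeff_ge0 Uy) => x + + Dx => /(_ Dx) h /(_ Dx) y0.
  rewrite zy -[X in _ - X]mulr1 -mulrBr normrM (ger0_norm y0) mulrC.
  by rewrite ler_wpM2r//; exact: expR_dist.
have -> : expR (e / 2) = Num.sqrt (expR e).
  by rewrite {2}(splitr e) expRD -expr2 sqrtr_sqr ger0_norm ?expR_ge0.
rewrite /form_norm -sqrtrM ?expR_ge0// ler_wsqrtr// -wformZ//.
apply: wform_mono => //; first exact: bounded_weightZ.
apply: filterS2 he (coeff_ge0 Uy) => x + + Dx => /(_ Dx) h /(_ Dx) y0.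
rewrite zy mulrC ler_wpM2r// ler_expR; exact: le_trans (ler_norm _) h.
Qed.

(** The exponent is affine in y_j with slope psi_j, bounded by b_j: the first-order
    terms cancel. *)
Lemma coeff_second_diff z j t u v : Uset b z -> z j = 0 -> H1 D u -> H1 D v ->
  `|Bf (set_coord z j t) u v + Bf (set_coord z j (- t)) u v - 2 * Bf z u v| <=
    (b j * `|t|) ^+ 2 * expR (b j * `|t|) * (form_norm (Bf z) u * form_norm (Bf z) v).
Proof.
move=> Uz zj hu hv; set e := b j * _.
have [Up _] := wsum_set_coord b0 j t Uz; have [Um _] := wsum_set_coord b0 j (- t) Uz.
have wz := coeff_weight Uz; have wp := coeff_weight Up; have wm := coeff_weight Um.
have wpm := bounded_weightD wp wm; have w2 := bounded_weightZ 2 wz.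
rewrite -wformD// -wformZ// -wformB//.
apply: wform_cs => //; [exact: bounded_weightB| | |exact: coeff_ge0]; last first.
  by rewrite mulr_ge0 ?sqr_ge0 ?expR_ge0.
apply: filterS2 psi_ae (coeff_ge0 Uz) => x + + Dx => /(_ Dx) px /(_ Dx) z0.
have shift r : a (set_coord z j r) x = a z x * expR (r * psi j x).
  by rewrite !coeffE exponent_set_coord// expRD mulrA.
rewrite !shift mulNr.
have -> : a z x * expR (t * psi j x) + a z x * expR (- (t * psi j x)) - 2 * a z x =
   (expR (t * psi j x) + expR (- (t * psi j x)) - 2) * a z x by ring.
rewrite normrM (ger0_norm z0) ler_wpM2r//; apply: expR_second_diff.
by rewrite normrM mulrC ler_wpM2r.
Qed.

Lemma coeff_shift z j t : Uset b z -> z j = 0 ->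
  {ae leb, forall x, D x -> `|exponent (set_coord z j t) x - exponent z x| <= b j * `|t|}.
Proof.
move=> Uz zj; apply: filterS psi_ae => x + Dx => /(_ Dx) px.
by rewrite exponent_set_coord// addrC addKr normrM mulrC ler_wpM2r.
Qed.

End Coefficient.

(** * Energy estimates *)

Section Galerkin.
Context {R : realType} {V : lmodType R}.
Variables (E W : set V) (Bd : V -> V -> R) (f : V -> R) (F : R).
Hypotheses (hE : is_subspace E) (hW : is_subspace W) (WE : W `<=` E) (F0 : 0 <= F)
  (fF : forall v, W v -> `|f v| <= F * form_norm Bd v).

Lemma sqr_le_mul (x c : R) : 0 <= x -> 0 <= c -> x ^+ 2 <= c * x -> x <= c.
Proof.
rewrite le_eqVlt => /orP[/eqP <- //|x0] c0.
by rewrite expr2 ler_pM2r.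
Qed.

Definition galerkin (B : V -> V -> R) u := W u /\ forall v, W v -> B u v = f v.

(** Test the equation with its solution. *)
Lemma energy_bound (B : V -> V -> R) (k : R) u : psd_form E B -> 0 <= k ->
  (forall v, E v -> form_norm Bd v <= k * form_norm B v) -> galerkin B u ->
  form_norm B u <= F * k.
Proof.
move=> hB k0 hk [Wu su]; apply: sqr_le_mul; [exact: form_norm_ge0|exact: mulr_ge0|].
rewrite (form_norm_sqr hB (WE Wu)) su//.
apply: (le_trans (ler_norm _)); apply: (le_trans (fF Wu)).
by rewrite -mulrA ler_wpM2l// hk//; exact: WE.
Qed.

(** Test the difference of the two equations with the difference of the solutions. *)
Lemma energy_diff (B0 B1 : V -> V -> R) (e k : R) u0 u1 :
  psd_form E B0 -> psd_form E B1 -> 0 <= e -> 0 <= k ->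
  (forall u v, E u -> E v -> `|B0 u v - B1 u v| <= e * (form_norm B1 u * form_norm B1 v)) ->
  (forall v, E v -> form_norm B1 v <= k * form_norm B0 v) ->
  galerkin B0 u0 -> galerkin B1 u1 ->
  form_norm B0 (u0 - u1) <= e * k * form_norm B1 u1.
Proof.
move=> h0 h1 e0 k0 d01 k01 [W0 s0] [W1 s1].
have Ww : W (u0 - u1) by exact: subspaceB.
have Ew := WE Ww; have E0 := WE W0; have E1 := WE W1.
apply: sqr_le_mul; first exact: form_norm_ge0.
  by rewrite !mulr_ge0// form_norm_ge0.
rewrite (form_norm_sqr h0 Ew) (formBl h0)// s0// -(s1 _ Ww) -opprB.
apply: (le_trans (ler_norm _)); rewrite normrN; apply: (le_trans (d01 _ _ E1 Ew)).
have := ler_wpM2l (mulr_ge0 e0 (form_norm_ge0 B1 u1)) (k01 _ Ew).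
move=> h; rewrite mulrA; apply: (le_trans h); rewrite le_eqVlt; apply/orP; left; apply/eqP; ring.
Qed.

(** Tested with itself, the second difference w of the solutions has the energy
    - (Bp + Bm - 2 B0)(up, w) - (Bm - B0)(um - up, w): a second difference of the
    form, and a product of two first differences. *)
Lemma energy_second_diff (B0 Bp Bm : V -> V -> R) (e h : R) u0 up um :
  psd_form E B0 -> psd_form E Bp -> psd_form E Bm -> 0 <= e -> 0 <= h ->
  (forall u v, E u -> E v -> `|Bp u v + Bm u v - 2 * B0 u v| <=
     h * (form_norm B0 u * form_norm B0 v)) ->
  (forall u v, E u -> E v -> `|Bm u v - B0 u v| <= e * (form_norm B0 u * form_norm B0 v)) ->
  galerkin B0 u0 -> galerkin Bp up -> galerkin Bm um ->
  form_norm B0 (up + um - 2 *: u0) <= h * form_norm B0 up + e * form_norm B0 (um - up).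
Proof.
move=> hB0 hBp hBm e0 h0 dh de [W0 s0] [Wp sp] [Wm sm].
set w := _ - _.
have Ww : W w by apply: subspaceB => //; [exact: subspaceD|exact: subspaceZ].
have Ew := WE Ww; have E0 := WE W0; have Ep := WE Wp; have Em := WE Wm.
have Emp : E (um - up) by exact: subspaceB.
have Ewpm : E (up + um) by exact: subspaceD.
have E20 : E (2 *: u0) by exact: subspaceZ.
apply: sqr_le_mul; first exact: form_norm_ge0.
  by rewrite addr_ge0// mulr_ge0// form_norm_ge0.
have -> : form_norm B0 w ^+ 2 =
    - (Bp up w + Bm up w - 2 * B0 up w) - (Bm (um - up) w - B0 (um - up) w).
  rewrite (form_norm_sqr hB0 Ew) {1}/w (formBl hB0 Ewpm E20 Ew) (formDl hB0 Ep Em Ew) (formZl hE hB0 2 E0 Ew).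
  rewrite (s0 _ Ww) (formBl hBm Em Ep Ew) (formBl hB0 Em Ep Ew) (sp _ Ww) (sm _ Ww); ring.
apply: (le_trans (ler_norm _)); apply: (le_trans (ler_normB _ _)); rewrite normrN.
apply: (le_trans (lerD (dh _ _ Ep Ew) (de _ _ Emp Ew))).
by rewrite mulrDl !mulrA.
Qed.

End Galerkin.

Section EnergyArith.
Context {R : realType}.
Implicit Types F k s e x : R.

Lemma energy_arith1 F k s : (k * expR (s / 2)) * (F * (k * expR (s / 2))) = F * k ^+ 2 * expR s.
Proof. by rewrite [in RHS](splitr s) expRD; ring. Qed.

Lemma energy_arith2 F k s s' e : 0 <= F -> s' <= s -> 0 <= e ->
  (k * expR (s' / 2)) * ((expR e - 1) * expR (e / 2) * (F * (k * expR (s / 2)))) <=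
  F * k ^+ 2 * expR s * ((expR e - 1) * expR e).
Proof.
move=> F0 ss e0.
have ee : 0 <= expR e - 1 by rewrite subr_ge0 -expR0 ler_expR.
rewrite (_ : _ * _ = F * k ^+ 2 * (expR e - 1) * (expR (s' / 2) * expR (s / 2) * expR (e / 2))); last by ring.
rewrite (_ : F * k ^+ 2 * expR s * _ = F * k ^+ 2 * (expR e - 1) * (expR s * expR e)); last by ring.
rewrite ler_wpM2l//; first by rewrite mulr_ge0// mulr_ge0// sqr_ge0.
rewrite -!expRD ler_expR; lra.
Qed.

Lemma energy_arith3 F k s e G : 0 <= F -> 0 <= e -> 0 <= k ->
  G = F * (k * expR (s / 2)) ->
  (k * expR (s / 2)) * (e ^+ 2 * expR e * (expR e * G) +
     (expR e - 1) * (2 * ((expR e - 1) * expR e * G))) <=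
  3 * (F * k ^+ 2) * e ^+ 2 * expR (5 * e) * expR s.
Proof.
move=> F0 e0 k0 GE.
have x1 : 1 <= expR e by rewrite -expR0 ler_expR.
have xe := expR_sub1_le e.
have -> : expR (5 * e) = expR e ^+ 5 by rewrite expRM_natl.
set x := expR e in x1 xe *.
have x0 : 0 <= x by exact: expR_ge0.
have s2 : expR (s / 2) * expR (s / 2) = expR s by rewrite -expRD -splitr.
rewrite (_ : _ * _ = F * k ^+ 2 * (expR (s / 2) * expR (s / 2)) *
   (e ^+ 2 * x ^+ 2 + 2 * ((x - 1) ^+ 2 * x))); last by rewrite GE; ring.
rewrite s2 (_ : 3 * _ * _ * _ * _ = F * k ^+ 2 * expR s * (3 * (e ^+ 2 * x ^+ 5))); last by ring.
rewrite ler_wpM2l//; first by rewrite mulr_ge0 ?expR_ge0// mulr_ge0// sqr_ge0.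
have h1 : (x - 1) ^+ 2 <= (e * x) ^+ 2.
  by rewrite ler_pXn2r// nnegrE ?subr_ge0 ?mulr_ge0.
have h2 : (x - 1) ^+ 2 * x <= e ^+ 2 * x ^+ 3.
  by rewrite (_ : e ^+ 2 * x ^+ 3 = (e * x) ^+ 2 * x) ?ler_wpM2r//; ring.
have h3 m : (m <= 5)%N -> e ^+ 2 * x ^+ m <= e ^+ 2 * x ^+ 5.
  by move=> m5; rewrite ler_wpM2l ?sqr_ge0// ler_weXn2l.
have := h3 2%N isT; have := h3 3%N isT; lra.
Qed.

End EnergyArith.

Section SolutionEstimates.
Context {R : realType} {d : nat}.
Local Notation leb := (@lebesgue_rV R d).
Local Notation RN := (@RN R).
Local Notation fT := ('rV[R]_d -> R).
Variable D : set 'rV[R]_d.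
Hypotheses (oD : open D) (bD : bounded_set D).
Variables (a0 : fT) (psi : nat -> fT) (b : nat -> R) (amin amax : R).
Hypotheses (b0 : forall j, 0 <= b j) (mpsi : forall j, measurable_fun D (psi j))
  (psib : forall j, {ae leb, forall x, D x -> `|psi j x| <= b j})
  (ma0 : measurable_fun D a0) (amin0 : 0 < amin)
  (a0b : {ae leb, forall x, D x -> amin <= a0 x <= amax}).
Variables (f : fT -> R) (W : set fT) (u : RN -> fT).
Hypotheses (hf : H10_dual D f) (hW : is_subspace W) (WH : W `<=` H10 D)
  (hu : forall y, Uset b y -> variational_solution D (lognormal_coeff a0 psi y) f W (u y)).
Local Notation a := (lognormal_coeff a0 psi).
Local Notation Bf y := (wform D (a y)).
Local Notation N := (H10_norm D).

(** A bound for the norm, continuity in the parameter, and a second difference of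
    order b_j^2 in each coordinate. The exponentials of the weighted sums come from
    the coercivity constant, at least a multiple of exp(- wsum b y); five is a
    convenient majorant of the exponents that add up. *)
Lemma solution_estimates : exists C : R, [/\ 0 <= C,
  forall y, Uset b y -> N (u y) <= C * expR (wsum b y),
  forall y z, Uset b y -> Uset b z -> wsum b z <= wsum b y ->
    N (u y - u z) <= C * expR (wsum b y) * ((expR (ydist b y z) - 1) * expR (ydist b y z)) &
  forall z j t, Uset b z -> z j = 0 ->
    N (u (set_coord z j t) + u (set_coord z j (- t)) - 2 *: u z) <=
    3 * C * (b j * `|t|) ^+ 2 * expR (5 * (b j * `|t|)) * expR (wsum b z) ].
Proof.
have [_ [K hK]] := hf; pose F := `|K|; pose k := (Num.sqrt amin)^-1.
have F0 : 0 <= F by exact: normr_ge0.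
have k0 : 0 <= k by rewrite invr_ge0 sqrtr_ge0.
have hE : is_subspace (H1 D : set fT) by exact: H1_subspace.
have WE : W `<=` (H1 D : set fT) by move=> v /WH; exact: H10_H1.
have fF v : W v -> `|f v| <= F * form_norm (dirichlet D) v.
  move=> /WH Wv; apply: (le_trans (hK v Wv)); rewrite -H10_normE.
  by rewrite ler_wpM2r ?sqrtr_ge0// ler_norm.
have psd y : Uset b y -> psd_form (H1 D : set fT) (Bf y).
  by move=> Uy; exact: (coeff_psd oD bD b0 mpsi psib ma0 amin0 a0b Uy).
have coer y v : Uset b y -> H1 D v ->
    form_norm (dirichlet D) v <= k * expR (wsum b y / 2) * form_norm (Bf y) v.
  move=> Uy hv.
  have c := coeff_coercive oD bD b0 mpsi psib ma0 amin0 a0b Uy hv.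
  have -> : k * expR (wsum b y / 2) = Num.sqrt (amin^-1 * expR (wsum b y)).
    rewrite sqrtrM ?invr_ge0 ?(ltW amin0)// sqrtrV ?(ltW amin0)//; congr (_ * _).
    by rewrite {2}(splitr (wsum b y)) expRD -expr2 sqrtr_sqr ger0_norm ?expR_ge0.
  have ke : 0 <= amin^-1 * expR (wsum b y) by rewrite mulr_ge0 ?expR_ge0// invr_ge0 ltW.
  rewrite /form_norm -sqrtrM// ler_wsqrtr//.
  have := ler_wpM2l ke c; congr (_ <= _).
  have := expRxMexpNx_1 (wsum b y) => h1.
  by rewrite mulrA mulrACA h1 mulVf ?gt_eqF// !mul1r.
have sol y : Uset b y -> galerkin W f (Bf y) (u y) by exact: hu.
have bound y : Uset b y -> form_norm (Bf y) (u y) <= F * (k * expR (wsum b y / 2)).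
  move=> Uy; apply: (energy_bound WE F0 fF (psd y Uy)); last exact: sol.
    by rewrite mulr_ge0 ?expR_ge0.
  by move=> v hv; exact: coer.
have ke0 (s : R) : 0 <= k * expR (s / 2) by rewrite mulr_ge0 ?expR_ge0.
have em0 (e : R) : 0 <= e -> 0 <= expR e - 1 by move=> e0; rewrite subr_ge0 -expR0 ler_expR.
have diff y z (e : R) : Uset b y -> Uset b z -> 0 <= e ->
    {ae leb, forall x, D x -> `|exponent psi z x - exponent psi y x| <= e} ->
    form_norm (Bf z) (u z - u y) <= (expR e - 1) * expR (e / 2) * (F * (k * expR (wsum b y / 2))).
  move=> Uy Uz e0 hzy.
  have [c1 _] := coeff_compare oD bD b0 mpsi psib ma0 amin0 a0b Uy Uz hzy e0.
  have hyz : {ae leb, forall x, D x -> `|exponent psi y x - exponent psi z x| <= e}.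
    by apply: filterS hzy => x + Dx => /(_ Dx); rewrite distrC.
  have [_ c2] := coeff_compare oD bD b0 mpsi psib ma0 amin0 a0b Uz Uy hyz e0.
  apply: le_trans (ler_wpM2l _ (bound y Uy)); last by rewrite mulr_ge0 ?expR_ge0// em0.
  apply: (energy_diff hW WE (psd z Uz) (psd y Uy) (em0 e e0) (expR_ge0 _) c1 c2); exact: sol.
exists (F * k ^+ 2); split.
- by rewrite mulr_ge0// sqr_ge0.
- move=> y Uy; rewrite H10_normE -energy_arith1.
  have Eu : H1 D (u y) by apply: WE; case: (sol y Uy).
  by apply: (le_trans (coer y _ Uy Eu)); rewrite ler_wpM2l// bound.
- move=> y z Uy Uz zy; set e := ydist b y z.
  have e0 : 0 <= e by apply: nnsum_ge0; exact: weight_ge0.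
  have Ey : H1 D (u y) by apply: WE; case: (sol y Uy).
  have Ez : H1 D (u z) by apply: WE; case: (sol z Uz).
  rewrite H10_normE (form_normBC hE (dirichlet_psd oD bD))//.
  apply: (le_trans (coer z _ Uz (subspaceB hE Ez Ey))).
  apply: le_trans (energy_arith2 k F0 zy e0); rewrite ler_wpM2l//.
  apply: diff => //; apply: filterS (psi_ae psib) => x + Dx => /(_ Dx) px.
  by rewrite distrC; exact: exponent_dist.
move=> z j t Uz zj; set e := b j * `|t|.
have e0 : 0 <= e by rewrite mulr_ge0.
have [Up Sp] := wsum_set_coord b0 j t Uz; have [Um Sm] := wsum_set_coord b0 j (- t) Uz.
rewrite normrN in Sm; rewrite -/e in Sp Sm.
set yp := set_coord z j t in Up Sp *; set ym := set_coord z j (- t) in Um Sm *.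
have hp : {ae leb, forall x, D x -> `|exponent psi yp x - exponent psi z x| <= e}.
  exact: coeff_shift.
have hm : {ae leb, forall x, D x -> `|exponent psi ym x - exponent psi z x| <= e}.
  by have := coeff_shift b0 psib (- t) Uz zj; rewrite normrN.
have flip y : {ae leb, forall x, D x -> `|exponent psi y x - exponent psi z x| <= e} ->
    {ae leb, forall x, D x -> `|exponent psi z x - exponent psi y x| <= e}.
  by move=> h; apply: filterS h => x + Dx => /(_ Dx); rewrite distrC.
pose G := F * (k * expR (wsum b z / 2)).
have half y : wsum b y <= wsum b z + e -> F * (k * expR (wsum b y / 2)) <= expR (e / 2) * G.
  move=> h; rewrite /G (_ : expR (e / 2) * _ = F * (k * (expR (wsum b z / 2) * expR (e / 2)))); last by ring.
  by rewrite !ler_wpM2l// -expRD ler_expR; lra.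
have Ep : H1 D (u yp) by apply: WE; case: (sol yp Up).
have Em : H1 D (u ym) by apply: WE; case: (sol ym Um).
have Ez : H1 D (u z) by apply: WE; case: (sol z Uz).
have [_ cp2] := coeff_compare oD bD b0 mpsi psib ma0 amin0 a0b Up Uz (flip _ hp) e0.
have [cm1 _] := coeff_compare oD bD b0 mpsi psib ma0 amin0 a0b Uz Um hm e0.
have ehalf : expR (e / 2) * expR (e / 2) = expR e by rewrite -expRD -splitr.
have bp : form_norm (Bf z) (u yp) <= expR e * G.
  apply: (le_trans (cp2 _ Ep)); rewrite -ehalf -mulrA ler_wpM2l ?expR_ge0//.
  exact: le_trans (bound yp Up) (half _ Sp).
have dz y : Uset b y -> wsum b y <= wsum b z + e ->
    {ae leb, forall x, D x -> `|exponent psi y x - exponent psi z x| <= e} ->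
    form_norm (Bf z) (u z - u y) <= (expR e - 1) * expR e * G.
  move=> Uy Sy hy; apply: (le_trans (diff y z e Uy Uz e0 (flip _ hy))).
  have -> : (expR e - 1) * expR e * G = (expR e - 1) * expR (e / 2) * (expR (e / 2) * G).
    by rewrite mulrA -[_ * expR (e / 2) * expR (e / 2)]mulrA ehalf.
  rewrite ler_wpM2l ?mulr_ge0 ?em0 ?expR_ge0//; exact: half.
have bmp : form_norm (Bf z) (u ym - u yp) <= 2 * ((expR e - 1) * expR e * G).
  apply: (le_trans (form_triB hE (psd z Uz) Em Ez Ep)).
  rewrite (form_normBC hE (psd z Uz) Em Ez) mulr2n mulrDl mul1r.
  by apply: lerD; exact: dz.
have h0 : 0 <= e ^+ 2 * expR e by rewrite mulr_ge0 ?sqr_ge0 ?expR_ge0.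
have ss := energy_second_diff hE hW WE (psd z Uz) (psd yp Up) (psd ym Um) (em0 e e0) h0
  (fun v w hv hw => coeff_second_diff oD bD b0 mpsi psib ma0 amin0 a0b t Uz zj hv hw) cm1
  (sol z Uz) (sol yp Up) (sol ym Um).
have Ew : H1 D (u yp + u ym - 2 *: u z).
  by apply: (subspaceB hE); [exact: (subspaceD hE)|exact: (subspaceZ hE)].
rewrite H10_normE; apply: (le_trans (coer z _ Uz Ew)).
apply: le_trans (energy_arith3 F0 e0 k0 (erefl G)); rewrite ler_wpM2l//.
apply: (le_trans ss); apply: lerD; rewrite ler_wpM2l//; exact: em0.
Qed.

End SolutionEstimates.

(** * Simple maps and rounded parameters *)

Section FiniteCode.
Context {R : realType} {V : lmodType R} {d : measure_display} {T : measurableType d}.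
Variables (C : finType) (c : T -> C).
Hypothesis mc : forall k, measurable [set t | c t = k].

Lemma code_indic (h : C -> R) t :
  h (c t) = \sum_(k < #|C|) \1_[set t | c t = enum_val k] t * h (enum_val k).
Proof.
rewrite (bigD1 (enum_rank (c t)))//= enum_rankK big1 => [|k kc].
  by rewrite addr0 indicE mem_set ?mul1r.
rewrite indicE memNset ?mul0r//= => e; move: kc; rewrite e.
by rewrite enum_valK eqxx.
Qed.

Lemma measurable_code (h : C -> R) : measurable_fun setT (fun t => h (c t) : measurableTypeR R).
Proof.
rewrite (_ : (fun t => _) = fun t => \sum_(k < #|C|) \1_[set t | c t = enum_val k] t * h (enum_val k)).
  by apply: measurable_sum => k; apply: measurable_funM => //; exact: measurable_indic.
by apply/funext => t; exact: code_indic.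
Qed.

Lemma code_bounded (h : C -> R) : exists M, forall t, `|h (c t)| <= M.
Proof.
exists (\sum_k `|h k|) => t; rewrite (bigD1 (c t))//= lerDl.
exact: sumr_ge0.
Qed.

Variable g : C -> V.

Definition code_map : @simple_map R d T V :=
  SimpleMap (fun k : 'I_#|C| => [set t | c t = enum_val k]) (fun k => g (enum_val k)).

Lemma code_map_eval t : simple_eval code_map t = g (c t).
Proof.
rewrite /simple_eval (bigD1 (enum_rank (c t)))//= enum_rankK big1 => [|k kc].
  by rewrite addr0 indicE mem_set ?scale1r.
rewrite indicE memNset ?scale0r//= => e; move: kc; rewrite e.
by rewrite enum_valK eqxx.
Qed.

Variables (mu : {finite_measure set T -> \bar R}) (B : set T).
Hypothesis mB : measurable B.

Lemma intg_code (h : C -> R) : mu.-integrable B (EFin \o (fun t => h (c t))).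
Proof.
have [M hM] := code_bounded h.
apply: (intg_dom mB _ (intg_cst mB M _)) => //.
- exact: measurable_funTS (measurable_code h).
- by rewrite ltey_eq fin_num_measure.
Qed.

Variables (E : set V) (Bd : V -> V -> R).
Hypotheses (hE : is_subspace E) (hB : psd_form E Bd) (Eg : forall k, E (g k)).

Lemma code_map_in : simple_in E code_map.
Proof. by move=> k; split; [exact: mc|exact: Eg]. Qed.

(** Pairing with a fixed vector turns the integral of a simple map into a scalar
    integral. *)
Lemma simple_integral_pairing v : E v ->
  Bd (simple_integral mu B code_map) v = \int[mu]_(t in B) Bd (g (c t)) v.
Proof.
move=> Ev; rewrite /simple_integral (form_suml hE hB)//; last first.
  by move=> k; apply: (subspaceZ hE); exact: Eg.
rewrite (_ : \int[mu]_(t in B) _ = \int[mu]_(t in B)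
    (\sum_(k < #|C|) \1_[set t | c t = enum_val k] t * Bd (g (enum_val k)) v)); last first.
  by apply: eq_Rintegral => t _; exact: (code_indic (fun k => Bd (g k) v)).
have i1 (k : 'I_#|C|) : mu.-integrable B (EFin \o (\1_[set t | c t = enum_val k] : T -> R)).
  have := intg_code (fun x => (x == enum_val k)%:R); congr (_.-integrable _ _).
  apply/funext => t /=; rewrite indicE; congr (EFin (nat_of_bool _)%:R).
  by apply/idP/idP => [/eqP h|/set_mem/= ->//]; exact: mem_set.
rewrite Rintegral_sum//; last first.
  move=> k; have := intgZ mB (Bd (g (enum_val k)) v) (i1 k); congr (_.-integrable _ (EFin \o _)).
  by apply/funext => t; rewrite mulrC.
apply: eq_bigr => k _.
rewrite (formZl hE hB _ (Eg _) Ev) RintegralZr//; congr (_ * _).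
by rewrite /Rintegral integral_indic// setIC.
Qed.

End FiniteCode.

Section Rounding.
Context {R : realType}.
Local Notation RN := (@RN R).
Implicit Types (t : R) (n : nat).

Definition round_level n t : nat := minn (Num.trunc (`|t| * n.+1%:R)) (n.+1 ^ 2).

(** Rounding towards 0 to a multiple of 1/(n+1), with a cut-off; this is odd and
    takes finitely many values. *)
Definition quantize n t : R := (-1) ^+ (t < 0)%R * ((round_level n t)%:R / n.+1%:R).

Definition rounding n (y : RN) : RN := fun j => if (j < n)%N then quantize n (y j) else 0.

Lemma round_levelN n t : round_level n (- t) = round_level n t.
Proof. by rewrite /round_level normrN. Qed.

Lemma round_level0 n : round_level n (0 : R) = 0%N.
Proof. by rewrite /round_level normr0 mul0r truncn0 min0n. Qed.

Lemma quantize0 n : quantize n 0 = 0.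
Proof. by rewrite /quantize round_level0 mul0r mulr0. Qed.

Lemma quantizeN n t : quantize n (- t) = - quantize n t.
Proof.
rewrite /quantize round_levelN oppr_lt0 -mulNr.
have [t0|t0|->] := ltgtP t 0; rewrite ?round_level0 ?mul0r ?mulr0//.
by rewrite expr0 expr1 opprK.
Qed.

Lemma round_level_le n t : (round_level n t)%:R / n.+1%:R <= `|t|.
Proof.
rewrite ler_pdivrMr ?ltr0n//; apply: (@le_trans _ _ (Num.trunc (`|t| * n.+1%:R))%:R).
  by rewrite ler_nat geq_minl.
by rewrite truncn_le mulr_ge0.
Qed.

Lemma round_level_ge0 n t : 0 <= (round_level n t)%:R / n.+1%:R :> R.
Proof. by rewrite divr_ge0. Qed.

Lemma quantize_abs n t : `|quantize n t| <= `|t|.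
Proof. by rewrite normrMsign ger0_norm ?round_level_ge0// round_level_le. Qed.

Lemma quantize_dist n t : `|t - quantize n t| = `|t| - (round_level n t)%:R / n.+1%:R.
Proof.
rewrite {1}(numEsign t) -mulrBr normrMsign ger0_norm// subr_ge0.
exact: round_level_le.
Qed.

Lemma quantize_cvg t : (fun n => `|t - quantize n t|) @ \oo --> (0 : R).
Proof.
apply: (squeeze_cvgr (f := fun=> 0) (h := fun n => n.+1%:R^-1)).
- exists (Num.trunc `|t|).+1 => // n /= tn; rewrite normr_ge0 quantize_dist /=.
  have n0 : (0 : R) < n.+1%:R by rewrite ltr0n.
  have tR : `|t| < n.+1%:R.
    apply: (lt_le_trans (truncnS_gt `|t|)); rewrite ler_nat; exact: leqW.
  have lv : (Num.trunc (`|t| * n.+1%:R) <= n.+1 ^ 2)%N.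
    rewrite truncn_le_nat (@le_lt_trans _ _ (n.+1%:R * n.+1%:R))//.
      by rewrite ler_wpM2r// ltW.
    by rewrite -natrM ltr_nat ltnS.
  rewrite /round_level (minn_idPl lv) lerBlDr -[X in _ <= X + _]mul1r -mulrDl ler_pdivlMr//.
  by rewrite nat1r ltW// truncnS_gt.
- exact: cvg_cst.
- exact: cvg_harmonic.
Qed.

Lemma rounding_abs n (y : RN) j : `|rounding n y j| <= `|y j|.
Proof. by rewrite /rounding; case: ifP => _; rewrite ?normr0// quantize_abs. Qed.

Lemma rounding_dist_le n (y : RN) j : `|y j - rounding n y j| <= `|y j|.
Proof.
rewrite /rounding; case: ifP => _; last by rewrite subr0.
by rewrite quantize_dist lerBlDr lerDl round_level_ge0.
Qed.

Lemma rounding_cvg (y : RN) j : (fun n => `|y j - rounding n y j|) @ \oo --> (0 : R).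
Proof.
apply: cvg_trans (quantize_cvg (y j)); apply: near_eq_cvg.
by exists j.+1 => // n /= jn; rewrite /rounding jn.
Qed.

Lemma truncate_rounding s n (y : RN) : truncate s (rounding n y) = rounding n (truncate s y).
Proof.
apply/funext => j; rewrite /truncate /rounding.
by case: ifP => // _; rewrite quantize0; case: ifP.
Qed.

Lemma rounding_flip j n (y : RN) : rounding n (flip_coord j y) = flip_coord j (rounding n y).
Proof.
apply/funext => k; rewrite /flip_coord /rounding.
by case: (k == j); case: ifP => //; rewrite ?quantizeN ?oppr0.
Qed.

Definition round_bit n (i : 'I_n * option 'I_(n.+1 ^ 2)) (y : RN) : bool :=
  if i.2 is Some k then (k < Num.trunc (`|y i.1 : R| * n.+1%:R))%N else (y i.1 < 0)%R.

(** Finitely many bits that determine the rounded parameter: they make every map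
    of the rounded parameter a simple map, whatever its regularity. *)
Definition round_code n (y : RN) : {ffun 'I_n * option 'I_(n.+1 ^ 2) -> bool} :=
  [ffun i => round_bit i y].

Definition round_decode n (c : {ffun 'I_n * option 'I_(n.+1 ^ 2) -> bool}) : RN := fun j =>
  if insub j is Some i then
    (-1) ^+ c (i, None) * ((\sum_k c (i, Some k))%N%:R / n.+1%:R)
  else 0.

Lemma sum_ltn (N m : nat) : (\sum_(k < N) (k < m) = minn m N)%N.
Proof.
elim: N => [|N IH]; first by rewrite big_ord0 minn0.
by rewrite big_ord_recr/= IH; case: ltngtP => h; lia.
Qed.

Lemma round_codeK n (y : RN) : round_decode (round_code n y) = rounding n y.
Proof.
apply/funext => j; rewrite /round_decode /rounding.
case: insubP => [i _ <-|/negbTE -> //].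
rewrite ltn_ord /quantize ffunE/=; congr (_ * (_%:R / _)).
by rewrite /round_level -sum_ltn; apply: eq_bigr => k _; rewrite ffunE.
Qed.

Lemma round_decode_supp n c j : (n <= j)%N -> @round_decode n c j = 0.
Proof. by rewrite /round_decode leqNgt => /negbTE nj; case: insubP => // i; rewrite nj. Qed.

Lemma measurable_round_code n c : measurable [set y : RN | round_code n y = c].
Proof.
have mbit (i : 'I_n * option 'I_(n.+1 ^ 2)) : measurable [set y : RN | round_bit i y].
  rewrite /round_bit; case: i => i [k|]/=.
    rewrite (_ : [set y : RN | _] = (fun y : RN => `|y i : R| * n.+1%:R) @^-1` `[k.+1%:R, +oo[%classic).
      rewrite -[X in measurable X]setTI.
      have m : measurable_fun setT (fun y : RN => `|y i| * n.+1%:R : measurableTypeR R).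
        apply: measurable_funM => //; apply: measurableT_comp; first exact: normr_measurable.
        exact: measurable_coord_RN.
      by apply: m => //; exact: measurable_itv.
    by apply/seteqP; split => y /=; rewrite in_itv/= andbT truncn_gt_nat.
  rewrite (_ : [set y : RN | _] = (fun y : RN => y i) @^-1` `]-oo, (0 : R)[%classic).
    rewrite -[X in measurable X]setTI.
    exact: (measurable_coord_RN i measurableT (measurable_itv _)).
  by apply/seteqP; split => y /=; rewrite in_itv.
rewrite (_ : [set y : RN | _] = \bigcap_(i in [set: 'I_n * option 'I_(n.+1 ^ 2)]) [set y | round_bit i y = c i]).
  apply: fin_bigcap_measurable => [|i _]; first exact: finite_finset.
  case: (c i); first exact: mbit.
  rewrite (_ : [set y | _] = ~` [set y | round_bit i y]); first exact: measurableC.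
  by apply/seteqP; split => y /=; case: (round_bit i y).
apply/seteqP; split => y /=.
  by move=> <- i _; rewrite ffunE.
by move=> h; apply/ffunP => i; rewrite ffunE; exact: h.
Qed.

End Rounding.

(** * The mean of the truncation error *)

Lemma err_arith {R : realType} (c x x' z z' : R) : 0 <= c -> 0 <= x' -> x' <= x ->
  1 <= z' -> z' <= z -> c * x' * ((z' - 1) * z') <= c * x * ((z - 1) * z).
Proof.
move=> c0 x0 xx z1 zz; have z0 : 0 <= z' by lra.
apply: ler_pM; first exact: mulr_ge0.
- by rewrite mulr_ge0// subr_ge0.
- by rewrite ler_wpM2l.
- by apply: ler_pM => //; [rewrite subr_ge0|rewrite lerB].
Qed.

Lemma second_arith {R : realType} (c bj t y w S : R) : 0 <= c -> 0 <= bj -> `|t| <= `|y| ->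
  w <= S -> 3 * c * (bj * `|t|) ^+ 2 * expR (5 * (bj * `|t|)) * expR w <=
  3 * c * bj ^+ 2 * (expR S * (`|y| ^+ 2 * expR (5 * (bj * `|y|)))).
Proof.
move=> c0 b0 ty wS.
have h1 : `|t| ^+ 2 <= `|y| ^+ 2 by rewrite ler_pXn2r// nnegrE.
have h2 : expR (5 * (bj * `|t|)) <= expR (5 * (bj * `|y|)).
  by rewrite ler_expR !ler_wpM2l.
have h3 : expR w <= expR S by rewrite ler_expR.
rewrite (_ : 3 * c * (bj * `|t|) ^+ 2 * _ * _ =
  3 * c * bj ^+ 2 * (expR w * (`|t| ^+ 2 * expR (5 * (bj * `|t|))))); last by ring.
rewrite ler_wpM2l//; first by rewrite mulr_ge0 ?sqr_ge0// mulr_ge0.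
by apply: ler_pM => //; apply: ler_pM.
Qed.

Lemma half_arith {R : realType} (x q : R) : 0 <= q -> x + x <= q -> x <= q.
Proof. lra. Qed.

Section Expectation.
Context {R : realType} {V : lmodType R}.
Local Notation RN := (@RN R).
Variables (E : set V) (Bd : V -> V -> R).
Hypotheses (hE : is_subspace E) (hB : psd_form E Bd).
Local Notation nrm := (form_norm Bd).
Hypothesis complete : forall w : nat -> V, (forall n, E (w n)) ->
  (forall e : R, 0 < e -> exists N, forall m n, (N <= m)%N -> (N <= n)%N ->
     nrm (w m - w n) <= e) ->
  exists I, E I /\ (fun n => nrm (w n - I)) @ \oo --> (0 : R).
Variables (b : nat -> R) (P : probability RN R) (C K : R) (u : RN -> V).
Hypotheses (b0 : forall j, 0 <= b j) (C0 : 0 <= C) (K0 : 0 <= K)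
  (hflip : forall j A, measurable A -> P (flip_coord j @^-1` A) = P A)
  (uE : forall y, Uset b y -> E (u y))
  (u_bound : forall y, Uset b y -> nrm (u y) <= C * expR (wsum b y))
  (u_cont : forall y z, Uset b y -> Uset b z -> wsum b z <= wsum b y ->
    nrm (u y - u z) <= C * expR (wsum b y) * ((expR (ydist b y z) - 1) * expR (ydist b y z)))
  (u_second : forall z j t, Uset b z -> z j = 0 ->
    nrm (u (set_coord z j t) + u (set_coord z j (- t)) - 2 *: u z) <=
    3 * C * (b j * `|t|) ^+ 2 * expR (5 * (b j * `|t|)) * expR (wsum b z))
  (moment : (\int[P]_(y in Uset b) (expR (wsum b y))%:E <= K%:E)%E).

Lemma cvg0_le (h : nat -> R) (e : R) : h @ \oo --> (0 : R) -> 0 < e ->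
  \forall n \near \oo, `|h n| <= e.
Proof.
move=> h0 e0; have h1 : \forall n \near \oo, `|0 - h n| <= e.
  exact: ((cvgrPdist_le _ _).1 h0 e e0).
by apply: filterS h1 => n; rewrite sub0r normrN.
Qed.

Local Notation U := (Uset b).
Local Notation rho := (@rounding R).
Let mU : measurable U := measurable_Uset b0.

Lemma rounding_U n y : U y -> U (rho n y) /\ wsum b (rho n y) <= wsum b y.
Proof. by move=> Uy; apply: (wsum_mono b0 Uy) => j; exact: rounding_abs. Qed.

Lemma truncate_U s y : U y -> U (truncate s y) /\ wsum b (truncate s y) <= wsum b y.
Proof.
move=> Uy; apply: (wsum_mono b0 Uy) => j; rewrite /truncate.
by case: ifP; rewrite ?normr0.
Qed.

Lemma decode_U n c : U (@round_decode R n c).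
Proof.
have h j : (n <= j)%N -> b j * `|@round_decode R n c j| = 0.
  by move=> /round_decode_supp ->; rewrite normr0 mulr0.
by have [] := nnsum_finite (weight_ge0 b0 _) h.
Qed.

Lemma ydist_rounding_ge0 n y : 0 <= ydist b y (rho n y).
Proof. by apply: nnsum_ge0 => j; rewrite mulr_ge0. Qed.

Lemma ydist_rounding_cvg y : U y -> (fun n => ydist b y (rho n y)) @ \oo --> (0 : R).
Proof.
move=> Uy; apply: (nnsum_tannery (weight_ge0 b0 y) Uy) => [n j|j].
  by rewrite mulr_ge0//= ler_wpM2l// rounding_dist_le.
rewrite -[X in _ --> X](mulr0 (b j)); apply: cvgM; first exact: cvg_cst.
exact: rounding_cvg.
Qed.

Lemma ydist_truncate s n y : U y ->
  ydist b (truncate s y) (rho n (truncate s y)) <= ydist b y (rho n y).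
Proof.
move=> Uy; have [Ur _] := rounding_U n Uy.
have [//|_ ->//] := @nnsum_mono R (fun j => b j * `|truncate s y j - rho n (truncate s y) j|)
  (fun j => b j * `|y j - rho n y j|) _ (ydist_fin b0 Uy Ur).
move=> j; rewrite mulr_ge0//= -truncate_rounding /truncate.
by case: ifP => // _; rewrite subrr normr0 mulr0 mulr_ge0.
Qed.

Section Truncation.
Variable s : nat.
Local Notation F := (fun y => u y - u (truncate s y)).
Local Notation code := (@round_code R).
Local Notation g := (fun n c => F (@round_decode R n c)).

Lemma trunc_error_in y : U y -> E (F y).
Proof. by move=> Uy; apply: (subspaceB hE); apply: uE => //; have [] := truncate_U s Uy. Qed.

Lemma coded_error_in n c : E (g n c). Proof. exact/trunc_error_in/decode_U. Qed.

Lemma coded_errorE n y : g n (code n y) = F (rho n y). Proof. by rewrite /= round_codeK. Qed.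

Definition err n y := nrm (F y - F (rho n y)).

Lemma trunc_error_bound y : U y -> nrm (F y) <= 2 * C * expR (wsum b y).
Proof.
move=> Uy; have [Ut St] := truncate_U s Uy.
apply: (le_trans (form_triB hE hB (uE Uy) hE.1 (uE Ut))).
rewrite subr0 sub0r (form_normN hE hB (uE Ut)).
rewrite (_ : 2 * C * _ = C * expR (wsum b y) + C * expR (wsum b y)); last by ring.
apply: lerD; first exact: u_bound.
by apply: (le_trans (u_bound Ut)); rewrite ler_wpM2l// ler_expR.
Qed.

Lemma err_ge0 n y : 0 <= err n y. Proof. exact: form_norm_ge0. Qed.

Lemma err_bound n y : U y -> err n y <= 4 * C * expR (wsum b y).
Proof.
move=> Uy; have [Ur Sr] := rounding_U n Uy.
apply: (le_trans (form_triB hE hB (trunc_error_in Uy) hE.1 (trunc_error_in Ur))).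
rewrite subr0 sub0r (form_normN hE hB (trunc_error_in Ur)).
rewrite (_ : 4 * C * _ = 2 * C * expR (wsum b y) + 2 * C * expR (wsum b y)); last by ring.
apply: lerD; first exact: trunc_error_bound.
by apply: (le_trans (trunc_error_bound Ur)); rewrite ler_wpM2l ?mulr_ge0// ler_expR.
Qed.

Lemma err_le n y : U y -> err n y <=
  2 * C * expR (wsum b y) * ((expR (ydist b y (rho n y)) - 1) * expR (ydist b y (rho n y))).
Proof.
move=> Uy; have [Ur Sr] := rounding_U n Uy; have [Ut St] := truncate_U s Uy.
have [Utr Str] := rounding_U n Ut; have [Urt _] := truncate_U s Ur.
set e := ydist b y (rho n y).
have e0 : 0 <= e by exact: ydist_rounding_ge0.
rewrite /err (_ : F y - F (rho n y) =
  (u y - u (rho n y)) - (u (truncate s y) - u (rho n (truncate s y)))); last first.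
  by rewrite truncate_rounding !opprB addrACA [RHS]addrACA; congr (_ + _); rewrite addrC.
have E1 : E (u y - u (rho n y)) by apply: (subspaceB hE); exact: uE.
have E2 : E (u (truncate s y) - u (rho n (truncate s y))) by apply: (subspaceB hE); exact: uE.
apply: (le_trans (form_triB hE hB E1 hE.1 E2)); rewrite subr0 sub0r (form_normN hE hB E2).
rewrite (_ : 2 * C * _ * _ = C * expR (wsum b y) * ((expR e - 1) * expR e) +
   C * expR (wsum b y) * ((expR e - 1) * expR e)); last by ring.
apply: lerD; first exact: u_cont.
apply: (le_trans (u_cont Ut Utr Str)); set e' := ydist _ _ _.
have e'0 : 0 <= e' by exact: ydist_rounding_ge0.
have ee : e' <= e by exact: ydist_truncate.
have x1 : 1 <= expR e' by rewrite -expR0 ler_expR.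
have x2 : expR e' <= expR e by rewrite ler_expR.
have x3 : expR (wsum b (truncate s y)) <= expR (wsum b y) by rewrite ler_expR.
exact: (err_arith C0 (expR_ge0 _) x3 x1 x2).
Qed.

Lemma err_cvg y : U y -> (fun n => err n y) @ \oo --> (0 : R).
Proof.
move=> Uy; pose e n := ydist b y (rho n y).
apply: (squeeze_cvgr (f := fun=> 0)
  (h := fun n => 2 * C * expR (wsum b y) * ((expR (e n) - 1) * expR (e n)))).
- by apply: nearW => n; rewrite err_ge0 err_le.
- exact: cvg_cst.
have ce : (fun n => expR (e n)) @ \oo --> (1 : R).
  rewrite -[X in _ --> X]expR0; apply: (cvg_comp _ _ (ydist_rounding_cvg Uy)).
  exact: continuous_expR.
rewrite -[X in _ --> X](mulr0 (2 * C * expR (wsum b y))).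
apply: cvgM; first exact: cvg_cst.
rewrite -[X in _ --> X](mul0r (1 : R)); apply: cvgM => //.
by rewrite -[X in _ --> X](subrr (1 : R)); apply: cvgB => //; exact: cvg_cst.
Qed.

Lemma nrm_dist v w : E v -> E w -> `|nrm v - nrm w| <= nrm (v - w).
Proof.
move=> Ev Ew; rewrite ler_norml; apply/andP; split.
  rewrite lerNl opprB lerBlDr.
  have := form_triB hE hB Ew Ev hE.1; rewrite !subr0 => h; apply: (le_trans h).
  by rewrite (form_normBC hE hB Ew Ev).
by rewrite lerBlDr; have := form_triB hE hB Ev Ew hE.1; rewrite !subr0.
Qed.

Lemma sub_sub (x y z : V) : x - y - (z - y) = x - z.
Proof. by rewrite opprB subrKA. Qed.

(** The map u is only known to be continuous for the weighted distance; its rounding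
    error is a pointwise limit of errors between simple maps. *)
Lemma measurable_err n : measurable_fun U (err n).
Proof.
apply: (measurable_fun_cvg (h := fun m y => nrm (F (rho m y) - F (rho n y)))).
  move=> m; pose cc (y : RN) := (code m y, code n y).
  have mcc k : measurable [set y | cc y = k].
    rewrite (_ : [set y | _] = [set y | code m y = k.1] `&` [set y | code n y = k.2]).
      by apply: measurableI; exact: measurable_round_code.
    apply/seteqP; split => y /=; first by rewrite /cc => <-.
    by move=> [h1 h2]; rewrite /cc h1 h2; case: k {h1 h2}.
  have := measurable_code mcc (fun k => nrm (g m k.1 - g n k.2)) => /(measurable_funTS (D := U)).
  apply: eq_measurable_fun => y _; rewrite /cc /= !coded_errorE//.
move=> y Uy; have [Ur _] := rounding_U n Uy.
apply/cvgrPdist_le => e e0; have h := cvg0_le (err_cvg Uy) e0.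
near=> m.
have hm : `|err m y| <= e by near: m.
have [Um _] := rounding_U m Uy.
have E1 : E (F y - F (rho n y)) by apply: (subspaceB hE); exact: trunc_error_in.
have E2 : E (F (rho m y) - F (rho n y)) by apply: (subspaceB hE); exact: trunc_error_in.
apply: (le_trans (nrm_dist E1 E2)).
have -> : F y - F (rho n y) - (F (rho m y) - F (rho n y)) = F y - F (rho m y).
  exact: sub_sub.
exact: le_trans (ler_norm _) hm.
Unshelve. all: by end_near. Qed.

Lemma intg_exp (c : R) : 0 <= c -> P.-integrable U (EFin \o (fun y => c * expR (wsum b y))).
Proof.
move=> c0; apply: (intgZ mU); apply/integrableP; split.
  apply/measurable_EFinP; apply: measurable_funTS; apply: measurableT_comp => //.
  exact: measurable_wsum.
under eq_integral => y _ do rewrite /= ger0_norm ?expR_ge0//.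
exact: le_lt_trans moment (ltry K).
Qed.

Lemma int_exp : \int[P]_(y in U) expR (wsum b y) <= K.
Proof.
rewrite /Rintegral -lee_fin fineK//.
rewrite ge0_fin_numE; first exact: le_lt_trans moment (ltry K).
by apply: integral_ge0 => y _; rewrite lee_fin expR_ge0.
Qed.

Lemma intg_err n : P.-integrable U (EFin \o err n).
Proof.
apply: (intg_dom mU (measurable_err n) (intg_exp (c := 4 * C) _)).
  by rewrite mulr_ge0.
by move=> y Uy; rewrite ger0_norm ?err_ge0// err_bound.
Qed.

Lemma int_err_cvg : (fun n => \int[P]_(y in U) (err n y)%:E)%E @ \oo --> 0%E.
Proof.
have m n : measurable_fun U (fun y => (err n y)%:E) by apply/measurable_EFinP; exact: measurable_err.
have c : {ae P, forall y, U y -> (fun n => (err n y)%:E) @ \oo --> cst 0%E y}.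
  apply: aeW => y Uy; apply: cvg_EFin; first exact: nearW.
  exact: err_cvg.
have i : P.-integrable U (EFin \o (fun y => 4 * C * expR (wsum b y))).
  by apply: intg_exp; rewrite mulr_ge0.
have d : {ae P, forall y, forall n, U y ->
    (`|(err n y)%:E| <= (EFin \o (fun y => (4 * C * expR (wsum b y))%R)) y)%E}.
  by apply: aeW => y n Uy; rewrite /= lee_fin ger0_norm ?err_ge0// err_bound.
have [_ _] := dominated_convergence mU m (measurable_cst _) c i d.
by rewrite integral0.
Qed.

Definition rint n := simple_integral P U (code_map (code n) (g n)).

Lemma rintE n : E (rint n).
Proof. by apply: (subspace_sum hE) => k; apply: (subspaceZ hE); exact: coded_error_in. Qed.

Lemma rint_pairing n v : E v -> Bd (rint n) v = \int[P]_(y in U) Bd (F (rho n y)) v.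
Proof.
move=> Ev; rewrite /rint (simple_integral_pairing (@measurable_round_code R n) P mU hE hB)//.
  by apply: eq_Rintegral => y _; rewrite coded_errorE.
by move=> c; exact: coded_error_in.
Qed.

Lemma intg_rho n (h : RN -> R) : P.-integrable U (EFin \o (fun y => h (rho n y))).
Proof.
have := intg_code (@measurable_round_code R n) P mU (fun c => h (round_decode c)).
congr (_.-integrable _ (EFin \o _)); by apply/funext => y; rewrite round_codeK.
Qed.

(** Pair the difference of the two integrals with itself. *)
Lemma rint_dist m n : nrm (rint m - rint n) <=
  \int[P]_(y in U) err m y + \int[P]_(y in U) err n y.
Proof.
set w := rint m - rint n.
have Ew : E w by apply: (subspaceB hE); exact: rintE.
apply: sqr_le_mul; first exact: form_norm_ge0.
  by rewrite addr_ge0//; apply: Rintegral_ge0 => y _; exact: err_ge0.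
rewrite (form_norm_sqr hB Ew) {1}/w (formBl hB (rintE m) (rintE n) Ew) !rint_pairing//.
rewrite -RintegralB//; [|exact: (intg_rho m (fun z => Bd (F z) w))|exact: (intg_rho n (fun z => Bd (F z) w))].
rewrite -RintegralD//; [|exact: intg_err|exact: intg_err].
rewrite -RintegralZr//; last by apply: (intgD mU); exact: intg_err.
apply: le_Rintegral => //.
- apply: (intgB mU); [exact: (intg_rho m (fun z => Bd (F z) w))|exact: (intg_rho n (fun z => Bd (F z) w))].
- rewrite (_ : _ \o _ = EFin \o (fun y => nrm w * (err m y + err n y))).
    by apply: (intgZ mU); apply: (intgD mU); exact: intg_err.
  by apply/funext => y /=; rewrite mulrC.
move=> y Uy; have [Um _] := rounding_U m Uy; have [Un _] := rounding_U n Uy.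
rewrite -(formBl hB (trunc_error_in Um) (trunc_error_in Un) Ew); apply: (le_trans (ler_norm _)).
apply: (le_trans (form_cs hE hB (subspaceB hE (trunc_error_in Um) (trunc_error_in Un)) Ew)).
rewrite ler_wpM2r ?form_norm_ge0//.
apply: (le_trans (form_triB hE hB (trunc_error_in Um) (trunc_error_in Uy) (trunc_error_in Un))).
by rewrite (form_normBC hE hB (trunc_error_in Um) (trunc_error_in Uy)).
Qed.

(** The integral is the limit of the integrals of the rounded maps; it inherits
    every bound that their scalar components satisfy. *)
Lemma bochner_exists : exists I, is_bochner_integral P U E nrm F I /\
  forall Q, 0 <= Q -> (forall n v, E v -> \int[P]_(y in U) Bd (F (rho n y)) v <= Q * nrm v) ->
    nrm I <= Q.
Proof.
have ec : (fun n => \int[P]_(y in U) err n y) @ \oo --> (0 : R).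
  exact: fine_cvg int_err_cvg.
have [I [EI cI]] : exists I, E I /\ (fun n => nrm (rint n - I)) @ \oo --> (0 : R).
  apply: complete => [n|e e0]; first exact: rintE.
  have e20 : 0 < e / 2 by rewrite divr_gt0.
  have [N _ hN] := cvg0_le ec e20.
  exists N => m n Nm Nn; apply: (le_trans (rint_dist m n)); rewrite (splitr e).
  have := hN m Nm; have := hN n Nn => /= h1 h2.
  by apply: lerD; apply: le_trans (ler_norm _) _.
have cI' : (fun n => nrm (I - rint n)) @ \oo --> (0 : R).
  rewrite (_ : (fun n => _) = fun n => nrm (rint n - I))//.
  by apply/funext => n; rewrite (form_normBC hE hB EI (rintE n)).
exists I; split.
  split => //; exists (fun n => code_map (code n) (g n)); split => //.
  - by move=> n; apply: code_map_in => [k|k]; [exact: measurable_round_code|exact: coded_error_in].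
  - apply: aeW => y Uy; rewrite (_ : (fun n => _) = err ^~ y); first exact: err_cvg.
    by apply/funext => n; rewrite code_map_eval coded_errorE.
  - rewrite (_ : (fun n => _) = fun n => (\int[P]_(y in U) (err n y)%:E)%E); first exact: int_err_cvg.
    by apply/funext => n; apply: eq_integral => y _; rewrite code_map_eval coded_errorE.
move=> Q Q0 hQ.
have rQ n : nrm (rint n) <= Q.
  apply: sqr_le_mul => //; first exact: form_norm_ge0.
  by rewrite (form_norm_sqr hB (rintE n)) rint_pairing ?hQ//; exact: rintE.
apply/ler_addgt0Pr => e e0.
have [N _ /(_ N (leqnn N)) hN] := cvg0_le cI' e0.
have := form_triB hE hB EI (rintE N) hE.1; rewrite !subr0 => h; apply: (le_trans h).
by rewrite addrC lerD// (le_trans (ler_norm _)).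
Qed.

(** Only used for small s, where no rate has to be shown. *)
Lemma crude_bound n v : E v -> \int[P]_(y in U) Bd (F (rho n y)) v <= 2 * C * K * nrm v.
Proof.
move=> Ev; have CC : 0 <= 2 * C * nrm v by rewrite !mulr_ge0// form_norm_ge0.
apply: (@le_trans _ _ (\int[P]_(y in U) (2 * C * nrm v * expR (wsum b y)))).
  apply: le_Rintegral => //; [exact: (intg_rho n (fun z => Bd (F z) v))|exact: intg_exp|].
  move=> y Uy; have [Ur Sr] := rounding_U n Uy.
  apply: (le_trans (ler_norm _)); apply: (le_trans (form_cs hE hB (trunc_error_in Ur) Ev)).
  rewrite mulrAC ler_wpM2r ?form_norm_ge0//; apply: (le_trans (trunc_error_bound Ur)).
  by rewrite ler_wpM2l ?mulr_ge0// ler_expR.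
rewrite RintegralZl//; last first.
  have := intg_exp ler01; congr (_.-integrable _ (EFin \o _)).
  by apply/funext => y; rewrite mul1r.
rewrite (_ : 2 * C * K * nrm v = 2 * C * nrm v * K); last by ring.
by rewrite ler_wpM2l// int_exp.
Qed.

Lemma flip_U j : flip_coord j @^-1` U = U.
Proof.
apply/seteqP; split => y; rewrite /Uset/= => h; move: h; congr (_ < _)%E; congr (limn _).
  apply/funext => n; apply: eq_bigr => k _; rewrite /flip_coord.
  by case: ifP => _; rewrite ?normrN.
apply/funext => n; apply: eq_bigr => k _; rewrite /flip_coord.
by case: ifP => _; rewrite ?normrN.
Qed.

Lemma flip_Rintegral j n (h : RN -> R) :
  \int[P]_(y in U) h (rho n y) = \int[P]_(y in U) h (flip_coord j (rho n y)).
Proof.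
pose f y := (h (rho n y))%:E.
have mf : measurable_fun setT f.
  apply/measurable_EFinP.
  have := measurable_code (@measurable_round_code R n) (fun c => h (round_decode c)).
  by apply: eq_measurable_fun => y _; rewrite round_codeK.
have i : P.-integrable (flip_coord j @^-1` U) (f \o flip_coord j).
  rewrite flip_U; have := intg_rho n (fun z => h (flip_coord j z)).
  by congr (_.-integrable _ _); apply/funext => y; rewrite /f/= rounding_flip.
rewrite /Rintegral; congr fine.
have := integral_pushforward (measurable_flip j) mf i mU; rewrite flip_U.
rewrite (_ : (\int[P]_(x in U) (f \o flip_coord j) x)%E =
  (\int[P]_(x in U) (h (flip_coord j (rho n x)))%:E)%E); last first.
  by apply: eq_integral => y _; rewrite /f/= rounding_flip.
move=> <-; apply: eq_measure_integral; first exact: measurable_flip.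
by move=> mr A mA _; exact/esym/hflip.
Qed.

Variable (s0 : nat).
Hypothesis moment2 : forall j, (s0 <= j)%N -> (\int[P]_y (expR (\sum_(i < j) b i * `|y i|) *
  (`|y j| ^+ 2 * expR (5 * (b j * `|y j|))))%:E <= K%:E)%E.

Local Notation X j := (fun y : RN => expR (\sum_(i < j) b i * `|y i|) *
  (`|y j| ^+ 2 * expR (5 * (b j * `|y j|)))).

Lemma weighted_sqr_ge0 j (y : RN) : 0 <= X j y.
Proof. by rewrite mulr_ge0 ?expR_ge0// mulr_ge0 ?expR_ge0// sqr_ge0. Qed.

Lemma measurable_weighted_sqr j : measurable_fun setT (X j : RN -> measurableTypeR R).
Proof.
have mexp (h : RN -> R) : measurable_fun setT (h : RN -> measurableTypeR R) ->
    measurable_fun setT (fun y => expR (h y)).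
  by move=> mh; apply: measurableT_comp; [exact: measurable_expR|exact: mh].
apply: measurable_funM.
  by apply: mexp; apply: measurable_sum => i; exact: measurable_weight.
apply: measurable_funM.
  apply: measurable_funX; apply: measurableT_comp; first exact: normr_measurable.
  exact: measurable_coord_RN.
by apply: mexp; apply: measurable_funM => //; exact: measurable_weight.
Qed.

Lemma int_weighted_sqr j : (s0 <= j)%N ->
  P.-integrable U (EFin \o X j) /\ \int[P]_(y in U) X j y <= K.
Proof.
move=> js.
have le : (\int[P]_(y in U) (X j y)%:E <= K%:E)%E.
  apply: le_trans (moment2 js); apply: ge0_subset_integral => //.
  by apply/measurable_EFinP; exact: measurable_weighted_sqr.
have ge : (0 <= \int[P]_(y in U) (X j y)%:E)%E.
  by apply: integral_ge0 => y _; rewrite lee_fin weighted_sqr_ge0.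
split.
  apply/integrableP; split.
    by apply/measurable_EFinP; exact: measurable_funTS (measurable_weighted_sqr j).
  under eq_integral => y _ do rewrite /= ger0_norm ?weighted_sqr_ge0//.
  exact: le_lt_trans le (ltry K).
by rewrite /Rintegral -lee_fin fineK// ge0_fin_numE// (le_lt_trans le (ltry K)).
Qed.

Local Notation incr j v := (fun z => Bd (u (truncate j.+1 z)) v - Bd (u (truncate j z)) v).

(** Averaging over the reflection of y_j turns the increment in the coordinate j
    into half a second difference. *)
Lemma symmetric_increment j n v y : E v -> U y ->
  incr j v (rho n y) + incr j v (flip_coord j (rho n y)) <=
  3 * C * b j ^+ 2 * nrm v * X j y.
Proof.
move=> Ev Uy; have [Ur _] := rounding_U n Uy; have [Ut _] := truncate_U j Ur.
set z := truncate j (rho n y) in Ut *; set t := rho n y j.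
have e1 : truncate j.+1 (rho n y) = set_coord z j t.
  apply/funext => k; rewrite /set_coord /z /truncate /t ltnS leq_eqVlt.
  by case: eqP => [->|].
have e2 : truncate j.+1 (flip_coord j (rho n y)) = set_coord z j (- t).
  apply/funext => k; rewrite /set_coord /z /truncate /t ltnS leq_eqVlt /flip_coord.
  by case: eqP => [->|].
have e3 : truncate j (flip_coord j (rho n y)) = z.
  apply/funext => k; rewrite /z /truncate /flip_coord.
  by case: ifP => // kj; rewrite ltn_eqF.
rewrite e1 e2 e3 -/z.
have zj : z j = 0 by rewrite /z /truncate ltnn.
have [Up _] := wsum_set_coord b0 j t Ut; have [Um _] := wsum_set_coord b0 j (- t) Ut.
have Ep := uE Up; have Em := uE Um; have Ez := uE Ut.
have E2 : E (2 *: u z) by exact: (subspaceZ hE).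
have Epm : E (u (set_coord z j t) + u (set_coord z j (- t))) by exact: (subspaceD hE).
have Ew : E (u (set_coord z j t) + u (set_coord z j (- t)) - 2 *: u z) by exact: (subspaceB hE).
rewrite (_ : _ + _ = Bd (u (set_coord z j t) + u (set_coord z j (- t)) - 2 *: u z) v); last first.
  by rewrite (formBl hB Epm E2 Ev) (formDl hB Ep Em Ev) (formZl hE hB 2 Ez Ev) mulr_natl mulr2n opprD addrACA.
apply: (le_trans (ler_norm _)); apply: (le_trans (form_cs hE hB Ew Ev)).
rewrite mulrAC ler_wpM2r ?form_norm_ge0//; apply: (le_trans (u_second t Ut zj)).
apply: second_arith => //; first exact: rounding_abs.
have zs k : (j <= k)%N -> b k * `|z k| = 0.
  by rewrite leqNgt /z /truncate => /negbTE ->; rewrite normr0 mulr0.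
have [_ h] := nnsum_finite (fun k => mulr_ge0 (b0 k) (normr_ge0 (z k))) zs.
apply: (le_trans h); apply: ler_sum => k _; rewrite ler_wpM2l// /z /truncate ltn_ord.
exact: rounding_abs.
Qed.

Lemma int_increment j n v : E v -> (s0 <= j)%N ->
  \int[P]_(y in U) incr j v (rho n y) <= 3 * C * b j ^+ 2 * nrm v * K.
Proof.
move=> Ev js; have [iX leX] := int_weighted_sqr js.
have c0 : 0 <= 3 * C * b j ^+ 2 * nrm v by rewrite !mulr_ge0 ?sqr_ge0// form_norm_ge0.
set a := \int[P]_(y in U) _.
apply: half_arith; first by rewrite mulr_ge0.
have i1 := intg_rho n (incr j v); have i2 := intg_rho n (fun z => incr j v (flip_coord j z)).
rewrite {2}/a (flip_Rintegral j n (incr j v)) /a -(RintegralD mU i1 i2).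
apply: (@le_trans _ _ (\int[P]_(y in U) (3 * C * b j ^+ 2 * nrm v * X j y))).
  apply: le_Rintegral => //; [exact: (intgD mU i1 i2)|exact: (intgZ mU)|].
  by move=> y Uy; exact: symmetric_increment.
by rewrite RintegralZl// ler_wpM2l.
Qed.

(** Only finitely many increments occur after rounding. *)
Lemma telescoped_bound (T : R) n v : E v -> (s0 <= s)%N ->
  (forall m, \sum_(s <= j < m) b j ^+ 2 <= T) ->
  \int[P]_(y in U) Bd (F (rho n y)) v <= 3 * C * K * T * nrm v.
Proof.
move=> Ev s0s hT.
pose diff m z := Bd (u (truncate m z)) v - Bd (u (truncate s z)) v.
have c0 : 0 <= 3 * C * K * nrm v by rewrite !mulr_ge0// form_norm_ge0.
have step m : (s <= m)%N -> \int[P]_(y in U) diff m (rho n y) <=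
    3 * C * K * nrm v * \sum_(s <= j < m) b j ^+ 2.
  move=> /subnKC <-; elim: (m - s)%N => [|k IH].
    rewrite addn0 big_geq// mulr0 (_ : \int[P]_(y in U) _ = 0)//.
    rewrite (_ : (fun y => _) = fun=> 0); first by rewrite /Rintegral integral0.
    by apply/funext => y; rewrite /diff subrr.
  rewrite addnS big_nat_recr ?leq_addr//= mulrDr.
  rewrite (_ : \int[P]_(y in U) _ = \int[P]_(y in U) diff (s + k)%N (rho n y) +
     \int[P]_(y in U) incr (s + k)%N v (rho n y)); last first.
    rewrite -RintegralD//; [|exact: intg_rho|exact: (intg_rho n (incr (s + k)%N v))].
    by apply: eq_Rintegral => y _; rewrite /diff [RHS]addrC subrKA.
  apply: lerD => //.
  apply: (le_trans (int_increment n Ev (leq_trans s0s (leq_addr k s)))).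
  rewrite le_eqVlt; apply/orP; left; apply/eqP; ring.
have := step (maxn n s) (leq_maxr n s).
rewrite (_ : \int[P]_(y in U) diff _ _ = \int[P]_(y in U) Bd (F (rho n y)) v); last first.
  apply: eq_Rintegral => y /set_mem Uy; have [Ur _] := rounding_U n Uy.
  have [Ut _] := truncate_U s Ur.
  rewrite (formBl hB (uE Ur) (uE Ut) Ev) /diff; congr (Bd (u _) v - _).
  apply/funext => k; rewrite /truncate; case: ifP => //; rewrite leq_max => /negbT.
  by rewrite negb_or => /andP[/negbTE kn _]; rewrite /rounding kn.
move=> h; apply: (le_trans h).
rewrite (_ : 3 * C * K * T * nrm v = 3 * C * K * nrm v * T); last by ring.
by rewrite ler_wpM2l.
Qed.

End Truncation.
End Expectation.

(** * The convergence rate *)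

Section Rate.
Context {R : realType} {d : nat}.
Local Notation leb := (@lebesgue_rV R d).
Local Notation RN := (@RN R).
Local Notation fT := ('rV[R]_d -> R).
Implicit Types (D : set 'rV[R]_d).

Lemma finite_dim_subspaceP D (W : set fT) : open D -> bounded_set D ->
  finite_dim_subspace D W -> is_subspace W /\ W `<=` H10 D.
Proof.
move=> oD bD [m [e [He ->]]]; split; last by move=> v [].
split.
  split; first exact: (H10_subspace oD bD).1.
  exists (fun=> 0); apply: aeW => x _; rewrite big1// => k _; exact: mul0r.
move=> c v w [hv [cv ev]] [hw [cw ew]]; split; first exact: (H10_subspace oD bD).2.
exists (fun k => c * cv k + cw k); apply: filterS2 ev ew => x + + Dx => /(_ Dx) hx /(_ Dx) hy.
rewrite -[LHS]/(c * v x + w x) hx hy mulr_sumr -big_split/=.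
by apply: eq_bigr => k _; rewrite mulrDl mulrA.
Qed.

Lemma Linf_plus_bounds D (a0 : fT) : open D -> Linf_plus D a0 ->
  exists amin amax : R, [/\ measurable_fun D a0, 0 < amin &
    {ae leb, forall x, D x -> amin <= a0 x <= amax}].
Proof.
move=> oD [/(Linf_bound oD)[ma0 _ amax] e0].
have [amin [amin0 hmin]] : exists r : R, 0 < r /\ (r%:E <= ess_inf_on D a0)%E.
  move: e0; case: (ess_inf_on D a0) => [r r0|_|]//.
    by exists r; rewrite lexx -lte_fin.
  by exists 1; rewrite ltr01 leey.
exists amin, (Linf_norm D a0); split => //.
have h : \forall x \ae leb, (ess_inf_on D a0 <= patch (fun=> +oo%E) D (EFin \o a0) x)%E.
  exact: ess_inf_le.
apply: filterS2 amax h => x + + Dx => /(_ Dx) h1; rewrite /patch mem_set//= => h2.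
by rewrite -lee_fin (le_trans hmin h2)/= (le_trans (ler_norm _) h1).
Qed.

(** For s <= s0 the power s^r is bounded below, so that a bound without rate can be
    absorbed in the constant. *)
Lemma rate_arith (K C C1 r s s0 : R) : 0 <= K -> 0 <= C -> 0 <= C1 -> r <= 0 ->
  0 < s -> s <= s0 ->
  2 * C * K <= (3 * C * K * C1 + 2 * C * K * s0 `^ (- r) + 1) * s `^ r.
Proof.
move=> K0 C0 C10 r0 spos ss0.
have sr : 0 < s `^ r by exact: powR_gt0.
have h1 : 1 <= s0 `^ (- r) * s `^ r.
  rewrite -[r in s `^ r]opprK [s `^ _]powRN ler_pdivlMr ?powR_gt0// mul1r.
  apply: ge0_ler_powR; rewrite ?nnegrE ?oppr_ge0//; first exact: ltW.
  exact: le_trans (ltW spos) ss0.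
have CK : 0 <= 2 * C * K by rewrite !mulr_ge0.
have := ler_wpM2l CK h1; rewrite mulr1 => h2; apply: (le_trans h2).
rewrite mulrA ler_wpM2r//; first exact: ltW.
have : 0 <= 3 * C * K * C1 by rewrite !mulr_ge0.
lra.
Qed.

(** The spaces W of test functions of the exact and of the finite element problem
    are treated alike: the energy estimates only test with elements of W, and the
    integral is taken in the complete space H^1_0(D). *)
Lemma weak_error_rate D (f : fT -> R) (a0 : fT) (psi : nat -> fT) (b : nat -> R) (p beta : R)
  (P : probability RN R) (W : set fT) (u : RN -> fT) :
  (0 < d)%N -> open D -> bounded_set D -> H10_dual D f -> Linf_plus D a0 ->
  (forall j, Lspace_on +oo D (psi j)) -> (forall j, b j = Linf_norm D (psi j)) ->
  (forall j, b j.+1 <= b j) -> 0 < p < 1 ->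
  (\sum_(0 <= j <oo) (b j `^ p)%:E < +oo)%E ->
  1 < beta \/ (beta = 1 /\ forall j, b j < 1) -> is_product_gen_gaussian beta P ->
  is_subspace W -> W `<=` H10 D ->
  (forall y, Uset b y -> variational_solution D (lognormal_coeff a0 psi y) f W (u y)) ->
  exists C : R, 0 < C /\ forall s : nat, (0 < s)%N ->
     exists I : fT,
       is_bochner_integral P (Uset b) (H10 D) (H10_norm D)
         (fun y => u y - u (truncate s y)) I /\
       H10_norm D I <= C * s%:R `^ (- (2 / p) + 1).
Proof.
move=> d0 oD bD hf ha0 hpsi hb bmono hp hbp hbeta hP hW WH hu.
have b0 j : 0 <= b j by rewrite hb; have [] := Linf_bound oD (hpsi j).
have mpsi j : measurable_fun D (psi j) by have [] := Linf_bound oD (hpsi j).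
have psib j : {ae leb, forall x, D x -> `|psi j x| <= b j}.
  by rewrite hb; have [] := Linf_bound oD (hpsi j).
have [amin [amax [ma0 amin0 a0b]]] := Linf_plus_bounds oD ha0.
have [B [K [B0 K0 m1 m2]]] := wsum_moments b0 hP bmono (lp_l1 b0 bmono hp hbp) hbeta.
have B10 : 0 < B / 10 by rewrite divr_gt0.
have [s0 [s0pos hs0]] := lp_small b0 bmono hp hbp B10.
have [C1 [C10 htail]] := lp_tail b0 bmono hp hbp.
have [C [C0 e1 e2 e3]] := solution_estimates oD bD b0 mpsi psib ma0 amin0 a0b hf hW WH hu.
have nE : H10_norm D = form_norm (dirichlet D) by apply/funext => v; exact: H10_normE.
rewrite nE in e1 e2 e3 *.
have hE := H10_subspace oD bD.
have hB : psd_form (H10 D : set fT) (dirichlet D).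
  by apply: psd_form_sub (dirichlet_psd oD bD) => v; exact: H10_H1.
have uE y : Uset b y -> H10 D (u y) by move=> /hu[/WH].
have r0 : - (2 / p) + 1 <= 0.
  have [p0 p1] := andP hp.
  by rewrite addrC subr_le0 ler_pdivlMr// mul1r; lra.
have m2' j : (s0 <= j)%N -> (\int[P]_y (expR (\sum_(i < j) b i * `|y i|) *
      (`|y j| ^+ 2 * expR (5 * (b j * `|y j|))))%:E <= K%:E)%E by move=> /hs0; exact: m2.
exists (3 * C * K * C1 + 2 * C * K * s0%:R `^ (- (- (2 / p) + 1)) + 1); split.
  by rewrite ltr_wpDl// addr_ge0// !mulr_ge0// powR_ge0.
move=> s spos; have sR : (0 : R) < s%:R by rewrite ltr0n.
have [I [bI hI]] := bochner_exists hE hB (fun w => @H10_complete _ _ _ oD bD d0 w)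
  b0 C0 uE e1 e2 m1 s.
exists I; split => //.
have [ss0|ss0] := leqP s0 s; last first.
  apply: (@le_trans _ _ (2 * C * K)); last by apply: rate_arith => //; rewrite ler_nat ltnW.
  apply: hI; first by rewrite !mulr_ge0.
  by move=> n v hv; exact: (crude_bound hE hB b0 C0 uE e1 m1 s n hv).
apply: (@le_trans _ _ (3 * C * K * (C1 * s%:R `^ (- (2 / p) + 1)))).
  apply: hI; first by rewrite !mulr_ge0// powR_ge0.
  move=> n v hv; apply: (telescoped_bound hE hB b0 C0 K0 (flip_invariant hP) uE e3 m2') => // m.
  exact: htail.
rewrite mulrA ler_wpM2r ?powR_ge0// -addrA lerDl addr_ge0//.
by rewrite !mulr_ge0// powR_ge0.
Qed.

End Rate.

Theorem mainTheorem3 (R : realType) (d : nat) (hd : (1 <= d <= 3)%N)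
    (D : set 'rV[R]_d) (hD : lipschitz_domain D)
    (f : ('rV[R]_d -> R) -> R) (hf : H10_dual D f)
    (a0 : 'rV[R]_d -> R) (ha0 : Linf_plus D a0)
    (psi : nat -> 'rV[R]_d -> R) (hpsi : forall j, Lspace_on +oo D (psi j))
    (b : nat -> R) (hb : forall j, b j = Linf_norm D (psi j))
    (hbmono : forall j, b j.+1 <= b j)
    (p : R) (hp : 0 < p < 1)
    (hbp : (\sum_(0 <= j <oo) (b j `^ p)%:E < +oo)%E)
    (u : @RN R -> 'rV[R]_d -> R)
    (hu : forall y, Uset b y ->
       variational_solution D (lognormal_coeff a0 psi y) f (H10 D) (u y))
    (beta : R) (hbeta : 1 < beta \/ (beta = 1 /\ forall j, b j < 1))
    (P : probability (@RN R) R) (hP : is_product_gen_gaussian beta P) :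
  (exists C : R, 0 < C /\ forall s : nat, (0 < s)%N ->
     exists I : 'rV[R]_d -> R,
       is_bochner_integral P (Uset b) (H10 D) (H10_norm D)
         (fun y => u y - u (truncate s y)) I /\
       H10_norm D I <= C * s%:R `^ (- (2 / p) + 1)) /\
  (polyhedral D ->
   forall (Xh : R -> set ('rV[R]_d -> R))
     (hXh : forall h : R, 0 < h -> finite_dim_subspace D (Xh h))
     (uh : R -> @RN R -> 'rV[R]_d -> R)
     (huh : forall h : R, 0 < h -> forall y, Uset b y ->
        variational_solution D (lognormal_coeff a0 psi y) f (Xh h) (uh h y)),
   forall h : R, 0 < h ->
   exists C : R, 0 < C /\ forall s : nat, (0 < s)%N ->
     exists I : 'rV[R]_d -> R,
       is_bochner_integral P (Uset b) (H10 D) (H10_norm D)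
         (fun y => uh h y - uh h (truncate s y)) I /\
       H10_norm D I <= C * s%:R `^ (- (2 / p) + 1)).
Proof.
have [oD _ _ bD _] := hD; have d0 : (0 < d)%N by case/andP: hd.
split.
  exact: (weak_error_rate d0 oD bD hf ha0 hpsi hb hbmono hp hbp hbeta hP
    (H10_subspace oD bD) (fun v hv => hv) hu).
move=> _ Xh hXh uh huh h h0.
have [hW WH] := finite_dim_subspaceP oD bD (hXh h h0).
exact: (weak_error_rate d0 oD bD hf ha0 hpsi hb hbmono hp hbp hbeta hP hW WH (huh h h0)).
Qed.
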